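(* For $0\le\alpha<1$, the sharp $\mathscr{S}^*_{\wp,n}$-radius of $\mathcal{CS}_n(\alpha)$ is $$R_{\mathscr{S}^*_{\wp,n}}(\mathcal{CS}_n(\alpha))=\left(\frac{1/e}{\sqrt{(1+n-\alpha)^2-\frac1e\left(2(1-\alpha)-\frac1e\right)}+1+n-\alpha}\right)^{1/n}.$$
   Context: $\mathbb{D}$ is the unit disk. For $n\ge1$, $\mathcal{A}_n$ is the class of analytic $f$ on $\mathbb{D}$ of the form $f(z)=z+\sum_{k\ge n+1}b_kz^k$, $\mathcal{A}=\mathcal{A}_1$. $f\prec g$ means $f=g\circ\omega$ for analytic $\omega:\mathbb{D}\to\mathbb{D}$, $\omega(0)=0$. $\wp(z)=1+ze^z$, $\mathscr{S}^*_\wp=\{f\in\mathcal{A}:zf'/f\prec\wp\}$, $\mathscr{S}^*_{\wp,n}=\mathcal{A}_n\cap\mathscr{S}^*_\wp$. $\mathcal{P}_n$ is the class of analytic $p(z)=1+\sum_{k\ge n}c_kz^k$ with $\operatorname{Re}p>0$. $\mathcal{S}^*_n(\alpha)=\{g\in\mathcal{A}_n:\operatorname{Re}(zg'/g)>\alpha\}$ and $\mathcal{CS}_n(\alpha)=\{f\in\mathcal{A}_n: f/g\in\mathcal{P}_n \text{ for some } g\in\mathcal{S}^*_n(\alpha)\}$. For classes $G_1,G_2$, $R_{G_1}(G_2)$ is the largest $r_0\in(0,1]$ such that $r^{-1}f(rz)\in G_1$ for all $0<r\le r_0$ and all $f\in G_2$; ''sharp'' means it cannot be increased. *)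

(* Defs.v *)
From Stdlib Require Import Reals.
From Coquelicot Require Import Coquelicot.
Open Scope R_scope.

Definition inD (z : C) : Prop := Cmod z < 1.

Definition cexp (z : C) : C :=
  (exp (Re z) * cos (Im z), exp (Re z) * sin (Im z)).

Definition wp (z : C) : C := Cplus 1 (Cmult z (cexp z)).

Definition analyticD (f : C -> C) : Prop :=
  exists a : nat -> C, forall z, inD z ->
    is_series (fun k => Cmult (a k) (Cpow z k)) (f z).

Definition classA (n : nat) (f : C -> C) : Prop :=
  exists b : nat -> C,
    b 0%nat = 0%R /\ b 1%nat = 1%R /\
    (forall k, (2 <= k <= n)%nat -> b k = 0%R) /\
    (forall z, inD z -> is_series (fun k => Cmult (b k) (Cpow z k)) (f z)).

Definition schwarz (w : C -> C) : Prop :=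
  analyticD w /\ w 0%R = 0%R /\ forall z, inD z -> inD (w z).

Definition logderiv_eq (f : C -> C) (z q : C) : Prop :=
  f z <> 0%R /\ exists d : C, is_derive f z d /\ Cdiv (Cmult z d) (f z) = q.

(* S*_wp,n : f in A_n with z f'/f < wp, i.e. z f'(z)/f(z) = wp(w(z)) for a
   Schwarz function w (at z = 0 both sides equal 1) *)
Definition Swp (n : nat) (f : C -> C) : Prop :=
  classA n f /\ exists w, schwarz w /\
    forall z, inD z -> z <> 0%R -> logderiv_eq f z (wp (w z)).

Definition classP (n : nat) (p : C -> C) : Prop :=
  (exists c : nat -> C,
     c 0%nat = 1%R /\ (forall k, (1 <= k < n)%nat -> c k = 0%R) /\
     (forall z, inD z -> is_series (fun k => Cmult (c k) (Cpow z k)) (p z))) /\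
  forall z, inD z -> 0 < Re (p z).

(* S*_n(alpha) : g in A_n with Re (z g'/g) > alpha on D (at z = 0 the value is 1) *)
Definition Sstar (n : nat) (alpha : R) (g : C -> C) : Prop :=
  classA n g /\ forall z, inD z -> z <> 0%R ->
    exists q, logderiv_eq g z q /\ alpha < Re q.

(* CS_n(alpha) : f in A_n with f/g in P_n for some g in S*_n(alpha)
   (f/g is taken with its removable value at 0) *)
Definition CS (n : nat) (alpha : R) (f : C -> C) : Prop :=
  classA n f /\ exists g, Sstar n alpha g /\
    exists p, classP n p /\ forall z, inD z -> z <> 0%R -> p z = Cdiv (f z) (g z).

Definition dilate (r : R) (f : C -> C) : C -> C :=
  fun z => Cdiv (f (Cmult (RtoC r) z)) (RtoC r).

Definition radius_prop (G1 G2 : (C -> C) -> Prop) (r0 : R) : Prop :=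
  forall r, 0 < r <= r0 -> forall f, G2 f -> G1 (dilate r f).

Definition is_radius (G1 G2 : (C -> C) -> Prop) (r0 : R) : Prop :=
  (0 < r0 <= 1) /\ radius_prop G1 G2 r0 /\
  forall r1, 0 < r1 <= 1 -> radius_prop G1 G2 r1 -> r1 <= r0.

(* Main.v *)
Require Import Defs.
From Stdlib Require Import Reals Lra Lia IndefiniteDescription Classical.
From Coquelicot Require Import Coquelicot.
Open Scope R_scope.

(** Write [f = g p] with [z g'/g] of real part above [alpha] and [Re p > 0].  The Schwarz lemma for
    functions vanishing to order [n] and the Schwarz-Pick inequality put [z f'/f] in a disc depending
    only on [x = |z|^n], with leftmost point [1 - (2 A x - 2 (1 - alpha) x^2) / (1 - x^2)], where
    [A = 1 + n - alpha].  Shifted by [-1], this disc lies in the disc with centre [1/(4e)] tangent to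
    [Re v = -1/e] at [-1/e] exactly as long as [x] is below the smaller root of a quadratic, and the
    latter disc is contained in the univalent image of the unit disc under [w e^w], so the subordinating
    function is obtained by inverting [w e^w].  Beyond that root, [z f'/f - 1] takes a real value below
    [-1/e] for the extremal function, whereas [w e^w] takes none in the unit disc.  The complex
    analysis needed (Cauchy's formula, Taylor expansion, maximum principle) is obtained for functions
    with a continuous complex derivative, by differentiating integrals over circles along homotopies. *)

(** * Complex differentiation *)


(** Subordination to a univalent function is containment of images, so everything turns on a disc
    squeezed between the discs for z f'/f - 1 and the image of w e^w. The former have centres c = 2
    (1 - alpha) x^2 / (1 - x^2) >= 0, so near the critical x they do not fit in the disc of radius
    1/e about 0: the comparison disc must be moved to the right while still touching -1/e. Its
    centre a is constrained twice. It must be at least every c that occurs, and then containment is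
    decided by the leftmost point alone. It must also be small enough for w e^w to stay at distance
    a + r/e from a on |w| = r, where the estimate uses 2 a <= r^2 / e. The value a = 1/(4e)
    satisfies both with slack. That distance bound yields preimages through a minimum principle,
    with no argument principle: a preimage of one point forces preimages of nearby points, and one
    walks from 0 to the target. The same principle, with univalence, makes the inverse continuous,
    hence holomorphic. Sharpness agrees with sufficiency because the extremal function attains the
    leftmost point of its disc on the positive axis. *)

Definition ccont (f : C -> C) (z : C) : Prop :=
  forall eps, 0 < eps -> exists delta, 0 < delta /\
    forall y, Cmod (y - z) < delta -> Cmod (f y - f z) < eps.

(** The error is compared with a product instead of a quotient, so [y = z] needs no exclusion. *)
Definition cder (f : C -> C) (z d : C) : Prop :=
  forall eps, 0 < eps -> exists delta, 0 < delta /\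
    forall y, Cmod (y - z) < delta ->
      Cmod (f y - f z - d * (y - z)) <= eps * Cmod (y - z).

Lemma Cmod_minus_sym (x y : C) : Cmod (x - y) = Cmod (y - x).
Proof. rewrite <- Cmod_opp. f_equal. ring. Qed.

Lemma Cmod_minus_triangle (x y z : C) : Cmod (x - z) <= Cmod (x - y) + Cmod (y - z).
Proof. replace (x - z)%C with ((x - y) + (y - z))%C by ring. apply Cmod_triangle. Qed.

Lemma Cmod_sub_le (x y : C) : Cmod (x - y) <= Cmod x + Cmod y.
Proof. unfold Cminus. rewrite <- (Cmod_opp y). apply Cmod_triangle. Qed.

Lemma Cmod_sub_ge (x y : C) : Cmod x - Cmod y <= Cmod (x - y).
Proof.
  pose proof (Cmod_triangle (x - y) y) as H.
  replace (x - y + y)%C with x in H by ring. lra.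
Qed.

Lemma Cmod_diag (x : C) : Cmod (x - x) = 0.
Proof. replace (x - x)%C with (RtoC 0) by ring. apply Cmod_0. Qed.

Lemma Cmod_sqr (z : C) : Cmod z * Cmod z = Re z * Re z + Im z * Im z.
Proof. pose proof (Cmod2_alt z). simpl in H. lra. Qed.

Lemma Cmod_le_sqr (z : C) (M : R) :
  0 <= M -> Re z * Re z + Im z * Im z <= M * M -> Cmod z <= M.
Proof. intros HM H. pose proof (Cmod_sqr z). pose proof (Cmod_ge_0 z). nra. Qed.

Lemma Cmod_le_abs (z : C) : Cmod z <= Rabs (Re z) + Rabs (Im z).
Proof.
  pose proof (Rabs_pos (Re z)); pose proof (Rabs_pos (Im z)).
  apply Cmod_le_sqr; [lra|].
  pose proof (Rsqr_abs (Re z)); pose proof (Rsqr_abs (Im z)). unfold Rsqr in *. nra.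
Qed.

Lemma Cmod_Im_le (z : C) : Rabs (Im z) <= Cmod z.
Proof. eapply Rle_trans; [|apply Rmax_Cmod]. apply Rmax_r. Qed.

Lemma ccont_const (c z : C) : ccont (fun _ => c) z.
Proof. intros e He. exists 1. split; [lra|]. intros. rewrite Cmod_diag. lra. Qed.

Lemma ccont_id (z : C) : ccont (fun x => x) z.
Proof. intros e He. exists e. auto. Qed.

Lemma ccont_Re (z : C) : ccont (fun x => RtoC (Re x)) z.
Proof.
  intros e He. exists e. split; [lra|]. intros y Hy.
  rewrite <- RtoC_minus, Cmod_R.
  replace (Re y - Re z) with (Re (y - z)%C) by reflexivity.
  pose proof (re_le_Cmod (y - z)%C). lra.
Qed.

Lemma ccont_Im (z : C) : ccont (fun x => RtoC (Im x)) z.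
Proof.
  intros e He. exists e. split; [lra|]. intros y Hy.
  rewrite <- RtoC_minus, Cmod_R.
  replace (Im y - Im z) with (Im (y - z)%C) by reflexivity.
  pose proof (Cmod_Im_le (y - z)%C). lra.
Qed.

Lemma ccont_ext_loc (f g : C -> C) (z : C) (delta : R) : 0 < delta ->
  (forall y, Cmod (y - z) < delta -> f y = g y) -> ccont f z -> ccont g z.
Proof.
  intros Hd E H e He. destruct (H e He) as [d [Hd' K]].
  exists (Rmin d delta). split. { apply Rmin_case; lra. }
  intros y Hy. pose proof (Rmin_l d delta). pose proof (Rmin_r d delta).
  rewrite <- !E; try lra. { apply K. lra. } rewrite Cmod_diag. lra.
Qed.

Lemma ccont_ext (f g : C -> C) (z : C) : (forall y, f y = g y) -> ccont f z -> ccont g z.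
Proof. intros E. apply (ccont_ext_loc f g z 1); [lra|]. auto. Qed.

Lemma ccont_plus (f g : C -> C) (z : C) :
  ccont f z -> ccont g z -> ccont (fun x => f x + g x)%C z.
Proof.
  intros Hf Hg e He.
  destruct (Hf (e / 2)) as [d1 [H1 K1]]; [lra|].
  destruct (Hg (e / 2)) as [d2 [H2 K2]]; [lra|].
  exists (Rmin d1 d2). split. { apply Rmin_case; lra. }
  intros y Hy. pose proof (Rmin_l d1 d2). pose proof (Rmin_r d1 d2).
  replace (f y + g y - (f z + g z))%C with ((f y - f z) + (g y - g z))%C by ring.
  eapply Rle_lt_trans; [apply Cmod_triangle|].
  assert (Cmod (f y - f z) < e / 2) by (apply K1; lra).
  assert (Cmod (g y - g z) < e / 2) by (apply K2; lra). lra.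
Qed.

Lemma ccont_mult (f g : C -> C) (z : C) :
  ccont f z -> ccont g z -> ccont (fun x => f x * g x)%C z.
Proof.
  intros Hf Hg e He.
  pose proof (Cmod_ge_0 (f z)) as Pf. pose proof (Cmod_ge_0 (g z)) as Pg.
  set (M := Cmod (f z) + Cmod (g z) + 1).
  assert (HM : 1 <= M) by (unfold M; lra).
  set (q := Rmin 1 (e / (3 * M))).
  assert (Hq : 0 < q). { unfold q. apply Rmin_case; [lra|]. apply Rdiv_lt_0_compat; lra. }
  assert (Hq1 : q <= 1) by apply Rmin_l.
  assert (Hq2 : q * (3 * M) <= e).
  { apply Rle_trans with (e / (3 * M) * (3 * M)).
    - apply Rmult_le_compat_r; [lra|]. apply Rmin_r.
    - right. field. lra. }
  destruct (Hf q Hq) as [d1 [H1 K1]]. destruct (Hg q Hq) as [d2 [H2 K2]].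
  exists (Rmin d1 d2). split. { apply Rmin_case; lra. }
  intros y Hy. pose proof (Rmin_l d1 d2). pose proof (Rmin_r d1 d2).
  replace (f y * g y - f z * g z)%C
    with ((f y - f z) * (g y - g z) + (f z * (g y - g z) + (f y - f z) * g z))%C by ring.
  assert (A : Cmod (f y - f z) < q) by (apply K1; lra).
  assert (B : Cmod (g y - g z) < q) by (apply K2; lra).
  eapply Rle_lt_trans; [apply Cmod_triangle|].
  pose proof (Cmod_triangle (f z * (g y - g z)) ((f y - f z) * g z)).
  rewrite !Cmod_mult in *.
  pose proof (Cmod_ge_0 (f y - f z)). pose proof (Cmod_ge_0 (g y - g z)).
  assert (T : Cmod (f y - f z) * Cmod (g y - g z) <= q * 1) by (apply Rmult_le_compat; lra).
  assert (T2 : Cmod (f z) * Cmod (g y - g z) <= M * q) by (apply Rmult_le_compat; unfold M; lra).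
  assert (T3 : Cmod (f y - f z) * Cmod (g z) <= q * Cmod (g z))
    by (apply Rmult_le_compat_r; lra).
  assert (q * Cmod (g z) + q <= q * M) by (unfold M; nra).
  nra.
Qed.

Lemma ccont_opp (f : C -> C) (z : C) : ccont f z -> ccont (fun x => - f x)%C z.
Proof.
  intros H. apply ccont_ext with (fun x => RtoC (-1) * f x)%C.
  { intros. replace (RtoC (-1)) with (- RtoC 1)%C by (rewrite <- RtoC_opp; f_equal; ring). ring. }
  apply ccont_mult; auto. apply ccont_const.
Qed.

Lemma ccont_minus (f g : C -> C) (z : C) :
  ccont f z -> ccont g z -> ccont (fun x => f x - g x)%C z.
Proof. intros. apply ccont_plus; auto. apply ccont_opp; auto. Qed.

Lemma ccont_nonzero (f : C -> C) (z : C) : ccont f z -> f z <> 0 ->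
  exists delta, 0 < delta /\ forall y, Cmod (y - z) < delta -> Cmod (f z) / 2 < Cmod (f y).
Proof.
  intros H N. apply Cmod_gt_0 in N.
  destruct (H (Cmod (f z) / 2)) as [d [Hd K]]; [lra|].
  exists d. split; auto. intros y Hy. specialize (K y Hy).
  rewrite Cmod_minus_sym in K. pose proof (Cmod_sub_ge (f z) (f y)). lra.
Qed.

Lemma ccont_inv (f : C -> C) (z : C) : ccont f z -> f z <> 0 -> ccont (fun x => / f x)%C z.
Proof.
  intros H N e He.
  destruct (ccont_nonzero f z H N) as [d1 [H1 K1]].
  pose proof N as P. apply Cmod_gt_0 in P.
  destruct (H (e * (Cmod (f z) * (Cmod (f z) / 2)))) as [d2 [H2 K2]].
  { repeat apply Rmult_lt_0_compat; lra. }
  exists (Rmin d1 d2). split. { apply Rmin_case; lra. }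
  intros y Hy. pose proof (Rmin_l d1 d2). pose proof (Rmin_r d1 d2).
  assert (A : Cmod (f z) / 2 < Cmod (f y)) by (apply K1; lra).
  assert (B : Cmod (f y - f z) < e * (Cmod (f z) * (Cmod (f z) / 2))) by (apply K2; lra).
  assert (Ny : f y <> 0). { apply Cmod_gt_0. lra. }
  replace (/ f y - / f z)%C with ((f z - f y) / (f y * f z))%C by (field; auto).
  rewrite Cmod_div by (apply Cmult_neq_0; auto). rewrite Cmod_mult, Cmod_minus_sym.
  apply Rlt_div_l. { apply Rmult_lt_0_compat; lra. }
  eapply Rlt_le_trans; [exact B|]. apply Rmult_le_compat_l; [lra|]. nra.
Qed.

Lemma ccont_div (f g : C -> C) (z : C) : ccont f z -> ccont g z -> g z <> 0 ->
  ccont (fun x => f x / g x)%C z.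
Proof. intros. apply ccont_mult; auto. apply ccont_inv; auto. Qed.

Lemma ccont_comp (f g : C -> C) (z : C) : ccont f (g z) -> ccont g z -> ccont (fun x => f (g x)) z.
Proof.
  intros Hf Hg e He. destruct (Hf e He) as [d [Hd K]]. destruct (Hg d Hd) as [d' [Hd' K']].
  exists d'. split; auto.
Qed.

Lemma ccont_pow (f : C -> C) (z : C) (n : nat) : ccont f z -> ccont (fun x => Cpow (f x) n) z.
Proof.
  intros H. induction n; simpl. { apply ccont_const. } apply ccont_mult; auto.
Qed.

(* Caratheodory's form of differentiability: the difference quotient extends continuously. *)
Lemma cder_caratheodory (f : C -> C) (z d : C) :
  cder f z d <-> exists phi delta, 0 < delta /\ ccont phi z /\ phi z = d /\
    forall y, Cmod (y - z) < delta -> (f y - f z = phi y * (y - z))%C.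
Proof.
  split.
  - intros H.
    exists (fun y => if Ceq_dec y z then d else ((f y - f z) / (y - z))%C), 1.
    split; [lra|]. split; [|split].
    + intros e He. destruct (H (e / 2)) as [dl [Hd K]]; [lra|].
      exists dl. split; auto. intros y Hy. specialize (K y Hy).
      destruct (Ceq_dec z z) as [_|]; [|congruence].
      destruct (Ceq_dec y z) as [->|N]. { rewrite Cmod_diag. lra. }
      pose proof (Cminus_eq_contra _ _ N) as N'.
      assert (P : 0 < Cmod (y - z)) by (apply Cmod_gt_0; auto).
      replace ((f y - f z) / (y - z) - d)%C with ((f y - f z - d * (y - z)) / (y - z))%C
        by (field; auto).
      rewrite Cmod_div by auto. apply Rlt_div_l; auto. nra.
    + destruct (Ceq_dec z z); congruence.
    + intros y _. destruct (Ceq_dec y z) as [->|N]. { ring. }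
      pose proof (Cminus_eq_contra _ _ N) as N'. field. auto.
  - intros (phi & dl & Hdl & Hc & <- & E) e He.
    destruct (Hc e He) as [d2 [Hd2 K]].
    exists (Rmin dl d2). split. { apply Rmin_case; lra. }
    intros y Hy. pose proof (Rmin_l dl d2). pose proof (Rmin_r dl d2).
    rewrite E by lra.
    replace (phi y * (y - z) - phi z * (y - z))%C with ((phi y - phi z) * (y - z))%C by ring.
    rewrite Cmod_mult. apply Rmult_le_compat_r; [apply Cmod_ge_0|].
    left. apply K. lra.
Qed.

Lemma cder_ccont (f : C -> C) (z d : C) : cder f z d -> ccont f z.
Proof.
  intros H. apply cder_caratheodory in H. destruct H as (phi & dl & Hdl & Hc & _ & E).
  apply ccont_ext_loc with (fun y => f z + phi y * (y - z))%C dl; auto.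
  { intros y Hy. rewrite <- E by auto. ring. }
  apply ccont_plus; [apply ccont_const|]. apply ccont_mult; auto.
  apply ccont_minus; [apply ccont_id|apply ccont_const].
Qed.

Lemma cder_ext_loc (f g : C -> C) (z d : C) (delta : R) : 0 < delta ->
  (forall y, Cmod (y - z) < delta -> f y = g y) -> cder f z d -> cder g z d.
Proof.
  intros Hd E H e He. destruct (H e He) as [d1 [Hd1 K]].
  exists (Rmin d1 delta). split. { apply Rmin_case; lra. }
  intros y Hy. pose proof (Rmin_l d1 delta). pose proof (Rmin_r d1 delta).
  rewrite <- !E; try lra. { apply K. lra. } rewrite Cmod_diag. lra.
Qed.

Lemma cder_ext (f g : C -> C) (z d : C) : (forall y, f y = g y) -> cder f z d -> cder g z d.
Proof. intros E. apply (cder_ext_loc f g z d 1); [lra|]. auto. Qed.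

Lemma cder_eq (f : C -> C) (z d d' : C) : cder f z d -> d = d' -> cder f z d'.
Proof. intros H <-. exact H. Qed.

Lemma cder_const (c z : C) : cder (fun _ => c) z 0.
Proof.
  intros e He. exists 1. split; [lra|]. intros y _.
  replace (c - c - 0 * (y - z))%C with (RtoC 0) by ring. rewrite Cmod_0.
  apply Rmult_le_pos; [lra|apply Cmod_ge_0].
Qed.

Lemma cder_id (z : C) : cder (fun x => x) z 1.
Proof.
  intros e He. exists 1. split; [lra|]. intros y _.
  replace (y - z - 1 * (y - z))%C with (RtoC 0) by ring. rewrite Cmod_0.
  apply Rmult_le_pos; [lra|apply Cmod_ge_0].
Qed.

Ltac min_intro d1 d2 := exists (Rmin d1 d2); split;
  [apply Rmin_case; lra | pose proof (Rmin_l d1 d2); pose proof (Rmin_r d1 d2)].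

Lemma cder_plus (f g : C -> C) (z a b : C) :
  cder f z a -> cder g z b -> cder (fun x => f x + g x)%C z (a + b)%C.
Proof.
  rewrite !cder_caratheodory.
  intros (p & d1 & H1 & C1 & <- & E1) (q & d2 & H2 & C2 & <- & E2).
  exists (fun x => p x + q x)%C. min_intro d1 d2.
  split; [|split]; auto using ccont_plus.
  intros y Hy. replace (f y + g y - (f z + g z))%C with ((f y - f z) + (g y - g z))%C by ring.
  rewrite E1, E2 by lra. ring.
Qed.

Lemma cder_mult (f g : C -> C) (z a b : C) :
  cder f z a -> cder g z b -> cder (fun x => f x * g x)%C z (a * g z + f z * b)%C.
Proof.
  intros Hf Hg. pose proof (cder_ccont _ _ _ Hg) as Cg.
  rewrite cder_caratheodory in Hf, Hg |- *.
  destruct Hf as (p & d1 & H1 & C1 & <- & E1). destruct Hg as (q & d2 & H2 & C2 & <- & E2).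
  exists (fun x => p x * g x + f z * q x)%C. min_intro d1 d2.
  split; [|split]; auto.
  { apply ccont_plus; apply ccont_mult; auto using ccont_const. }
  intros y Hy.
  replace (f y * g y - f z * g z)%C with ((f y - f z) * g y + f z * (g y - g z))%C by ring.
  rewrite E1, E2 by lra. ring.
Qed.

Lemma cder_scal (c : C) (f : C -> C) (z a : C) :
  cder f z a -> cder (fun x => c * f x)%C z (c * a)%C.
Proof.
  intros H. eapply cder_eq. { apply cder_mult; [apply cder_const|exact H]. } cbv beta. ring.
Qed.

Lemma cder_opp (f : C -> C) (z a : C) : cder f z a -> cder (fun x => - f x)%C z (- a)%C.
Proof.
  intros H. eapply cder_eq.
  { apply cder_ext with (fun x => (- RtoC 1) * f x)%C; [intros; ring|]. apply cder_scal. exact H. }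
  ring.
Qed.

Lemma cder_minus (f g : C -> C) (z a b : C) :
  cder f z a -> cder g z b -> cder (fun x => f x - g x)%C z (a - b)%C.
Proof. intros. apply cder_plus; auto. apply cder_opp; auto. Qed.

Lemma cder_inv (f : C -> C) (z a : C) :
  cder f z a -> f z <> 0 -> cder (fun x => / f x)%C z (- a / (f z * f z))%C.
Proof.
  intros Hf N. pose proof (cder_ccont _ _ _ Hf) as Cf.
  destruct (ccont_nonzero f z Cf N) as (d2 & H2 & K).
  rewrite cder_caratheodory in Hf |- *.
  destruct Hf as (p & d1 & H1 & C1 & <- & E1).
  exists (fun x => - p x / (f x * f z))%C. min_intro d1 d2.
  split; [|split]; auto.
  { apply ccont_div; auto using ccont_opp, ccont_mult, ccont_const, Cmult_neq_0. }
  intros y Hy.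
  assert (Ny : f y <> 0).
  { apply Cmod_gt_0. pose proof (Cmod_ge_0 (f z)). assert (Cmod (f z) / 2 < Cmod (f y)) by (apply K; lra). lra. }
  replace (/ f y - / f z)%C with (- (f y - f z) / (f y * f z))%C by (field; auto).
  rewrite E1 by lra. field. auto.
Qed.

Lemma cder_div (f g : C -> C) (z a b : C) : cder f z a -> cder g z b -> g z <> 0 ->
  cder (fun x => f x / g x)%C z ((a * g z - f z * b) / (g z * g z))%C.
Proof.
  intros Hf Hg N. eapply cder_eq.
  { apply cder_mult; [exact Hf|apply cder_inv; [exact Hg|exact N]]. }
  cbv beta. field. auto.
Qed.

Lemma cder_comp (f g : C -> C) (z a b : C) :
  cder f (g z) a -> cder g z b -> cder (fun x => f (g x)) z (a * b)%C.
Proof.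
  intros Hf Hg. pose proof (cder_ccont _ _ _ Hg) as Cg.
  rewrite cder_caratheodory in Hf, Hg |- *.
  destruct Hf as (p & d1 & H1 & C1 & <- & E1). destruct Hg as (q & d2 & H2 & C2 & <- & E2).
  destruct (Cg d1 H1) as (d3 & H3 & K3).
  exists (fun x => p (g x) * q x)%C. min_intro d2 d3.
  split; [|split]; auto.
  { apply ccont_mult; auto. apply ccont_comp; auto. }
  intros y Hy. rewrite E1 by (apply K3; lra). rewrite E2 by lra. ring.
Qed.

Lemma cder_pow (f : C -> C) (z a : C) (n : nat) : cder f z a ->
  cder (fun x => Cpow (f x) n) z (INR n * Cpow (f z) (pred n) * a)%C.
Proof.
  intros H. induction n.
  - simpl. eapply cder_eq; [apply cder_const|]. simpl. ring.
  - eapply cder_eq. { apply (cder_mult f (fun x => Cpow (f x) n)); [exact H|exact IHn]. }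
    cbv beta. rewrite S_INR, RtoC_plus. destruct n.
    + simpl. ring.
    + change (pred (S (S n))) with (S n). change (pred (S n)) with n. rewrite !Cpow_S. ring.
Qed.

Lemma cder_unique (f : C -> C) (z a b : C) : cder f z a -> cder f z b -> a = b.
Proof.
  intros Ha Hb. apply Ceq_minus. apply Cmod_eq_0.
  destruct (Rle_lt_or_eq_dec 0 (Cmod (a - b)) (Cmod_ge_0 _)) as [P|]; [exfalso|auto].
  destruct (Ha (Cmod (a - b) / 4)) as (d1 & H1 & K1); [lra|].
  destruct (Hb (Cmod (a - b) / 4)) as (d2 & H2 & K2); [lra|].
  set (t := Rmin d1 d2 / 2).
  assert (Ht : 0 < t) by (unfold t; apply Rmin_case; lra).
  pose proof (Rmin_l d1 d2). pose proof (Rmin_r d1 d2).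
  set (y := (z + t)%C).
  assert (E : Cmod (y - z) = t).
  { unfold y. replace (z + t - z)%C with (RtoC t) by ring. rewrite Cmod_R. apply Rabs_pos_eq. lra. }
  specialize (K1 y). specialize (K2 y). rewrite E in *.
  specialize (K1 ltac:(unfold t in *; lra)). specialize (K2 ltac:(unfold t in *; lra)).
  assert (Cmod ((a - b) * (y - z)) <= Cmod (a - b) / 4 * t + Cmod (a - b) / 4 * t).
  { replace ((a - b) * (y - z))%C with
      ((f y - f z - b * (y - z)) - (f y - f z - a * (y - z)))%C by ring.
    eapply Rle_trans; [apply Cmod_sub_le|]. lra. }
  rewrite Cmod_mult, E in H3. nra.
Qed.

(** The bridge to [logderiv_eq], the only place where the definitions mention [is_derive] over
    [C]. *)
Lemma cder_is_derive (f : C -> C) (z d : C) : cder f z d <-> is_derive f z d.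
Proof.
  split.
  - intros H. split; [apply is_linear_scal_l|].
    intros x Hx. assert (Ex : z = x). { apply (@is_filter_lim_locally_unique C_AbsRing (AbsRing_NormedModule C_AbsRing) z x Hx). }
    subst x. intros eps. destruct (H eps (cond_pos eps)) as (dl & Hd & K).
    exists (mkposreal dl Hd). intros y Hy.
    specialize (K y Hy).
    replace (f y - f z - d * (y - z))%C
      with (minus (minus (f y) (f z)) (@scal C_Ring C_ModuleSpace (minus y z) d)) in K.
    { exact K. }
    change (f y - f z - (y - z) * d = f y - f z - d * (y - z))%C. ring.
  - intros [_ H] e He.
    specialize (H z (fun P HP => HP) (mkposreal e He)).
    destruct H as [dl K]. exists dl. split; [apply cond_pos|].
    intros y Hy. specialize (K y Hy).
    replace (f y - f z - d * (y - z))%C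
      with (minus (minus (f y) (f z)) (@scal C_Ring C_ModuleSpace (minus y z) d)).
    { exact K. }
    change (f y - f z - (y - z) * d = f y - f z - d * (y - z))%C. ring.
Qed.

(** * The complex exponential and its derivative *)

Lemma cexp_plus (a b : C) : cexp (a + b) = (cexp a * cexp b)%C.
Proof.
  unfold cexp, Re, Im. simpl. rewrite exp_plus, cos_plus, sin_plus. unfold Cmult; simpl. f_equal; ring.
Qed.

Lemma cexp_0 : cexp 0 = 1.
Proof. unfold cexp, Re, Im; simpl. rewrite exp_0, cos_0, sin_0. unfold RtoC. f_equal; ring. Qed.

Lemma cexp_nonzero (z : C) : cexp z <> 0.
Proof.
  intros H. pose proof (cexp_plus z (- z)) as E. rewrite H in E.
  replace (z + - z)%C with (RtoC 0) in E by ring. rewrite cexp_0 in E.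
  apply C1_nz. rewrite E. ring.
Qed.

Lemma Cmod_cexp (z : C) : Cmod (cexp z) = exp (Re z).
Proof.
  unfold Cmod, cexp; simpl.
  replace (exp (Re z) * cos (Im z) * (exp (Re z) * cos (Im z) * 1) +
     exp (Re z) * sin (Im z) * (exp (Re z) * sin (Im z) * 1))
    with (exp (Re z) * exp (Re z) * (Rsqr (sin (Im z)) + Rsqr (cos (Im z)))) by (unfold Rsqr; ring).
  rewrite sin2_cos2, Rmult_1_r. apply sqrt_square. left. apply exp_pos.
Qed.

Lemma derivable_eps (f : R -> R) (x l : R) : derivable_pt_lim f x l ->
  forall eps, 0 < eps -> exists delta, 0 < delta /\
    forall h, Rabs h < delta -> Rabs (f (x + h) - f x - l * h) <= eps * Rabs h.
Proof.
  intros H e He. destruct (H e He) as [dl K]. exists dl. split; [apply cond_pos|].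
  intros h Hh. destruct (Req_dec h 0) as [->|N].
  { replace (f (x + 0) - f x - l * 0) with 0 by (rewrite Rplus_0_r; ring). rewrite Rabs_R0. lra. }
  specialize (K h N Hh).
  replace (f (x + h) - f x - l * h) with (((f (x + h) - f x) / h - l) * h) by (field; auto).
  rewrite Rabs_mult. apply Rmult_le_compat_r; [apply Rabs_pos|lra].
Qed.

Lemma cder_cexp_0 : cder cexp 0 1.
Proof.
  intros e He.
  destruct (derivable_eps exp 0 1) with (eps := Rmin 1 (e / 8)) as (d1 & H1 & K1).
  { rewrite <- exp_0. apply derivable_pt_lim_exp. } { apply Rmin_case; lra. }
  destruct (derivable_eps cos 0 0) with (eps := e / 12) as (d2 & H2 & K2); [|lra|].
  { replace 0 with (- sin 0) at 2 by (rewrite sin_0; ring). apply derivable_pt_lim_cos. }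
  destruct (derivable_eps sin 0 1) with (eps := e / 12) as (d3 & H3 & K3); [|lra|].
  { rewrite <- cos_0. apply derivable_pt_lim_sin. }
  (* The cap [1 / 2] gives [exp x <= 2]; the cap [e / 16] absorbs the quadratic term [2 * m * m]
     that comes from [(exp x - 1) * t]. *)
  set (d := Rmin (Rmin d1 d2) (Rmin d3 (Rmin (1 / 2) (e / 16)))).
  assert (Hd : 0 < d) by (unfold d; repeat apply Rmin_case; lra).
  assert (Hd1 : d <= d1) by (unfold d; eapply Rle_trans; [apply Rmin_l|apply Rmin_l]).
  assert (Hd2 : d <= d2) by (unfold d; eapply Rle_trans; [apply Rmin_l|apply Rmin_r]).
  assert (Hd3 : d <= d3) by (unfold d; eapply Rle_trans; [apply Rmin_r|apply Rmin_l]).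
  assert (Hd4 : d <= Rmin (1 / 2) (e / 16)) by (unfold d; eapply Rle_trans; [apply Rmin_r|apply Rmin_r]).
  pose proof (Rmin_l (1/2) (e/16)). pose proof (Rmin_r (1/2) (e/16)).
  pose proof (Rmin_l 1 (e/8)). pose proof (Rmin_r 1 (e/8)).
  exists d. split; auto. intros y Hy.
  replace (y - 0)%C with y in * by ring. rewrite cexp_0.
  pose proof (re_le_Cmod y) as Px. pose proof (Cmod_Im_le y) as Py.
  eapply Rle_trans; [apply Cmod_le_abs|].
  replace (Re (cexp y - 1 - 1 * y)%C) with (exp (Re y) * cos (Im y) - 1 - Re y) by (simpl; unfold Re, Im; ring).
  replace (Im (cexp y - 1 - 1 * y)%C) with (exp (Re y) * sin (Im y) - Im y) by (simpl; unfold Re, Im; ring).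
  set (x := Re y) in *. set (t := Im y) in *. set (m := Cmod y) in *.
  specialize (K1 x ltac:(lra)). specialize (K2 t ltac:(lra)). specialize (K3 t ltac:(lra)).
  rewrite !Rplus_0_l, ?exp_0, ?cos_0, ?sin_0 in *.
  pose proof (Rabs_pos x). pose proof (Rabs_pos t).
  assert (A1 : Rabs (exp x - 1 - 1 * x) <= e / 8 * m).
  { eapply Rle_trans; [exact K1|]. apply Rmult_le_compat; try lra. apply Rmin_case; lra. }
  assert (A1' : Rabs (exp x - 1) <= 2 * m).
  { replace (exp x - 1) with ((exp x - 1 - 1 * x) + x) by ring.
    eapply Rle_trans; [apply Rabs_triang|].
    assert (Rmin 1 (e / 8) * Rabs x <= 1 * m) by (apply Rmult_le_compat; try lra; apply Rmin_case; lra). lra. }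
  assert (A2 : Rabs (cos t - 1 - 0 * t) <= e / 12 * m) by (eapply Rle_trans; [exact K2|]; apply Rmult_le_compat_l; lra).
  assert (A3 : Rabs (sin t - 0 - 1 * t) <= e / 12 * m) by (eapply Rle_trans; [exact K3|]; apply Rmult_le_compat_l; lra).
  pose proof (exp_pos x) as Pe.
  assert (Ee : exp x <= 2).
  { assert (exp x - 1 <= 2 * m) by (eapply Rle_trans; [apply Rle_abs|exact A1']). lra. }
  assert (B1 : Rabs (exp x * cos t - 1 - x) <= e / 8 * m + 2 * (e / 12 * m)).
  { replace (exp x * cos t - 1 - x) with ((exp x - 1 - 1 * x) + exp x * (cos t - 1 - 0 * t)) by ring.
    eapply Rle_trans; [apply Rabs_triang|]. rewrite Rabs_mult, (Rabs_pos_eq (exp x)) by lra.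
    apply Rplus_le_compat; auto. apply Rmult_le_compat; auto; try lra. apply Rabs_pos. }
  assert (B2 : Rabs (exp x * sin t - t) <= 2 * (e / 12 * m) + 2 * m * m).
  { replace (exp x * sin t - t) with (exp x * (sin t - 0 - 1 * t) + (exp x - 1) * t) by ring.
    eapply Rle_trans; [apply Rabs_triang|]. rewrite !Rabs_mult, (Rabs_pos_eq (exp x)) by lra.
    apply Rplus_le_compat; apply Rmult_le_compat; auto; try lra; apply Rabs_pos. }
  assert (Hm : 0 <= m) by (unfold m; apply Cmod_ge_0).
  assert (2 * m * m <= e / 8 * m) by nra.
  assert (0 <= e * m) by nra.
  lra.
Qed.

Lemma cder_cexp (z : C) : cder cexp z (cexp z).
Proof.
  apply cder_ext with (fun y => cexp z * cexp (y - z))%C.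
  { intros y. rewrite <- cexp_plus. f_equal. ring. }
  eapply cder_eq.
  { apply cder_scal. apply (cder_comp cexp (fun y => y - z)%C z 1 1).
    - replace (z - z)%C with (RtoC 0) by ring. apply cder_cexp_0.
    - eapply cder_eq. { apply cder_minus; [apply cder_id|apply cder_const]. } ring. }
  ring.
Qed.

Lemma ccont_cexp (z : C) : ccont cexp z.
Proof. eapply cder_ccont. apply cder_cexp. Qed.

(** * Power series *)


Lemma is_series_C_eps (a : nat -> C) (l : C) :
  is_series a l <-> forall eps, 0 < eps -> exists N, forall n, (N <= n)%nat ->
    Cmod (sum_n a n - l) < eps.
Proof.
  unfold is_series.
  rewrite (@filterlim_locally_ball_norm C_AbsRing nat C_NormedModule eventually _).
  split.
  - intros H e He. destruct (H (mkposreal e He)) as [N K]. exists N. intros n Hn.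
    exact (K n Hn).
  - intros H e. destruct (H e (cond_pos e)) as [N K]. exists N. intros n Hn. exact (K n Hn).
Qed.

Lemma is_series_Cmod_le (a : nat -> C) (l : C) (L : R) :
  is_series a l -> (forall n, Cmod (sum_n a n) <= L) -> Cmod l <= L.
Proof.
  rewrite is_series_C_eps. intros H B. apply le_epsilon. intros e He.
  destruct (H e He) as [N K]. specialize (K N (le_n N)). specialize (B N).
  rewrite Cmod_minus_sym in K. pose proof (Cmod_sub_ge l (sum_n a N)). lra.
Qed.

Lemma is_series_unique_C (a : nat -> C) (l l' : C) : is_series a l -> is_series a l' -> l = l'.
Proof. apply filterlim_locally_unique. Qed.

Lemma Cmod_sum_n_le (a : nat -> C) (w : nat -> R) (n : nat) :
  (forall k, Cmod (a k) <= w k) -> Cmod (sum_n a n) <= sum_n w n.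
Proof.
  intros H. induction n.
  - rewrite !sum_O. apply H.
  - rewrite !sum_Sn. eapply Rle_trans; [apply Cmod_triangle|].
    apply Rplus_le_compat; auto.
Qed.

Lemma is_series_terms_small (a : nat -> C) (l : C) : is_series a l ->
  is_lim_seq (fun k => Cmod (a k)) 0.
Proof.
  rewrite is_series_C_eps. intros H. apply is_lim_seq_spec. intros e.
  destruct (H (e / 2)) as [N K]. { pose proof (cond_pos e). lra. }
  exists (S N). intros n Hn. rewrite Rminus_0_r, Rabs_pos_eq by apply Cmod_ge_0.
  destruct n; [lia|].
  replace (a (S n)) with ((sum_n a (S n) - l) - (sum_n a n - l))%C.
  { eapply Rle_lt_trans; [apply Cmod_sub_le|].
    assert (Cmod (sum_n a (S n) - l) < e / 2) by (apply K; lia).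
    assert (Cmod (sum_n a n - l) < e / 2) by (apply K; lia). lra. }
  rewrite sum_Sn. change (sum_n a n + a (S n) - l - (sum_n a n - l) = a (S n))%C. ring.
Qed.

Definition psum (a : nat -> C) (f : C -> C) : Prop :=
  forall z, inD z -> is_series (fun k => a k * Cpow z k)%C (f z).

(** Passing to the moduli of the coefficients makes the real theory of the convergence radius
    available. If the radius were below [(rho + 1) / 2], the terms at that point could not tend to
    0, although the series converges there. *)
Lemma psum_CV_radius (a : nat -> C) (f : C -> C) (rho : R) : psum a f ->
  0 <= rho < 1 -> Rbar_lt (Rabs rho) (CV_radius (fun k => Cmod (a k))).
Proof.
  intros H Hr. rewrite Rabs_pos_eq by lra.
  set (r := (rho + 1) / 2).
  apply Rbar_lt_le_trans with r. { unfold r. simpl. lra. }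
  apply Rbar_not_lt_le. intros Hlt.
  apply (CV_disk_outside (fun k => Cmod (a k)) r).
  { rewrite Rabs_pos_eq by (unfold r; lra). exact Hlt. }
  assert (Hz : inD r). { unfold inD, r. rewrite Cmod_R, Rabs_pos_eq; lra. }
  apply is_lim_seq_ext with (2 := is_series_terms_small _ _ (H r Hz)).
  intros k. rewrite Cmod_mult, Cmod_pow, Cmod_R. f_equal. f_equal. apply Rabs_pos_eq. unfold r; lra.
Qed.

Lemma partial_sums_le (w : nat -> R) : (forall n, 0 <= w n) -> ex_series w ->
  exists L, forall n, sum_n w n <= L.
Proof.
  intros P [L H]. exists L. apply is_lim_seq_incr_compare; [exact H|].
  intros n. rewrite sum_Sn. pose proof (P (S n)). unfold plus; simpl. lra.
Qed.

(** This is the second formal derivative at [rho], the majorant for the second-order Taylor errors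
    of the terms. The truncated exponent [n - 2] is harmless: for [n < 2] the coefficient
    vanishes. *)
Lemma ex_series_PS_derive2 (a : nat -> R) (rho : R) : (forall n, 0 <= a n) -> 0 <= rho ->
  Rbar_lt (Rabs rho) (CV_radius a) ->
  ex_series (fun n => a n * (INR n * INR (pred n)) * rho ^ (n - 2)).
Proof.
  intros P Hr H. apply ex_series_incr_1, ex_series_incr_1.
  rewrite <- (CV_radius_derive a), <- (CV_radius_derive (PS_derive a)) in H.
  apply CV_disk_inside in H. revert H. apply ex_series_ext. intros n. cbv beta.
  rewrite Rabs_pos_eq.
  - unfold PS_derive. replace (S (S n) - 2)%nat with n by lia.
    change (pred (S (S n))) with (S n). match goal with |- @eq _ ?a ?b => change (@eq R a b) end. ring.
  - unfold PS_derive. apply Rmult_le_pos; [|apply pow_le; lra].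
    repeat apply Rmult_le_pos; auto; apply pos_INR.
Qed.

Lemma Cpow_taylor2 (y z : C) (rho : R) (n : nat) : Cmod y <= rho -> Cmod z <= rho ->
  Cmod (Cpow y n - Cpow z n - INR n * Cpow z (pred n) * (y - z))
    <= INR n * INR (pred n) * rho ^ (n - 2) * (Cmod (y - z) * Cmod (y - z)).
Proof.
  intros Hy Hz. pose proof (Cmod_ge_0 y). pose proof (Cmod_ge_0 z).
  pose proof (Cmod_ge_0 (y - z)) as Pm. assert (0 <= rho) by lra.
  destruct n as [|n].
  { simpl. replace (1 - 1 - 0 * 1 * (y - z))%C with (RtoC 0) by ring. rewrite Cmod_0. lra. }
  induction n as [|n IH].
  { simpl. replace (y * 1 - z * 1 - 1 * 1 * (y - z))%C with (RtoC 0) by ring. rewrite Cmod_0. lra. }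
  (* With E_m the error for the exponent m, E_(m+1) = y E_m + m z^(m-1) (y - z)^2. *)
  replace (Cpow y (S (S n)) - Cpow z (S (S n)) - INR (S (S n)) * Cpow z (pred (S (S n))) * (y - z))%C
    with (y * (Cpow y (S n) - Cpow z (S n) - INR (S n) * Cpow z (pred (S n)) * (y - z))
      + INR (S n) * Cpow z n * ((y - z) * (y - z)))%C.
  2:{ rewrite (S_INR (S n)), RtoC_plus. change (pred (S (S n))) with (S n).
      change (pred (S n)) with n. rewrite !Cpow_S. ring. }
  eapply Rle_trans; [apply Cmod_triangle|]. rewrite !Cmod_mult, Cmod_pow, Cmod_R.
  rewrite (Rabs_pos_eq (INR (S n))) by apply pos_INR.
  replace (S (S n) - 2)%nat with n by lia. change (pred (S (S n))) with (S n).
  set (h := Cmod (y - z) * Cmod (y - z)) in *. assert (0 <= h) by (unfold h; nra).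
  assert (A : Cmod y * Cmod (Cpow y (S n) - Cpow z (S n) - INR (S n) * Cpow z (pred (S n)) * (y - z))
    <= INR (S n) * INR n * rho ^ n * h).
  { eapply Rle_trans; [apply Rmult_le_compat; [lra|apply Cmod_ge_0|exact Hy|exact IH]|].
    change (pred (S n)) with n. destruct n as [|n].
    - simpl. lra.
    - replace (S (S n) - 2)%nat with n by lia. simpl pow. right. ring. }
  assert (B : Cmod z ^ n <= rho ^ n) by (apply pow_incr; lra).
  assert (B' : INR (S n) * Cmod z ^ n * h <= INR (S n) * rho ^ n * h).
  { apply Rmult_le_compat_r; auto. apply Rmult_le_compat_l; auto. apply pos_INR. }
  rewrite (S_INR (S n)).
  replace ((INR (S n) + 1) * INR (S n) * rho ^ n * h)
    with (INR (S n) * INR n * rho ^ n * h + 2 * (INR (S n) * rho ^ n * h))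
    by (rewrite S_INR; ring).
  assert (0 <= INR (S n) * rho ^ n * h).
  { repeat apply Rmult_le_pos; auto. apply pos_INR. apply pow_le; lra. }
  lra.
Qed.

(** Summing the second-order errors of the single powers bounds f(y) - f(z) - f'(z) (y - z) by a
    constant times |y - z|^2, with a constant uniform on a disc slightly larger than |z|; no uniform
    convergence of the derived series is invoked. *)
Lemma psum_derive (a : nat -> C) (f : C -> C) : psum a f ->
  exists f', psum (fun k => INR (S k) * a (S k))%C f' /\ forall z, inD z -> cder f z (f' z).
Proof.
  intros H.
  assert (EX : forall z, exists l : C, inD z ->
    is_series (fun k => INR (S k) * a (S k) * Cpow z k)%C l).
  { intros z. destruct (Rlt_dec (Cmod z) 1) as [Hz|]; [|exists (RtoC 0); intros; contradiction].
    assert (EXz : ex_series (V := C_CompleteNormedModule) (fun k => INR (S k) * a (S k) * Cpow z k)%C).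
    { apply ex_series_le with (fun k => Rabs (PS_derive (fun k => Cmod (a k)) k * Cmod z ^ k)).
      - intros k. match goal with |- _ <= ?r => change (Cmod (INR (S k) * a (S k) * Cpow z k) <= r) end.
        rewrite !Cmod_mult, Cmod_pow, Cmod_R.
        rewrite (Rabs_pos_eq (INR _)) by apply pos_INR. right. unfold PS_derive.
        rewrite Rabs_pos_eq. reflexivity.
        repeat apply Rmult_le_pos; try apply pos_INR; try apply Cmod_ge_0. apply pow_le, Cmod_ge_0.
      - apply CV_disk_inside. rewrite CV_radius_derive.
        apply (psum_CV_radius a f); auto. split; [apply Cmod_ge_0|auto]. }
    destruct EXz as [l Hl]. exists l. auto. }
  destruct (functional_choice (fun z (l : C) => inD z -> is_series (fun k => INR (S k) * a (S k) * Cpow z k)%C l) EX) as [f' Hf']. exists f'.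
  split; [exact Hf'|]. intros z Hz. unfold inD in Hz.
  pose proof (Cmod_ge_0 z) as Pz. set (rho := (Cmod z + 1) / 2).
  assert (Hrho : 0 <= rho < 1) by (unfold rho; lra).
  pose (w := fun n => Cmod (a n) * (INR n * INR (pred n)) * rho ^ (n - 2)).
  assert (Pw : forall n, 0 <= w n).
  { intros n. unfold w. repeat apply Rmult_le_pos; try apply pos_INR; try apply Cmod_ge_0.
    apply pow_le; lra. }
  destruct (partial_sums_le w Pw) as [L HL].
  { apply ex_series_PS_derive2; [intros; apply Cmod_ge_0|lra|]. eapply psum_CV_radius; eauto. }
  assert (PL : 0 <= L). { specialize (HL 0%nat). rewrite sum_O in HL. specialize (Pw 0%nat). lra. }
  (* The derived series is reindexed with a zero term at [k = 0], to align it with the series of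
     [f]. *)
  assert (Sz : is_series (fun k => INR k * a k * Cpow z (pred k))%C (f' z)).
  { apply is_series_decr_1.
    match goal with |- is_series _ ?x => replace x with (f' z) end.
    { apply Hf'. exact Hz. }
    change (f' z = f' z + - (0 * a 0%nat * Cpow z (pred 0)))%C. ring. }
  assert (Q : forall y, Cmod (y - z) < (1 - Cmod z) / 2 ->
    Cmod (f y - f z - f' z * (y - z)) <= L * (Cmod (y - z) * Cmod (y - z))).
  { intros y Hy.
    assert (Hyr : Cmod y <= rho).
    { pose proof (Cmod_triangle (y - z) z) as T. replace (y - z + z)%C with y in T by ring.
      unfold rho. lra. }
    assert (Sy : is_series (fun k => a k * Cpow y k)%C (f y)) by (apply H; unfold inD; lra).
    assert (Sz0 : is_series (fun k => a k * Cpow z k)%C (f z)) by (apply H; exact Hz).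
    pose proof (is_series_minus _ _ _ _ Sy Sz0) as S1.
    pose proof (is_series_minus _ _ _ _ S1 (is_series_scal (y - z)%C _ _ Sz)) as S2.
    replace (f y - f z - f' z * (y - z))%C
      with (plus (plus (f y) (opp (f z))) (opp (@scal C_Ring C_ModuleSpace (y - z)%C (f' z)))).
    2:{ change (f y + - f z + - ((y - z) * f' z) = f y - f z - f' z * (y - z))%C. ring. }
    apply (is_series_Cmod_le _ _ _ S2). intros n.
    eapply Rle_trans.
    { apply Cmod_sum_n_le with (w := fun k => (Cmod (y - z) * Cmod (y - z)) * (w k)).
      intros k.
      match goal with |- Cmod ?X <= _ => replace X with
        (a k * (Cpow y k - Cpow z k - INR k * Cpow z (pred k) * (y - z)))%C end.
      2:{ change (a k * (y ^ k - z ^ k - INR k * z ^ Nat.pred k * (y - z)) =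
             a k * y ^ k + - (a k * z ^ k) + - ((y - z) * (INR k * a k * z ^ Nat.pred k)))%C. ring. }
      rewrite Cmod_mult. unfold w.
      pose proof (Cpow_taylor2 y z rho k Hyr ltac:(unfold rho; lra)) as T.
      apply Rmult_le_compat_l with (r := Cmod (a k)) in T; [|apply Cmod_ge_0]. lra. }
    eapply Rle_trans; [right; apply (@sum_n_mult_l R_Ring)|]. change mult with Rmult.
    rewrite Rmult_comm. apply Rmult_le_compat_r; auto.
    pose proof (Cmod_ge_0 (y - z)). nra. }
  intros e He. exists (Rmin ((1 - Cmod z) / 2) (e / (L + 1))). split.
  { apply Rmin_case; [lra|]. apply Rdiv_lt_0_compat; lra. }
  intros y Hy. pose proof (Rmin_l ((1 - Cmod z) / 2) (e / (L + 1))).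
  pose proof (Rmin_r ((1 - Cmod z) / 2) (e / (L + 1))).
  eapply Rle_trans; [apply Q; lra|].
  pose proof (Cmod_ge_0 (y - z)) as Pm. rewrite <- Rmult_assoc.
  apply Rmult_le_compat_r; auto.
  apply Rle_trans with (L * (e / (L + 1))). { apply Rmult_le_compat_l; lra. }
  assert (0 < e / (L + 1)) by (apply Rdiv_lt_0_compat; lra).
  replace e with ((L + 1) * (e / (L + 1))) at 2 by (field; lra). nra.
Qed.

(** * Integrals over a period *)


Definition contR (H : C -> C) : Prop := forall t : R, ccont H (RtoC t).

(** Only real arguments are integrated over, but the integrand takes a complex variable so that
    [ccont] and [cder] apply to it directly. *)
Definition cint (H : C -> C) : C :=
  (RInt (fun t : R => Re (H (RtoC t))) 0 (2 * PI), RInt (fun t : R => Im (H (RtoC t))) 0 (2 * PI)).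

Lemma Ceq_ReIm (a b : C) : Re a = Re b -> Im a = Im b -> a = b.
Proof. destruct a, b; simpl. intros; subst; auto. Qed.

Lemma continuous_eps (f : R -> R) (x : R) :
  (forall eps, 0 < eps -> exists delta, 0 < delta /\
     forall y, Rabs (y - x) < delta -> Rabs (f y - f x) < eps) -> continuous f x.
Proof.
  intros H. apply filterlim_locally. intros e. destruct (H e (cond_pos e)) as (d & Hd & K).
  exists (mkposreal d Hd). intros y Hy. apply K. exact Hy.
Qed.

Lemma ccont_Re_real (H : C -> C) (t : R) : ccont H t -> continuous (fun s : R => Re (H s)) t.
Proof.
  intros K. apply continuous_eps. intros e He. destruct (K e He) as (d & Hd & Q).
  exists d. split; auto. intros y Hy. specialize (Q (RtoC y)).
  rewrite <- RtoC_minus, Cmod_R in Q. specialize (Q Hy).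
  change (Rabs (Re (H y - H t)%C) < e). eapply Rle_lt_trans; [apply re_le_Cmod|exact Q].
Qed.

Lemma ccont_Im_real (H : C -> C) (t : R) : ccont H t -> continuous (fun s : R => Im (H s)) t.
Proof.
  intros K. apply continuous_eps. intros e He. destruct (K e He) as (d & Hd & Q).
  exists d. split; auto. intros y Hy. specialize (Q (RtoC y)).
  rewrite <- RtoC_minus, Cmod_R in Q. specialize (Q Hy).
  change (Rabs (Im (H y - H t)%C) < e). eapply Rle_lt_trans; [apply Cmod_Im_le|exact Q].
Qed.

Lemma is_derive_eps (f : R -> R) (x l : R) :
  (forall eps, 0 < eps -> exists delta, 0 < delta /\
     forall y, Rabs (y - x) < delta -> Rabs (f y - f x - l * (y - x)) <= eps * Rabs (y - x)) ->
  is_derive f x l.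
Proof.
  intros H. split; [apply is_linear_scal_l|]. intros x' Hx.
  assert (Ex : x = x') by (apply (is_filter_lim_locally_unique x x' Hx)). subst x'.
  intros e. destruct (H e (cond_pos e)) as (d & Hd & K).
  exists (mkposreal d Hd). intros y Hy. specialize (K y Hy).
  rewrite (Rmult_comm l) in K. exact K.
Qed.

Lemma cder_Re_real (F : C -> C) (t : R) (d : C) : cder F t d ->
  is_derive (fun s : R => Re (F s)) t (Re d).
Proof.
  intros K. apply is_derive_eps. intros e He. destruct (K e He) as (dl & Hd & Q).
  exists dl. split; auto. intros y Hy. specialize (Q (RtoC y)).
  rewrite <- RtoC_minus, Cmod_R in Q. specialize (Q Hy).
  pose proof (re_le_Cmod (F y - F t - d * (y - t)%R)%C) as T.
  replace (Re (F y - F t - d * (y - t)%R)%C) with (Re (F y) - Re (F t) - Re d * (y - t)) in T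
    by (unfold Re; simpl; ring). lra.
Qed.

Lemma cder_Im_real (F : C -> C) (t : R) (d : C) : cder F t d ->
  is_derive (fun s : R => Im (F s)) t (Im d).
Proof.
  intros K. apply is_derive_eps. intros e He. destruct (K e He) as (dl & Hd & Q).
  exists dl. split; auto. intros y Hy. specialize (Q (RtoC y)).
  rewrite <- RtoC_minus, Cmod_R in Q. specialize (Q Hy).
  pose proof (Cmod_Im_le (F y - F t - d * (y - t)%R)%C) as T.
  replace (Im (F y - F t - d * (y - t)%R)%C) with (Im (F y) - Im (F t) - Im d * (y - t)) in T
    by (unfold Im; simpl; ring). lra.
Qed.

Lemma contR_ex_Re (H : C -> C) a b : contR H -> ex_RInt (fun t : R => Re (H t)) a b.
Proof. intros K. apply (@ex_RInt_continuous R_CompleteNormedModule). intros t _. apply ccont_Re_real, K. Qed.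

Lemma contR_ex_Im (H : C -> C) a b : contR H -> ex_RInt (fun t : R => Im (H t)) a b.
Proof. intros K. apply (@ex_RInt_continuous R_CompleteNormedModule). intros t _. apply ccont_Im_real, K. Qed.

Lemma cint_ext (H G : C -> C) : (forall t : R, H t = G t) -> cint H = cint G.
Proof. intros E. unfold cint. f_equal; apply RInt_ext; intros; rewrite E; auto. Qed.

Lemma cint_plus (H G : C -> C) : contR H -> contR G ->
  cint (fun t => H t + G t)%C = (cint H + cint G)%C.
Proof.
  intros KH KG. apply Ceq_ReIm; simpl.
  - apply (@RInt_plus R_CompleteNormedModule _ _ 0 (2 * PI)); apply contR_ex_Re; auto.
  - apply (@RInt_plus R_CompleteNormedModule _ _ 0 (2 * PI)); apply contR_ex_Im; auto.
Qed.

Lemma cint_scal (c : C) (H : C -> C) : contR H -> cint (fun t => c * H t)%C = (c * cint H)%C.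
Proof.
  intros K. pose proof (contR_ex_Re H 0 (2 * PI) K) as ER. pose proof (contR_ex_Im H 0 (2 * PI) K) as EI.
  assert (S : forall (l : R) f, ex_RInt f 0 (2 * PI) -> RInt (fun t => l * f t) 0 (2 * PI) = l * RInt f 0 (2 * PI)).
  { intros l f Hf. apply (@RInt_scal R_CompleteNormedModule f 0 (2 * PI) l Hf). }
  apply Ceq_ReIm; simpl.
  - rewrite <- !S by auto.
    apply (@RInt_minus R_CompleteNormedModule (fun t : R => fst c * Re (H t)) (fun t : R => snd c * Im (H t)) 0 (2 * PI)).
    + apply (@ex_RInt_scal R_NormedModule); auto.
    + apply (@ex_RInt_scal R_NormedModule); auto.
  - rewrite <- !S by auto.
    apply (@RInt_plus R_CompleteNormedModule (fun t : R => fst c * Im (H t)) (fun t : R => snd c * Re (H t)) 0 (2 * PI)).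
    + apply (@ex_RInt_scal R_NormedModule); auto.
    + apply (@ex_RInt_scal R_NormedModule); auto.
Qed.

Lemma cint_const (c : C) : cint (fun _ => c) = (2 * PI * c)%C.
Proof.
  unfold cint. rewrite !RInt_const. apply Ceq_ReIm; simpl; unfold scal; simpl; unfold mult; simpl; unfold Re, Im; ring.
Qed.

(** The real and imaginary parts are bounded separately, which costs a factor 2. The loss is
    harmless: the remainder estimate only needs some constant, and the maximum principle takes roots
    of high order. *)
Lemma cint_bound (H : C -> C) (M : R) : contR H ->
  (forall t : R, 0 <= t <= 2 * PI -> Cmod (H t) <= M) -> Cmod (cint H) <= 4 * PI * M.
Proof.
  intros K B. pose proof PI_RGT_0. eapply Rle_trans; [apply Cmod_le_abs|]. simpl.
  assert (Rabs (RInt (fun t : R => Re (H t)) 0 (2 * PI)) <= (2 * PI - 0) * M).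
  { apply abs_RInt_le_const; [lra|apply contR_ex_Re; auto|]. intros t Ht.
    eapply Rle_trans; [apply re_le_Cmod|auto]. }
  assert (Rabs (RInt (fun t : R => Im (H t)) 0 (2 * PI)) <= (2 * PI - 0) * M).
  { apply abs_RInt_le_const; [lra|apply contR_ex_Im; auto|]. intros t Ht.
    eapply Rle_trans; [apply Cmod_Im_le|auto]. }
  lra.
Qed.

Lemma cint_derivative (P H : C -> C) : contR H -> (forall t : R, cder P t (H t)) ->
  cint H = (P (2 * PI)%R - P 0)%C.
Proof.
  intros K D. apply Ceq_ReIm; simpl.
  - apply (is_RInt_unique (V := R_CompleteNormedModule)).
    apply (is_RInt_derive (fun t : R => Re (P t)) (fun t : R => Re (H t))).
    + intros. apply cder_Re_real, D.
    + intros. apply ccont_Re_real, K.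
  - apply (is_RInt_unique (V := R_CompleteNormedModule)).
    apply (is_RInt_derive (fun t : R => Im (P t)) (fun t : R => Im (H t))).
    + intros. apply cder_Im_real, D.
    + intros. apply ccont_Im_real, K.
Qed.

Lemma locally_interval (a b t : R) (Q : R -> Prop) : a < t < b ->
  (forall s, a < s < b -> Q s) -> locally t Q.
Proof.
  intros Ht HQ. assert (P : 0 < Rmin (t - a) (b - t)) by (apply Rmin_case; lra).
  exists (mkposreal _ P). intros s Hs. apply HQ.
  change (Rabs (s - t) < Rmin (t - a) (b - t)) in Hs.
  pose proof (Rmin_l (t - a) (b - t)). pose proof (Rmin_r (t - a) (b - t)).
  apply Rabs_def2 in Hs. lra.
Qed.

Lemma ccont_2d (p : R -> R -> R) (G : C -> C) (t x : R) :
  (forall s y, Rabs (p s y - p t x) <= Cmod (G (s, y) - G (t, x))) -> ccont G (t, x) ->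
  continuity_2d_pt p t x.
Proof.
  intros E K e. destruct (K e (cond_pos e)) as (d & Hd & Q).
  assert (P : 0 < d / 2) by lra. exists (mkposreal _ P). intros s y Hs Hy. simpl in Hs, Hy.
  eapply Rle_lt_trans; [apply E|]. apply Q.
  eapply Rle_lt_trans; [apply Cmod_le_abs|].
  unfold Re, Im. simpl. unfold Rminus in *. lra.
Qed.

(** The homotopy tool: the integral has derivative [cint (H' t) = 0] in the parameter. The margin
    [d] gives the endpoints 0 and 1 a two-sided neighbourhood, and packing both real variables into
    one complex [u] expresses joint continuity through [ccont]. *)
Lemma cint_param_constant (H H' : C -> C -> C) (d : R) : 0 < d ->
  (forall t x : R, - d < t < 1 + d -> cder (fun s => H s x) t (H' t x)) ->
  (forall t x : R, - d < t < 1 + d -> ccont (fun u => H' (Re u) (Im u)) (t, x)) ->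
  (forall t : R, - d < t < 1 + d -> contR (H t)) ->
  (forall t : R, 0 <= t <= 1 -> cint (H' t) = 0) ->
  cint (H 0) = cint (H 1).
Proof.
  intros Hd D K CH Z.
  apply Ceq_ReIm; simpl.
  - apply (@eq_is_derive R_NormedModule (fun t : R => RInt (fun x : R => Re (H t x)) 0 (2 * PI)) 0 1); [|lra].
    intros t Ht.
    (* [is_derive_RInt_param] delivers the derivative in exactly this form, so the target 0 is
       traded for it. *)
    assert (E0 : RInt (fun x : R => Derive (fun u : R => Re (H u x)) t) 0 (2 * PI) = 0).
    2: refine (eq_ind _ (fun l => is_derive (K := R_AbsRing) (V := R_NormedModule) (fun t : R => RInt (fun x : R => Re (H t x)) 0 (2 * PI)) t l) _ _ E0).
    + specialize (Z t Ht). apply (f_equal Re) in Z. simpl in Z.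
      transitivity (RInt (fun x : R => Re (H' t x)) 0 (2 * PI)); [|exact Z].
      apply RInt_ext. intros x _. apply is_derive_unique.
      apply (cder_Re_real (fun s => H s x)). apply D. lra.
    + apply is_derive_RInt_param.
      * apply (locally_interval (- d) (1 + d)); [lra|]. intros s Hs x _.
        exists (Re (H' s x)). apply (cder_Re_real (fun s => H s x)). apply D. auto.
      * intros x _. apply continuity_2d_pt_ext_loc with (fun s y => Re (H' s y)).
        { assert (P : 0 < Rmin (t + d) (1 + d - t)) by (apply Rmin_case; lra).
          exists (mkposreal _ P). intros s y Hs _. simpl in Hs. symmetry.
          apply is_derive_unique. apply (cder_Re_real (fun s => H s y)). apply D.
          pose proof (Rmin_l (t + d) (1 + d - t)). pose proof (Rmin_r (t + d) (1 + d - t)).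
          apply Rabs_def2 in Hs. lra. }
        apply ccont_2d with (fun u => H' (Re u) (Im u)); [|apply K; lra].
        intros s y. simpl. pose proof (re_le_Cmod (H' s y - H' t x)%C) as T.
        unfold Re in *. simpl in *. exact T.
      * apply (locally_interval (- d) (1 + d)); [lra|]. intros s Hs. apply contR_ex_Re, CH. auto.
  - apply (@eq_is_derive R_NormedModule (fun t : R => RInt (fun x : R => Im (H t x)) 0 (2 * PI)) 0 1); [|lra].
    intros t Ht.
    assert (E0 : RInt (fun x : R => Derive (fun u : R => Im (H u x)) t) 0 (2 * PI) = 0).
    2: refine (eq_ind _ (fun l => is_derive (K := R_AbsRing) (V := R_NormedModule) (fun t : R => RInt (fun x : R => Im (H t x)) 0 (2 * PI)) t l) _ _ E0).
    + specialize (Z t Ht). apply (f_equal Im) in Z. simpl in Z.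
      transitivity (RInt (fun x : R => Im (H' t x)) 0 (2 * PI)); [|exact Z].
      apply RInt_ext. intros x _. apply is_derive_unique.
      apply (cder_Im_real (fun s => H s x)). apply D. lra.
    + apply is_derive_RInt_param.
      * apply (locally_interval (- d) (1 + d)); [lra|]. intros s Hs x _.
        exists (Im (H' s x)). apply (cder_Im_real (fun s => H s x)). apply D. auto.
      * intros x _. apply continuity_2d_pt_ext_loc with (fun s y => Im (H' s y)).
        { assert (P : 0 < Rmin (t + d) (1 + d - t)) by (apply Rmin_case; lra).
          exists (mkposreal _ P). intros s y Hs _. simpl in Hs. symmetry.
          apply is_derive_unique. apply (cder_Im_real (fun s => H s y)). apply D.
          pose proof (Rmin_l (t + d) (1 + d - t)). pose proof (Rmin_r (t + d) (1 + d - t)).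
          apply Rabs_def2 in Hs. lra. }
        apply ccont_2d with (fun u => H' (Re u) (Im u)); [|apply K; lra].
        intros s y. simpl. pose proof (Cmod_Im_le (H' s y - H' t x)%C) as T.
        unfold Im in *. simpl in *. exact T.
      * apply (locally_interval (- d) (1 + d)); [lra|]. intros s Hs. apply contR_ex_Im, CH. auto.
Qed.

(** * Cauchy's formula and Taylor expansion *)


Definition hol (f : C -> C) : Prop :=
  exists f', forall z, inD z -> cder f z (f' z) /\ ccont f' z.

(** Radius and angle are complex so that [cder] can differentiate in either of them. *)
Definition circ (r t : C) : C := (r * cexp (Ci * t))%C.

Lemma Ci2 : (Ci * Ci)%C = (- (1))%C.
Proof. apply Ceq_ReIm; simpl; ring. Qed.

Lemma Cmod_circ (r t : R) : 0 <= r -> Cmod (circ r t) = r.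
Proof.
  intros H. unfold circ. rewrite Cmod_mult, Cmod_R, Cmod_cexp, Rabs_pos_eq by auto.
  replace (Re (Ci * t)%C) with 0 by (unfold Re; simpl; ring). rewrite exp_0. ring.
Qed.

Lemma circ_periodic (r : C) : circ r (2 * PI)%R = circ r 0.
Proof.
  unfold circ. f_equal. unfold cexp.
  replace (Re (Ci * (2 * PI)%R)%C) with 0 by (unfold Re; simpl; ring).
  replace (Re (Ci * 0)%C) with 0 by (unfold Re; simpl; ring).
  replace (Im (Ci * (2 * PI)%R)%C) with (2 * PI) by (unfold Im; simpl; ring).
  replace (Im (Ci * 0)%C) with 0 by (unfold Im; simpl; ring).
  rewrite cos_2PI, sin_2PI, cos_0, sin_0. reflexivity.
Qed.

Lemma circ_nonzero (r : R) (t : C) : 0 < r -> circ r t <> 0.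
Proof.
  intros H. apply Cmult_neq_0; [|apply cexp_nonzero]. intros E. apply RtoC_inj in E. lra.
Qed.

Lemma ccont_circ (f g : C -> C) (z : C) : ccont f z -> ccont g z -> ccont (fun u => circ (f u) (g u)) z.
Proof.
  intros Hf Hg. unfold circ. apply ccont_mult; auto.
  apply (ccont_comp cexp (fun u => Ci * g u)%C); [apply ccont_cexp|].
  apply ccont_mult; auto. apply ccont_const.
Qed.

Lemma cder_circ_l (f : C -> C) (t z a : C) : cder f z a ->
  cder (fun u => circ (f u) t) z (a * cexp (Ci * t))%C.
Proof.
  intros H. unfold circ. eapply cder_eq; [apply cder_mult; [exact H|apply cder_const]|]. cbv beta. ring.
Qed.

Lemma cder_circ_r (r t : C) : cder (fun u => circ r u) t (Ci * circ r t)%C.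
Proof.
  unfold circ. eapply cder_eq.
  { apply cder_scal. apply (cder_comp cexp (fun u => Ci * u)%C); [apply cder_cexp|].
    apply cder_scal. apply cder_id. }
  ring.
Qed.

Ltac cc := repeat first
  [ assumption | apply ccont_const | apply ccont_id | apply ccont_Re | apply ccont_Im
  | apply ccont_plus | apply ccont_minus | apply ccont_opp | apply ccont_circ
  | apply ccont_div | apply ccont_inv | apply ccont_mult | apply ccont_pow ].

Lemma Cmod_lt_neq (a b : C) : Cmod a < Cmod b -> (b - a <> 0)%C.
Proof. intros H. apply Cminus_eq_contra. intros ->. lra. Qed.

Lemma RtoC_nonzero (r : R) : r <> 0 -> RtoC r <> 0.
Proof. intros H E. apply RtoC_inj in E. auto. Qed.

(** Replacing z by t z deforms the kernel from 1 at t = 0. With c the point on the circle, the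
    t-derivative c z / (c - t z)^2 is the angular derivative of i z / (c - t z), which is periodic,
    so its integral vanishes. *)
Lemma cint_cauchy_kernel (z : C) (r : R) : Cmod z < r < 1 ->
  cint (fun t => circ r t / (circ r t - z))%C = RtoC (2 * PI).
Proof.
  intros [Hz Hr]. pose proof (Cmod_ge_0 z) as P.
  assert (N : forall t x : R, - (r - Cmod z) < t < 1 + (r - Cmod z) -> (circ r x - t * z <> 0)%C).
  { intros t x Ht. apply Cmod_lt_neq. rewrite Cmod_mult, Cmod_R, Cmod_circ by lra.
    assert (Rabs t < 1 + (r - Cmod z)) by (apply Rabs_def1; lra).
    apply Rle_lt_trans with ((1 + (r - Cmod z)) * Cmod z); [|nra].
    apply Rmult_le_compat_r; lra. }
  pose proof (cint_param_constant
    (fun t x => circ r x / (circ r x - t * z))%C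
    (fun t x => circ r x * z / ((circ r x - t * z) * (circ r x - t * z)))%C
    (r - Cmod z) ltac:(lra)) as Q.
  cbv beta in Q.
  rewrite (cint_ext (fun t : C => circ r t / (circ r t - z))%C
    (fun t : C => circ r t / (circ r t - 1 * z))%C).
  2:{ intros. rewrite Cmult_1_l. reflexivity. }
  rewrite <- Q.
  - transitivity (cint (fun _ => 1)).
    + apply cint_ext. intros t. field. apply circ_nonzero. lra.
    + rewrite cint_const. rewrite <- !RtoC_mult. f_equal. ring.
  - intros t x Ht. eapply cder_eq.
    { apply cder_div; [apply cder_const| |].
      - apply cder_minus; [apply cder_const|]. apply cder_mult; [apply cder_id|apply cder_const].
      - apply N. auto. }
    cbv beta. field. apply N. auto.
  - intros t x Ht. apply ccont_div; cc. simpl. apply Cmult_neq_0; apply (N t x Ht).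
  - intros t Ht x. apply ccont_div; cc. apply (N t x Ht).
  - intros t Ht.
    rewrite (cint_derivative (fun x => Ci * z / (circ r x - t * z))%C).
    + rewrite circ_periodic. ring.
    + intros x. assert (N' := N t x ltac:(lra)). apply ccont_div; cc. apply Cmult_neq_0; exact N'.
    + intros x. assert (N' := N t x ltac:(lra)). eapply cder_eq.
      { apply cder_div; [apply cder_const| |exact N'].
        apply cder_minus; [apply cder_circ_r|apply cder_const]. }
      cbv beta. transitivity (- (Ci * Ci) * (circ r x * z) / ((circ r x - t * z) * (circ r x - t * z)))%C.
      * field. exact N'.
      * rewrite Ci2. field. exact N'.
Qed.

(** The circle is contracted onto z through z + t (c - z). Differentiating f in t produces a factor
    c - z that cancels the kernel's denominator, leaving f'(z + t (c - z)) c, an angular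
    derivative. *)
Lemma cauchy_formula (f : C -> C) (z : C) (r : R) : hol f -> Cmod z < r < 1 ->
  cint (fun t => f (circ r t) * (circ r t / (circ r t - z)))%C = (2 * PI * f z)%C.
Proof.
  intros [f' Hf] [Hz Hr]. pose proof (Cmod_ge_0 z) as P.
  assert (N : forall x : R, (circ r x - z <> 0)%C).
  { intros x. apply Cmod_lt_neq. rewrite Cmod_circ; lra. }
  set (d := (1 - r) / 2).
  assert (I : forall t x : R, - d < t < 1 + d -> inD (z + t * (circ r x - z))%C).
  { intros t x Ht. unfold inD.
    replace (z + t * (circ r x - z))%C with ((1 - t)%R * z + t * circ r x)%C
      by (rewrite RtoC_minus; ring).
    eapply Rle_lt_trans; [apply Cmod_triangle|]. rewrite !Cmod_mult, !Cmod_R, Cmod_circ by lra.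
    assert (Rabs (1 - t) * Cmod z <= Rabs (1 - t) * r)
      by (apply Rmult_le_compat_l; [apply Rabs_pos|lra]).
    assert (Rabs (1 - t) + Rabs t <= 1 + 2 * d).
    { unfold d in *. unfold Rabs. destruct (Rcase_abs (1 - t)), (Rcase_abs t); lra. }
    assert ((Rabs (1 - t) + Rabs t) * r <= (1 + 2 * d) * r) by (apply Rmult_le_compat_r; lra).
    unfold d in *. nra. }
  pose proof (cint_param_constant
    (fun t x => f (z + t * (circ r x - z)) * (circ r x / (circ r x - z)))%C
    (fun t x => f' (z + t * (circ r x - z)) * circ r x)%C d ltac:(unfold d; lra)) as Q.
  cbv beta in Q.
  rewrite (cint_ext _ (fun t : C => f (z + 1 * (circ r t - z)) * (circ r t / (circ r t - z)))%C).
  2:{ intros. f_equal. f_equal. ring. }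
  rewrite <- Q; clear Q.
  - rewrite (cint_ext _ (fun x => f z * (circ r x / (circ r x - z)))%C).
    2:{ intros x. f_equal. f_equal. ring. }
    rewrite cint_scal.
    + rewrite cint_cauchy_kernel by lra. rewrite RtoC_mult. ring.
    + intros x. apply ccont_div; cc. apply N.
  - intros t x Ht. eapply cder_eq.
    { apply cder_mult; [|apply cder_const].
      apply (cder_comp f (fun s => z + s * (circ r x - z))%C).
      - apply Hf. apply I. exact Ht.
      - apply cder_plus; [apply cder_const|]. apply cder_mult; [apply cder_id|apply cder_const]. }
    cbv beta. field. apply N.
  - intros t x Ht. apply ccont_mult; cc.
    apply (ccont_comp f' (fun u => z + Re u * (circ r (Im u) - z))%C); cc.
    apply Hf. apply (I t x Ht).
  - intros t Ht x. apply ccont_mult; cc; [|apply N].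
    + apply (ccont_comp f (fun u => z + t * (circ r u - z))%C); cc.
      eapply cder_ccont. apply Hf. apply (I t x Ht).
  - intros t Ht.
    assert (CH : contR (fun x : C => f' (z + t * (circ r x - z)) * circ r x)%C).
    { intros x. apply ccont_mult; cc.
      apply (ccont_comp f' (fun u => z + t * (circ r u - z))%C); cc.
      apply Hf. apply (I t x). unfold d; lra. }
    (* The angular primitive f(z + t (c - z)) / (i t) breaks down at [t = 0]; there the integrand is
       the constant f'(z) times c, with primitive f'(z) c / i. *)
    destruct (Req_dec t 0) as [->|Nt].
    + rewrite (cint_derivative (fun x => f' z * / Ci * circ r x)%C); auto.
      * rewrite circ_periodic. ring.
      * intros x. eapply cder_eq. { apply cder_scal. apply cder_circ_r. }
        replace (z + 0 * (circ r x - z))%C with z by ring. field. apply Ci_nz.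
    + rewrite (cint_derivative (fun x => / (Ci * t) * f (z + t * (circ r x - z)))%C); auto.
      * rewrite circ_periodic. ring.
      * intros x. eapply cder_eq.
        { apply cder_scal. apply (cder_comp f (fun x => z + t * (circ r x - z))%C).
          - apply Hf. apply I. unfold d; lra.
          - apply cder_plus; [apply cder_const|]. apply cder_scal.
            apply cder_minus; [apply cder_circ_r|apply cder_const]. }
        cbv beta. field. split; [apply RtoC_nonzero; auto|apply Ci_nz].
Qed.

(** Holomorphy is asked only off 0, so that g may be f(w) / w^k. The radius is interpolated
    linearly, and the parameter derivative of g on the circle is a multiple of its angular
    derivative. *)
Lemma cint_circ_indep (g g' : C -> C) (r1 r2 : R) : 0 < r1 < 1 -> 0 < r2 < 1 ->
  (forall z : C, z <> 0 -> inD z -> cder g z (g' z) /\ ccont g' z) ->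
  cint (fun t => g (circ r1 t)) = cint (fun t => g (circ r2 t)).
Proof.
  intros H1 H2 Hg.
  set (d := Rmin (Rmin r1 r2) (Rmin (1 - r1) (1 - r2))).
  assert (Hd : 0 < d) by (unfold d; repeat apply Rmin_case; lra).
  assert (D1 : d <= r1) by (unfold d; eapply Rle_trans; [apply Rmin_l|apply Rmin_l]).
  assert (D2 : d <= r2) by (unfold d; eapply Rle_trans; [apply Rmin_l|apply Rmin_r]).
  assert (D3 : d <= 1 - r1) by (unfold d; eapply Rle_trans; [apply Rmin_r|apply Rmin_l]).
  assert (D4 : d <= 1 - r2) by (unfold d; eapply Rle_trans; [apply Rmin_r|apply Rmin_r]).
  pose (rho := fun t : C => (r1 + t * (r2 - r1))%C).
  assert (RR : forall t : R, rho t = RtoC (r1 + t * (r2 - r1))).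
  { intros t. unfold rho. rewrite RtoC_plus, RtoC_mult, RtoC_minus. reflexivity. }
  assert (B : forall t : R, - d < t < 1 + d -> 0 < r1 + t * (r2 - r1) < 1).
  { intros t Ht. split.
    - destruct (Rle_dec r1 r2); nra.
    - destruct (Rle_dec r1 r2); nra. }
  assert (G : forall t x : R, - d < t < 1 + d ->
    cder g (circ (rho t) x) (g' (circ (rho t) x)) /\ ccont g' (circ (rho t) x)).
  { intros t x Ht. specialize (B t Ht). rewrite RR. apply Hg.
    - apply circ_nonzero. lra.
    - unfold inD. rewrite Cmod_circ; lra. }
  assert (Crho : forall u, ccont rho u) by (intros; unfold rho; cc).
  pose proof (cint_param_constant (fun t x => g (circ (rho t) x))
    (fun t x => g' (circ (rho t) x) * ((r2 - r1) * cexp (Ci * x)))%C d Hd) as Q.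
  cbv beta in Q.
  rewrite (cint_ext _ (fun x => g (circ (rho 0) x))).
  2:{ intros. unfold rho. repeat f_equal. ring. }
  rewrite (cint_ext (fun t => g (circ r2 t)) (fun x => g (circ (rho 1) x))).
  2:{ intros. unfold rho. repeat f_equal. ring. }
  apply Q; clear Q.
  - intros t x Ht. eapply cder_eq.
    { apply (cder_comp g (fun s => circ (rho s) x)); [apply G; auto|].
      apply cder_circ_l. unfold rho. apply cder_plus; [apply cder_const|].
      apply cder_mult; [apply cder_id|apply cder_const]. }
    cbv beta. ring.
  - intros t x Ht. apply ccont_mult.
    + apply (ccont_comp g' (fun u => circ (rho (Re u)) (Im u))); [apply (G t x Ht)|].
      apply ccont_circ; [|apply ccont_Im].
      apply (ccont_comp rho (fun u => RtoC (Re u))); [apply Crho|apply ccont_Re].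
    + apply ccont_mult; cc. apply (ccont_comp cexp (fun u => Ci * Im u)%C); cc. apply ccont_cexp.
  - intros t Ht x. apply (ccont_comp g (fun u => circ (rho t) u)).
    { eapply cder_ccont. apply (G t x Ht). }
    cc.
  - intros t Ht.
    assert (B' := B t ltac:(lra)).
    assert (Nr : rho t <> 0) by (rewrite RR; apply RtoC_nonzero; lra).
    rewrite (cint_derivative (fun x => (r2 - r1) / (Ci * rho t) * g (circ (rho t) x))%C).
    + rewrite circ_periodic. ring.
    + intros x. apply ccont_mult.
      * apply (ccont_comp g' (fun u => circ (rho t) u)); [apply (G t x); lra|cc].
      * apply ccont_mult; cc. apply (ccont_comp cexp (fun u => Ci * u)%C); cc. apply ccont_cexp.
    + intros x. eapply cder_eq.
      { apply cder_scal. apply (cder_comp g (fun x => circ (rho t) x)); [apply G; lra|apply cder_circ_r]. }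
      unfold circ at 2. field. split; [auto|apply Ci_nz].
Qed.

Lemma contR_bounded (H : C -> C) : contR H -> exists M, forall t : R, 0 <= t <= 2 * PI -> Cmod (H t) <= M.
Proof.
  intros K. pose proof PI_RGT_0.
  destruct (continuity_ab_maj (fun t : R => Cmod (H t)) 0 (2 * PI)) as (m & Hm & _); [lra| |].
  - intros t _. apply continuity_pt_filterlim. apply continuous_eps. intros e He.
    destruct (K t e He) as (d & Hd & Q). exists d. split; auto. intros y Hy.
    specialize (Q y). rewrite <- RtoC_minus, Cmod_R in Q. specialize (Q Hy).
    pose proof (Cmod_sub_ge (H y) (H t)). pose proof (Cmod_sub_ge (H t) (H y)).
    rewrite (Cmod_minus_sym (H t)) in *. apply Rabs_def1; lra.
  - exists (Cmod (H m)). exact Hm.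
Qed.

(** Fixing the radius [1 / 2] makes the coefficients independent of the point of expansion; any
    radius in (0, 1) gives the same value by [taylor_coef_radius]. *)
Definition taylor_coef (f : C -> C) (k : nat) : C :=
  (/ (2 * PI) * cint (fun t => f (circ (1 / 2)%R t) / Cpow (circ (1 / 2)%R t) k))%C.

Lemma taylor_coef_radius (f : C -> C) (k : nat) (r : R) : hol f -> 0 < r < 1 ->
  cint (fun t => f (circ r t) / Cpow (circ r t) k)%C = (2 * PI * taylor_coef f k)%C.
Proof.
  intros [f' Hf] Hr. unfold taylor_coef.
  rewrite (cint_circ_indep (fun w => f w / Cpow w k)%C
    (fun w => (f' w * Cpow w k - f w * (INR k * Cpow w (pred k) * 1)) / (Cpow w k * Cpow w k))%C
    r (1 / 2)); [|lra|lra|].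
  - rewrite Cmult_assoc, Cinv_r, Cmult_1_l; auto. rewrite <- RtoC_mult. apply RtoC_nonzero.
    pose proof PI_RGT_0. lra.
  - intros z Nz Dz. destruct (Hf z Dz) as [A B]. split.
    + apply cder_div; auto. { apply (cder_pow (fun w => w)). apply cder_id. } apply Cpow_nz; auto.
    + apply ccont_div; cc. { eapply cder_ccont; eauto. }
      apply Cmult_neq_0; apply Cpow_nz; auto.
Qed.

Lemma taylor (f : C -> C) : hol f -> psum (taylor_coef f) f.
Proof.
  intros Hf z Hz. unfold inD in Hz. pose proof (Cmod_ge_0 z) as P.
  set (r := (1 + Cmod z) / 2). assert (Hr : Cmod z < r < 1) by (unfold r; lra).
  assert (N : forall x : R, (circ r x - z <> 0)%C).
  { intros x. apply Cmod_lt_neq. rewrite Cmod_circ; lra. }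
  assert (N0 : forall x : R, (circ r x <> 0)%C) by (intros; apply circ_nonzero; lra).
  assert (Cf : forall x : R, ccont (fun t => f (circ r t)) x).
  { intros x. destruct Hf as [f' Hf]. apply (ccont_comp f (fun t => circ r t)); [|cc].
    eapply cder_ccont. apply Hf. unfold inD. rewrite Cmod_circ; lra. }
  pose (J := fun m => cint (fun t => f (circ r t) * (circ r t / (circ r t - z)) / Cpow (circ r t) m)%C).
  assert (CJ : forall m, contR (fun t => f (circ r t) * (circ r t / (circ r t - z)) / Cpow (circ r t) m)%C).
  { intros m x. cc; first [apply Cf | apply N | apply Cpow_nz, N0]. }
  assert (J0 : J 0%nat = (2 * PI * f z)%C).
  { unfold J. rewrite <- (cauchy_formula f z r Hf Hr). apply cint_ext. intros t. simpl. field. apply N. }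
  (* From c / (c - z) = 1 + (z / c) (c / (c - z)). Iterating this peels off one Taylor term at a
     time with the exact remainder z^(n+1) J_(n+1), so sum and integral are never interchanged. *)
  assert (JS : forall m, J m = (2 * PI * taylor_coef f m + z * J (S m))%C).
  { intros m. unfold J. rewrite <- (taylor_coef_radius f m r Hf) by lra.
    rewrite <- cint_scal by apply CJ. rewrite <- cint_plus.
    - apply cint_ext. intros t. rewrite Cpow_S. field.
      repeat split; first [apply N | apply N0 | apply Cpow_nz, N0].
    - intros x. cc; first [apply Cf | apply Cpow_nz, N0].
    - intros x. apply ccont_mult; [apply ccont_const|apply (CJ (S m))]. }
  pose proof PI_RGT_0 as HPI.
  assert (N2 : (RtoC 2 * RtoC PI <> 0)%C).
  { rewrite <- RtoC_mult. apply RtoC_nonzero. lra. }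
  assert (SJ : forall n, (2 * PI * (f z - sum_n (fun k => taylor_coef f k * Cpow z k) n) = Cpow z (S n) * J (S n))%C).
  { induction n.
    - rewrite sum_O. specialize (JS 0%nat). rewrite J0 in JS. simpl. 
      replace (2 * PI * (f z - taylor_coef f 0 * 1))%C with (2 * PI * f z - 2 * PI * taylor_coef f 0)%C by ring.
      rewrite JS. ring.
    - rewrite sum_Sn. match goal with |- context [plus ?a ?b] => change (plus a b) with (a + b)%C end.
      match goal with |- context [sum_n ?g n] => set (T := sum_n g n : C) in * end.
      replace (2 * PI * (f z - (T + taylor_coef f (S n) * Cpow z (S n))))%C
        with (2 * PI * (f z - T) - Cpow z (S n) * (2 * PI * taylor_coef f (S n)))%C by ring.
      rewrite IHn, (JS (S n)). rewrite (Cpow_S z (S n)). ring. }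
  destruct (contR_bounded (fun t => f (circ r t) * (circ r t / (circ r t - z)))%C) as [M HM].
  { intros x. cc; first [apply Cf | apply N]. }
  assert (PM : 0 <= M). { eapply Rle_trans; [apply Cmod_ge_0|apply (HM 0)]; lra. }
  set (q := Cmod z / r).
  assert (Hq : 0 <= q < 1).
  { unfold q. split; [apply Rdiv_le_0_compat; lra|]. apply Rlt_div_l; lra. }
  assert (EST : forall n, Cmod (sum_n (fun k => taylor_coef f k * Cpow z k)%C n - f z) <= 2 * M * q ^ (S n)).
  { intros n. rewrite Cmod_minus_sym.
    apply Rmult_le_reg_l with (2 * PI); [lra|].
    replace (2 * PI * Cmod (f z - sum_n (fun k => taylor_coef f k * Cpow z k)%C n)) with
      (Cmod (2 * PI * (f z - sum_n (fun k => taylor_coef f k * Cpow z k) n))%C).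
    2:{ rewrite !Cmod_mult, !Cmod_R, !Rabs_pos_eq; lra. }
    rewrite SJ, Cmod_mult, Cmod_pow.
    assert (Cmod (J (S n)) <= 4 * PI * (M / r ^ (S n))).
    { unfold J. apply cint_bound; [apply CJ|]. intros t Ht.
      rewrite Cmod_div by apply Cpow_nz, N0. rewrite (Cmod_pow (circ r t)), Cmod_circ by lra.
      apply Rmult_le_compat_r; [|apply HM; auto].
      left. apply Rinv_0_lt_compat. apply pow_lt. lra. }
    apply Rle_trans with (Cmod z ^ S n * (4 * PI * (M / r ^ (S n)))).
    { apply Rmult_le_compat_l; auto. apply pow_le; auto. }
    right. unfold q. unfold Rdiv. rewrite Rpow_mult_distr, pow_inv. ring. }
  apply is_series_C_eps. intros e He.
  assert (Lq : is_lim_seq (fun n => 2 * M * q ^ (S n)) 0).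
  { replace 0 with (2 * M * 0) by ring. apply (is_lim_seq_scal_l _ (2 * M) 0).
    apply (is_lim_seq_incr_1 (fun n => q ^ n)). apply is_lim_seq_geom. rewrite Rabs_pos_eq; lra. }
  apply is_lim_seq_spec in Lq. destruct (Lq (mkposreal e He)) as [n0 K].
  exists n0. intros n Hn. specialize (K n Hn). simpl in K.
  eapply Rle_lt_trans; [apply EST|]. rewrite Rminus_0_r in K.
  eapply Rle_lt_trans; [apply Rle_abs|]. exact K.
Qed.

(* Landau's trick: Cauchy's formula for the powers of f, whose constant disappears in the m-th root. *)
Lemma max_principle (f : C -> C) (r M : R) (z : C) : hol f -> Cmod z < r < 1 -> 0 <= M ->
  (forall t : R, 0 <= t <= 2 * PI -> Cmod (f (circ r t)) <= M) -> Cmod (f z) <= M.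
Proof.
  intros Hf Hr PM B. pose proof (Cmod_ge_0 z) as P. pose proof PI_RGT_0 as HPI.
  assert (N : forall x : R, (circ r x - z <> 0)%C).
  { intros x. apply Cmod_lt_neq. rewrite Cmod_circ; lra. }
  assert (Cf : forall x : R, ccont (fun t => f (circ r t)) x).
  { intros x. destruct Hf as [f' Hf]. apply (ccont_comp f (fun t => circ r t)); [|cc].
    eapply cder_ccont. apply Hf. unfold inD. rewrite Cmod_circ; lra. }
  assert (Hm : forall m, hol (fun w => Cpow (f w) m)).
  { intros m. destruct Hf as [f' Hf]. exists (fun w => INR m * Cpow (f w) (pred m) * f' w)%C.
    intros w Hw. destruct (Hf w Hw) as [A A']. split; [apply cder_pow; auto|].
    apply ccont_mult; auto. apply ccont_mult; cc. eapply cder_ccont; eauto. }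
  set (K := r / (r - Cmod z)).
  assert (PK : 0 < K) by (unfold K; apply Rdiv_lt_0_compat; lra).
  assert (E : forall m, Cmod (f z) ^ m <= 2 * (M ^ m * K)).
  { intros m. apply Rmult_le_reg_l with (2 * PI); [lra|].
    rewrite <- Cmod_pow.
    replace (2 * PI * Cmod (f z ^ m)) with (Cmod (2 * PI * f z ^ m)%C).
    2:{ rewrite !Cmod_mult, !Cmod_R, !Rabs_pos_eq; lra. }
    rewrite <- (cauchy_formula _ z r (Hm m) Hr).
    replace (2 * PI * (2 * (M ^ m * K))) with (4 * PI * (M ^ m * K)) by ring.
    apply cint_bound.
    - intros x. cc; first [apply Cf | apply N].
    - intros t Ht. rewrite Cmod_mult, Cmod_pow, Cmod_div by apply N. rewrite Cmod_circ by lra.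
      apply Rmult_le_compat; try apply pow_le; try apply Cmod_ge_0.
      + apply Rdiv_le_0_compat; [lra|]. apply Cmod_gt_0, N.
      + apply pow_incr. split; [apply Cmod_ge_0|apply B, Ht].
      + unfold K. apply Rmult_le_compat_l; [lra|]. apply Rinv_le_contravar; [lra|].
        pose proof (Cmod_sub_ge (circ r t) z) as T. rewrite Cmod_circ in T; lra. }
  apply Rnot_lt_le. intros L.
  destruct (Req_dec M 0) as [M0|M0].
  { specialize (E 1%nat). rewrite M0 in *. simpl in E. lra. }
  assert (PM' : 0 < M) by lra.
  assert (X : 1 < Cmod (f z) / M) by (apply Rlt_div_r; lra).
  destruct (Pow_x_infinity (Cmod (f z) / M)) with (b := 2 * K + 1) as [n0 Hn].
  { rewrite Rabs_pos_eq; lra. }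
  specialize (Hn n0 (le_n _)). rewrite Rabs_pos_eq in Hn by (apply pow_le; lra).
  specialize (E n0). unfold Rdiv in Hn. rewrite Rpow_mult_distr, pow_inv in Hn.
  assert (PMn : 0 < M ^ n0) by (apply pow_lt; lra).
  assert (Cmod (f z) ^ n0 * / M ^ n0 <= 2 * K).
  { apply Rmult_le_reg_r with (M ^ n0); auto. rewrite Rmult_assoc, Rinv_l by lra. lra. }
  lra.
Qed.

(** * The Schwarz and Schwarz-Pick lemmas *)


Lemma inD_nbhd (z : C) : inD z -> exists d, 0 < d /\ forall y, Cmod (y - z) < d -> inD y.
Proof.
  unfold inD. intros H. exists (1 - Cmod z). split; [lra|]. intros y Hy.
  pose proof (Cmod_sub_ge y z). lra.
Qed.

Lemma inD_0 : inD 0.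
Proof. unfold inD. rewrite Cmod_0. lra. Qed.

Lemma hol_ccont (f : C -> C) (z : C) : hol f -> inD z -> ccont f z.
Proof. intros [f' H] Hz. eapply cder_ccont. apply H. auto. Qed.

Lemma hol_ext (f g : C -> C) : (forall z, inD z -> f z = g z) -> hol f -> hol g.
Proof.
  intros E [f' H]. exists f'. intros z Hz. destruct (H z Hz) as [A B]. split; auto.
  destruct (inD_nbhd z Hz) as (d & Hd & K). apply cder_ext_loc with f d; auto.
Qed.

Lemma hol_const (c : C) : hol (fun _ => c).
Proof. exists (fun _ => 0). intros. split; [apply cder_const|apply ccont_const]. Qed.

Lemma hol_id : hol (fun z => z).
Proof. exists (fun _ => 1). intros. split; [apply cder_id|apply ccont_const]. Qed.

Lemma hol_plus (f g : C -> C) : hol f -> hol g -> hol (fun z => f z + g z)%C.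
Proof.
  intros [f' Hf] [g' Hg]. exists (fun z => f' z + g' z)%C. intros z Hz.
  destruct (Hf z Hz), (Hg z Hz). split; auto using cder_plus, ccont_plus.
Qed.

Lemma hol_mult (f g : C -> C) : hol f -> hol g -> hol (fun z => f z * g z)%C.
Proof.
  intros Hf Hg. pose proof (fun z => hol_ccont f z Hf) as Cf. pose proof (fun z => hol_ccont g z Hg) as Cg.
  destruct Hf as [f' Hf], Hg as [g' Hg].
  exists (fun z => f' z * g z + f z * g' z)%C. intros z Hz.
  destruct (Hf z Hz), (Hg z Hz). split; [apply cder_mult; auto|]. apply ccont_plus; apply ccont_mult; auto.
Qed.

Lemma hol_opp (f : C -> C) : hol f -> hol (fun z => - f z)%C.
Proof.
  intros [f' Hf]. exists (fun z => - f' z)%C. intros z Hz. destruct (Hf z Hz).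
  split; auto using cder_opp, ccont_opp.
Qed.

Lemma hol_minus (f g : C -> C) : hol f -> hol g -> hol (fun z => f z - g z)%C.
Proof. intros. apply hol_plus; auto. apply hol_opp; auto. Qed.

Lemma hol_inv (f : C -> C) : hol f -> (forall z, inD z -> f z <> 0) -> hol (fun z => / f z)%C.
Proof.
  intros Hf N. pose proof (fun z => hol_ccont f z Hf) as Cf. destruct Hf as [f' Hf].
  exists (fun z => - f' z / (f z * f z))%C. intros z Hz. destruct (Hf z Hz).
  split; [apply cder_inv; auto|]. cc; auto using Cmult_neq_0.
Qed.

Lemma hol_div (f g : C -> C) : hol f -> hol g -> (forall z, inD z -> g z <> 0) ->
  hol (fun z => f z / g z)%C.
Proof. intros. apply hol_mult; auto. apply hol_inv; auto. Qed.

Lemma hol_pow (f : C -> C) (n : nat) : hol f -> hol (fun z => Cpow (f z) n).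
Proof. intros H. induction n; simpl. { apply hol_const. } apply hol_mult; auto. Qed.

Lemma hol_comp (f g : C -> C) : hol f -> hol g -> (forall z, inD z -> inD (g z)) ->
  hol (fun z => f (g z)).
Proof.
  intros [f' Hf] Hg M. pose proof (fun z => hol_ccont g z Hg) as Cg. destruct Hg as [g' Hg].
  exists (fun z => f' (g z) * g' z)%C. intros z Hz.
  destruct (Hf (g z) (M z Hz)), (Hg z Hz). split; [apply cder_comp; auto|].
  apply ccont_mult; auto. apply (ccont_comp f' g); auto.
Qed.

Lemma hol_cexp (f : C -> C) : hol f -> hol (fun z => cexp (f z)).
Proof.
  intros Hf. pose proof (fun z => hol_ccont f z Hf) as Cf. destruct Hf as [f' Hf].
  exists (fun z => cexp (f z) * f' z)%C. intros z Hz. destruct (Hf z Hz).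
  split; [apply (cder_comp cexp f); auto using cder_cexp|]. apply ccont_mult; auto.
  apply (ccont_comp cexp f); auto using ccont_cexp.
Qed.

Lemma psum_hol (a : nat -> C) (f : C -> C) : psum a f -> hol f.
Proof.
  intros H. destruct (psum_derive a f H) as (f' & H' & D).
  destruct (psum_derive _ f' H') as (f'' & _ & D').
  exists f'. intros z Hz. split; auto. eapply cder_ccont; eauto.
Qed.

(** The Taylor series upgrades the merely continuous derivative in [hol] to a holomorphic one. *)
Lemma hol_derivative (f : C -> C) : hol f ->
  exists f', hol f' /\ forall z, inD z -> cder f z (f' z).
Proof.
  intros H. destruct (psum_derive _ f (taylor f H)) as (f' & H' & D).
  exists f'. split; auto. eapply psum_hol; eauto.
Qed.

(** * Removing and inserting powers of z in a power series *)

Lemma is_series_at_0 (a : nat -> C) : is_series (fun k => a k * Cpow 0 k)%C (a 0%nat).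
Proof.
  apply is_series_C_eps. intros e He. exists 0%nat. intros n _.
  replace (sum_n (fun k => a k * Cpow 0 k)%C n) with (a 0%nat).
  { rewrite Cmod_diag. auto. }
  induction n.
  - rewrite sum_O. simpl. ring.
  - rewrite sum_Sn, <- IHn. simpl. change (a 0%nat = a 0%nat + a (S n) * (0 * Cpow 0 n))%C. ring.
Qed.

Lemma psum_at_0 (a : nat -> C) (f : C -> C) : psum a f -> f 0 = a 0%nat.
Proof.
  intros H. apply (is_series_unique_C (fun k => a k * Cpow 0 k)%C); [apply H, inD_0|apply is_series_at_0].
Qed.

Lemma psum_tail (a : nat -> C) (f : C -> C) : psum a f ->
  exists f1, psum (fun k => a (S k)) f1 /\ forall z, inD z -> f z = (a 0%nat + z * f1 z)%C.
Proof.
  intros H.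
  (* The removable value at 0 is supplied by hand. *)
  exists (fun z => if Ceq_dec z 0 then a 1%nat else (f z - a 0%nat) / z)%C. split.
  - intros z Hz. destruct (Ceq_dec z 0) as [->|N]; [apply (is_series_at_0 (fun k => a (S k)))|].
    assert (S1 : is_series (fun k => a (S k) * Cpow z (S k))%C (f z - a 0%nat)%C).
    { apply (is_series_incr_1 (fun k => a k * Cpow z k)%C).
      match goal with |- is_series _ ?x => replace x with (f z) end; [apply H; auto|].
      change (f z = f z - a 0%nat + a 0%nat * 1)%C. ring. }
    apply (is_series_scal (/ z)%C) in S1.
    replace ((f z - a 0%nat) / z)%C with (@scal C_Ring C_ModuleSpace (/ z)%C (f z - a 0%nat)%C).
    2:{ change (/ z * (f z - a 0%nat) = (f z - a 0%nat) / z)%C. field; auto. }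
    revert S1. apply is_series_ext. intros k. rewrite Cpow_S.
    change (/ z * (a (S k) * (z * Cpow z k)) = a (S k) * Cpow z k)%C. field. auto.
  - intros z Hz. destruct (Ceq_dec z 0) as [->|N].
    + rewrite (psum_at_0 a f H). ring.
    + field. auto.
Qed.

Lemma psum_factor (m : nat) : forall (a : nat -> C) (f : C -> C), psum a f ->
  (forall k, (k < m)%nat -> a k = 0) ->
  exists g, hol g /\ forall z, inD z -> f z = (Cpow z m * g z)%C.
Proof.
  induction m; intros a f H Z.
  - exists f. split; [eapply psum_hol; eauto|]. intros. simpl. ring.
  - destruct (psum_tail a f H) as (f1 & H1 & E1).
    destruct (IHm _ f1 H1) as (g & Hg & E). { intros k Hk. apply Z. lia. }
    exists g. split; auto. intros z Hz. rewrite E1, E, (Z 0%nat) by (auto; lia). simpl. ring.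
Qed.

Lemma psum_cons (a0 : C) (c : nat -> C) (f : C -> C) : psum c f ->
  psum (fun k => match k with O => a0 | S j => c j end) (fun z => a0 + z * f z)%C.
Proof.
  intros H z Hz. apply is_series_decr_1.
  match goal with |- is_series _ ?x => replace x with (@scal C_Ring C_ModuleSpace z (f z)) end.
  2:{ change (z * f z = a0 + z * f z + - (a0 * 1))%C. ring. }
  specialize (H z Hz). apply (is_series_scal z) in H. revert H. apply is_series_ext.
  intros k. rewrite Cpow_S. change (z * (c k * Cpow z k) = c k * (z * Cpow z k))%C. ring.
Qed.

Lemma psum_ext (a : nat -> C) (f g : C -> C) : (forall z, inD z -> f z = g z) -> psum a f -> psum a g.
Proof. intros E H z Hz. rewrite <- E by auto. auto. Qed.

Lemma psum_shift (m : nat) (c : nat -> C) (f : C -> C) : psum c f ->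
  exists b : nat -> C, (forall k, (k < m)%nat -> b k = 0) /\ psum b (fun z => Cpow z m * f z)%C.
Proof.
  intros H. induction m.
  - exists c. split; [intros; lia|]. eapply psum_ext; [|exact H]. intros. simpl. ring.
  - destruct IHm as (b & Z & Hb).
    exists (fun k => match k with O => RtoC 0 | S j => b j end). split.
    + intros [|k] Hk; auto. apply Z. lia.
    + eapply psum_ext; [|apply psum_cons, Hb]. intros. simpl. ring.
Qed.

(** From here on the gap in the coefficients is carried by an explicit factor with a holomorphic
    cofactor, so quotients by powers of z never have to be formed again. *)
Lemma classA_hol (n : nat) (f : C -> C) : (1 <= n)%nat ->
  classA n f <-> exists G, hol G /\ forall z, inD z -> f z = (z + Cpow z (S n) * G z)%C.
Proof.
  intros Hn. split.
  - intros (b & B0 & B1 & Z & H).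
    destruct (psum_tail b f H) as (f1 & H1 & E1).
    destruct (psum_tail _ f1 H1) as (f2 & H2 & E2).
    (* Two shifts have moved the vanishing indices 2, ..., n to 0, ..., n - 2, hence [n - 1] further
       factors. *)
    destruct (psum_factor (n - 1) _ f2 H2) as (g & Hg & E). { intros k Hk. apply Z. lia. }
    exists g. split; auto. intros z Hz. rewrite E1, E2, E, B0, B1 by auto.
    destruct n; [lia|]. replace (S n - 1)%nat with n by lia. simpl. ring.
  - intros (G & HG & E).
    destruct (psum_shift (n - 1) _ G (taylor G HG)) as (b & Z & Hb).
    exists (fun k => match k with O => RtoC 0 | S O => RtoC 1 | S (S j) => b j end).
    split; [reflexivity|]. split; [reflexivity|]. split.
    + intros [|[|k]] Hk; try lia. apply Z. lia.
    + eapply psum_ext; [|apply (psum_cons 0 _ _ (psum_cons 1 _ _ Hb))].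
      intros z Hz. rewrite E by auto. destruct n; [lia|]. replace (S n - 1)%nat with n by lia. simpl. ring.
Qed.

Lemma classP_hol (n : nat) (p : C -> C) : (1 <= n)%nat ->
  classP n p <-> (exists G, hol G /\ forall z, inD z -> p z = (1 + Cpow z n * G z)%C) /\
    forall z, inD z -> 0 < Re (p z).
Proof.
  intros Hn. unfold classP. split; intros [H P]; (split; [|exact P]); clear P.
  - destruct H as (c & C0 & Z & H).
    destruct (psum_tail c p H) as (f1 & H1 & E1).
    destruct (psum_factor (n - 1) _ f1 H1) as (g & Hg & E). { intros k Hk. apply Z. lia. }
    exists g. split; auto. intros z Hz. rewrite E1, E, C0 by auto.
    destruct n; [lia|]. replace (S n - 1)%nat with n by lia. simpl. ring.
  - destruct H as (G & HG & E).
    destruct (psum_shift (n - 1) _ G (taylor G HG)) as (b & Z & Hb).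
    exists (fun k => match k with O => RtoC 1 | S j => b j end).
    split; [reflexivity|]. split.
    + intros [|k] Hk; try lia. apply Z. lia.
    + eapply psum_ext; [|apply (psum_cons 1 _ _ Hb)].
      intros z Hz. rewrite E by auto. destruct n; [lia|]. replace (S n - 1)%nat with n by lia. simpl. ring.
Qed.

Lemma bernoulli_le (e : R) (n : nat) : 0 <= e <= 1 -> 1 - INR n * e <= (1 - e) ^ n.
Proof.
  intros He. induction n. { simpl. lra. }
  rewrite S_INR. simpl. pose proof (pos_INR n).
  assert ((1 - e) * (1 - INR n * e) <= (1 - e) * (1 - e) ^ n) by (apply Rmult_le_compat_l; lra).
  nra.
Qed.

(** Stated for the quotient psi, so the origin is included. On the circle of radius 1 - e the
    maximum principle gives |psi| <= (1 - e)^(-n); Bernoulli's inequality makes this linear in e,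
    and e tends to 0. *)
Lemma schwarz_lemma (n : nat) (psi : C -> C) : hol psi ->
  (forall z, inD z -> Cmod (Cpow z n * psi z) <= 1) ->
  forall z, inD z -> Cmod (psi z) <= 1.
Proof.
  intros Hp B z Hz. unfold inD in Hz. pose proof (Cmod_ge_0 z) as P.
  assert (Q : forall e, 0 < e < 1 - Cmod z -> Cmod (psi z) * (1 - INR n * e) <= 1).
  { intros e He. set (r := 1 - e). assert (Hr : Cmod z < r < 1) by (unfold r; lra).
    assert (Pr : 0 < r ^ n) by (apply pow_lt; lra).
    assert (Cmod (psi z) <= / r ^ n).
    { apply (max_principle psi r); auto. { left. apply Rinv_0_lt_compat; auto. }
      intros t _. specialize (B (circ r t)). rewrite Cmod_mult, Cmod_pow, Cmod_circ in B by lra.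
      specialize (B ltac:(unfold inD; rewrite Cmod_circ; lra)).
      apply Rmult_le_reg_l with (r ^ n); auto. rewrite Rinv_r; lra. }
    apply Rle_trans with (Cmod (psi z) * r ^ n).
    { apply Rmult_le_compat_l; [apply Cmod_ge_0|]. apply bernoulli_le. lra. }
    apply Rle_trans with (/ r ^ n * r ^ n). { apply Rmult_le_compat_r; lra. }
    rewrite Rinv_l; lra. }
  apply Rnot_lt_le. intros L. set (s := Cmod (psi z)) in *. pose proof (pos_INR n).
  assert (PD : 0 < s * (INR n + 1)) by (apply Rmult_lt_0_compat; lra).
  (* Small enough that s (1 - n e) still exceeds 1 when s > 1. *)
  set (e := Rmin ((1 - Cmod z) / 2) ((s - 1) / (2 * (s * (INR n + 1))))).
  assert (He : 0 < e). { unfold e. apply Rmin_case; [lra|]. apply Rdiv_lt_0_compat; lra. }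
  assert (He1 : e <= (1 - Cmod z) / 2) by apply Rmin_l.
  assert (He2 : e * (2 * (s * (INR n + 1))) <= s - 1).
  { apply Rle_trans with ((s - 1) / (2 * (s * (INR n + 1))) * (2 * (s * (INR n + 1)))).
    - apply Rmult_le_compat_r; [lra|apply Rmin_r].
    - right. field. lra. }
  specialize (Q e ltac:(lra)). nra.
Qed.

Lemma Cmod_sqr_blaschke (a b : C) :
  Cmod (1 + Cconj a * b) * Cmod (1 + Cconj a * b) - Cmod (b + a) * Cmod (b + a)
    = (1 - Cmod a * Cmod a) * (1 - Cmod b * Cmod b).
Proof. rewrite !Cmod_sqr. destruct a, b. unfold Re, Im; simpl. ring. Qed.

Lemma blaschke_nonzero (a b : C) : Cmod a < 1 -> Cmod b <= 1 -> (1 + Cconj a * b <> 0)%C.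
Proof.
  intros Ha Hb E. pose proof (Cmod_triangle (1 + Cconj a * b) (- (Cconj a * b))) as T.
  rewrite E in T. replace (0 + - (Cconj a * b))%C with (- (Cconj a * b))%C in T by ring.
  assert (E1 : (- (Cconj a * b))%C = 1).
  { replace (- (Cconj a * b))%C with (1 - (1 + Cconj a * b))%C by ring. rewrite E. ring. }
  apply (f_equal Cmod) in E1. rewrite Cmod_opp, Cmod_mult, Cmod_conj, Cmod_1 in E1.
  pose proof (Cmod_ge_0 a). pose proof (Cmod_ge_0 b). nra.
Qed.

Lemma blaschke_lt (a b : C) : Cmod a < 1 -> Cmod b < 1 -> Cmod ((b + a) / (1 + Cconj a * b)) < 1.
Proof.
  intros Ha Hb. assert (N := blaschke_nonzero a b Ha ltac:(lra)).
  rewrite Cmod_div by auto. apply Cmod_gt_0 in N. apply Rlt_div_l; auto. rewrite Rmult_1_l.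
  pose proof (Cmod_sqr_blaschke a b). pose proof (Cmod_ge_0 a). pose proof (Cmod_ge_0 b).
  pose proof (Cmod_ge_0 (b + a)).
  assert (0 < (1 - Cmod a * Cmod a) * (1 - Cmod b * Cmod b)) by (apply Rmult_lt_0_compat; nra).
  nra.
Qed.

Lemma Cmult_Cconj (a : C) : (Cconj a * a)%C = (Cmod a * Cmod a)%R.
Proof. rewrite Cmod_sqr. apply Ceq_ReIm; simpl; unfold Re, Im; ring. Qed.

(** Disc automorphisms before and after psi move z and psi(z) to 0. The composite is w g(w), the
    Schwarz lemma gives |g(0)| <= 1, and g(0) is also the chain-rule derivative d (1 - |z|^2) / (1 -
    |psi(z)|^2). *)
Lemma schwarz_pick_lt (psi : C -> C) (z d : C) : hol psi -> (forall w, inD w -> inD (psi w)) ->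
  inD z -> cder psi z d ->
  Cmod d * (1 - Cmod z * Cmod z) <= 1 - Cmod (psi z) * Cmod (psi z).
Proof.
  intros Hp B Hz D. set (c := psi z). assert (Hc : Cmod c < 1) by (apply B; auto).
  unfold inD in Hz.
  pose (T := fun w => ((w + z) / (1 + Cconj z * w))%C).
  assert (NT : forall w, inD w -> (1 + Cconj z * w <> 0)%C).
  { intros w Hw. apply blaschke_nonzero; auto. unfold inD in Hw. lra. }
  assert (TD : forall w, inD w -> inD (T w)) by (intros; apply blaschke_lt; auto).
  assert (HT : hol T).
  { apply hol_div; auto.
    - apply hol_plus; [apply hol_id|apply hol_const].
    - apply hol_plus; [apply hol_const|]. apply hol_mult; [apply hol_const|apply hol_id]. }
  assert (T0 : T 0 = z). { unfold T. field. }
  assert (Hc' : Cmod (- c) < 1) by (rewrite Cmod_opp; auto).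
  pose (Psi := fun w => ((psi (T w) + - c) / (1 + Cconj (- c) * psi (T w)))%C).
  assert (NP : forall w, inD w -> (1 + Cconj (- c) * psi (T w) <> 0)%C).
  { intros w Hw. apply blaschke_nonzero; auto. left. apply B, TD, Hw. }
  assert (HcT : hol (fun w => psi (T w))) by (apply hol_comp; auto).
  assert (HP : hol Psi).
  { apply hol_div; auto.
    - apply hol_plus; auto. apply hol_const.
    - apply hol_plus; [apply hol_const|]. apply hol_mult; auto. apply hol_const. }
  assert (P0 : Psi 0 = 0).
  { unfold Psi. rewrite T0. fold c. replace (c + - c)%C with (RtoC 0) by ring. unfold Cdiv. ring. }
  destruct (psum_factor 1 _ Psi (taylor Psi HP)) as (g & Hg & E).
  { intros k Hk. replace k with 0%nat by lia. rewrite <- (psum_at_0 _ _ (taylor Psi HP)). exact P0. }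
  assert (G1 : Cmod (g 0) <= 1).
  { apply (schwarz_lemma 1 g); auto; [|apply inD_0]. intros w Hw. rewrite <- E by auto.
    left. apply blaschke_lt; auto. apply B, TD, Hw. }
  assert (D1 : cder Psi 0 (g 0)).
  { destruct Hg as [g' Hg].
    apply cder_ext_loc with (fun w => w * g w)%C 1; [lra| |].
    - intros y Hy. rewrite E. { simpl. ring. } unfold inD. replace (y - 0)%C with y in Hy by ring. auto.
    - eapply cder_eq. { apply cder_mult; [apply cder_id|apply Hg, inD_0]. } cbv beta. ring. }
  set (k := Cmod c * Cmod c) in *. set (m := Cmod z * Cmod z).
  assert (Hk : k < 1) by (unfold k; pose proof (Cmod_ge_0 c); nra).
  assert (Hm : m < 1) by (unfold m; pose proof (Cmod_ge_0 z); nra).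
  assert (D2 : cder Psi 0 (d * (1 - m)%R / (1 - k)%R)%C).
  { assert (N0 := NP 0 inD_0). rewrite T0 in N0. fold c in N0.
    eapply cder_eq.
    { apply cder_div; [| |rewrite T0; exact N0].
      - apply cder_plus; [|apply cder_const]. apply (cder_comp psi T 0 d); [rewrite T0; exact D|].
        apply cder_div; [apply cder_plus; [apply cder_id|apply cder_const]| |apply NT, inD_0].
        apply cder_plus; [apply cder_const|]. apply cder_scal, cder_id.
      - apply cder_plus; [apply cder_const|]. apply cder_scal.
        apply (cder_comp psi T 0 d); [rewrite T0; exact D|].
        apply cder_div; [apply cder_plus; [apply cder_id|apply cder_const]| |apply NT, inD_0].
        apply cder_plus; [apply cder_const|]. apply cder_scal, cder_id. }
    cbv beta. rewrite T0. fold c.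
    assert (Ek : (1 + Cconj (- c) * c)%C = (1 - k)%R).
    { rewrite Copp_conj. unfold k. rewrite RtoC_minus, <- Cmult_Cconj. ring. }
    rewrite Ek.
    replace ((1 + 0) * (1 + Cconj z * 0) - (0 + z) * (0 + Cconj z * 1))%C with (RtoC (1 - m)).
    2:{ unfold m. rewrite RtoC_minus, <- Cmult_Cconj. ring. }
    assert (RtoC (1 - k) <> 0) by (apply RtoC_nonzero; lra).
    field. auto. }
  rewrite (cder_unique _ _ _ _ D1 D2) in G1.
  rewrite Cmod_div, Cmod_mult, !Cmod_R, !Rabs_pos_eq in G1; try lra; [|apply RtoC_nonzero; lra].
  apply Rle_div_l in G1; lra.
Qed.

(** Unimodular values are allowed, as the Schwarz lemma only yields |psi| <= 1. Scaling by t < 1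
    restores the strict bound, and t tends to 1, so no case of constant psi has to be split off. *)
Lemma schwarz_pick (psi : C -> C) (z d : C) : hol psi -> (forall w, inD w -> Cmod (psi w) <= 1) ->
  inD z -> cder psi z d ->
  Cmod d * (1 - Cmod z * Cmod z) <= 1 - Cmod (psi z) * Cmod (psi z).
Proof.
  intros Hp B Hz D.
  assert (Q : forall t, 0 < t < 1 -> t * (Cmod d * (1 - Cmod z * Cmod z)) <=
    1 - t * t * (Cmod (psi z) * Cmod (psi z))).
  { intros t Ht.
    pose proof (schwarz_pick_lt (fun w => t * psi w)%C z (t * d)%C) as X. cbv beta in X.
    rewrite !Cmod_mult, Cmod_R, Rabs_pos_eq in X by lra.
    assert (Y : t * Cmod d * (1 - Cmod z * Cmod z) <= 1 - t * Cmod (psi z) * (t * Cmod (psi z))).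
    { apply X; auto.
      - apply hol_mult; auto. apply hol_const.
      - intros w Hw. unfold inD. rewrite Cmod_mult, Cmod_R, Rabs_pos_eq by lra.
        specialize (B w Hw). pose proof (Cmod_ge_0 (psi w)). nra.
      - apply cder_scal. auto. }
    lra. }
  set (A := Cmod d * (1 - Cmod z * Cmod z)) in *. set (c := Cmod (psi z) * Cmod (psi z)) in *.
  assert (Pc : 0 <= c) by (unfold c; pose proof (Cmod_ge_0 (psi z)); nra).
  assert (PA : 0 <= A).
  { unfold A, inD in *. pose proof (Cmod_ge_0 d). pose proof (Cmod_ge_0 z).
    apply Rmult_le_pos; auto. nra. }
  apply Rnot_lt_le. intros L.
  set (e := Rmin (1 / 2) ((A - (1 - c)) / (2 * (A + 2 * c + 1)))).
  assert (He : 0 < e). { unfold e. apply Rmin_case; [lra|]. apply Rdiv_lt_0_compat; lra. }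
  assert (He1 : e <= 1 / 2) by apply Rmin_l.
  assert (He2 : e * (2 * (A + 2 * c + 1)) <= A - (1 - c)).
  { apply Rle_trans with ((A - (1 - c)) / (2 * (A + 2 * c + 1)) * (2 * (A + 2 * c + 1))).
    - apply Rmult_le_compat_r; [lra|apply Rmin_r].
    - right. field. lra. }
  specialize (Q (1 - e) ltac:(lra)). 
  assert (0 <= e * e * c) by (apply Rmult_le_pos; nra). nra.
Qed.

(** * Inverting [w e^w] *)


(** Without a zero, 1/Phi would violate the maximum principle. This is the device that solves
    equations, both for surjectivity of [wexp] and for continuity of its inverse. *)
Lemma hol_has_zero (Phi : C -> C) (z1 : C) (r m : R) : hol Phi -> Cmod z1 < r < 1 ->
  (forall t : R, 0 <= t <= 2 * PI -> m <= Cmod (Phi (circ r t))) -> Cmod (Phi z1) < m ->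
  exists z, inD z /\ Phi z = 0.
Proof.
  intros H Hr B L. apply NNPP. intros NE.
  assert (N : forall z, inD z -> Phi z <> 0) by (intros z Hz E; apply NE; exists z; auto).
  pose proof (Cmod_ge_0 (Phi z1)). assert (Pm : 0 < m) by lra.
  assert (D1 : inD z1) by (unfold inD; lra).
  assert (Q : Cmod (/ Phi z1) <= / m).
  { apply (max_principle (fun z => / Phi z)%C r); auto.
    - apply hol_inv; auto.
    - left. apply Rinv_0_lt_compat; auto.
    - intros t Ht. assert (inD (circ r t)).
      { unfold inD. pose proof (Cmod_ge_0 z1). rewrite Cmod_circ; lra. }
      rewrite Cmod_inv by auto. apply Rinv_le_contravar; auto. }
  assert (Pz : 0 < Cmod (Phi z1)) by (apply Cmod_gt_0, N, D1).
  rewrite Cmod_inv in Q by auto.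
  apply Rinv_le_contravar in Q; [|apply Rinv_0_lt_compat; auto]. rewrite !Rinv_inv in Q. lra.
Qed.

Definition wexp (w : C) : C := (w * cexp w)%C.

(** * Univalence of w e^w on the disc *)

Lemma Rabs_sin_le (t : R) : Rabs (sin t) <= Rabs t.
Proof.
  assert (P : forall t, 0 <= t -> Rabs (sin t) <= t).
  { clear t. intros t Ht. destruct (Req_dec t 0) as [->|]; [rewrite sin_0, Rabs_R0; lra|].
    destruct (Rle_dec t PI).
    - rewrite Rabs_pos_eq by (apply sin_ge_0; lra). left. apply sin_lt_x. lra.
    - pose proof (SIN_bound t). pose proof PI2_1. apply Rabs_le. lra. }
  destruct (Rle_dec 0 t).
  - rewrite (Rabs_pos_eq t) by lra. auto.
  - rewrite <- (Ropp_involutive t) at 1. rewrite sin_neg, Rabs_Ropp, (Rabs_left t) by lra.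
    apply P. lra.
Qed.

Lemma sin_sqr_le (t : R) : sin t * sin t <= t * t.
Proof.
  pose proof (Rabs_sin_le t) as H. apply Rsqr_le_abs_1 in H. unfold Rsqr in H. exact H.
Qed.

Lemma cos_lower (y : R) : 1 - cos y <= y * y / 2.
Proof.
  replace y with (2 * (y / 2)) at 1 by field. rewrite cos_2a_sin.
  pose proof (sin_sqr_le (y / 2)). lra.
Qed.

(** With u = x + i y, |e^u - 1|^2 = (1 - e^x)^2 + 2 e^x (1 - cos y), and for x <= 0 the two terms
    are at most x^2 and y^2. *)
Lemma Cmod_cexp_minus_1_le (u : C) : Re u <= 0 -> Cmod (cexp u - 1) <= Cmod u.
Proof.
  intros H. apply Cmod_le_sqr; [apply Cmod_ge_0|]. rewrite Cmod_sqr.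
  set (x := Re u) in *. set (y := Im u).
  replace (Re (cexp u - 1)%C) with (exp x * cos y - 1) by (unfold x, y, Re, Im; simpl; unfold Re, Im; ring).
  replace (Im (cexp u - 1)%C) with (exp x * sin y) by (unfold x, y, Re, Im; simpl; unfold Re, Im; ring).
  pose proof (exp_ineq1_le x). pose proof (exp_pos x). pose proof (cos_lower y).
  assert (exp x <= 1). { rewrite <- exp_0. destruct H as [H| ->]; [left; apply exp_increasing; auto|lra]. }
  pose proof (sin2_cos2 y) as SC. unfold Rsqr in SC.
  replace ((exp x * cos y - 1) * (exp x * cos y - 1) + exp x * sin y * (exp x * sin y))
    with (exp x * exp x * (sin y * sin y + cos y * cos y) - 2 * exp x * cos y + 1) by ring.
  rewrite SC.
  replace (exp x * exp x * 1 - 2 * exp x * cos y + 1)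
    with ((1 - exp x) * (1 - exp x) + 2 * exp x * (1 - cos y)) by ring.
  assert ((1 - exp x) * (1 - exp x) <= x * x) by nra.
  pose proof (COS_bound y).
  assert (exp x * (1 - cos y) <= 1 * (1 - cos y)) by (apply Rmult_le_compat_r; lra).
  lra.
Qed.

(** With u = w2 - w1 the equation reads w1 = w2 e^u, so |u| = |w2| |e^u - 1| <= |w2| |u|, and |w2| <
    1 forces u = 0. The sign condition on Re u costs nothing, since the two points can be
    exchanged. *)
Lemma wexp_inj_aux (w1 w2 : C) : inD w2 -> wexp w1 = wexp w2 -> Re (w2 - w1)%C <= 0 -> w1 = w2.
Proof.
  intros H2 E Hu. set (u := (w2 - w1)%C) in *.
  assert (E1 : w1 = (w2 * cexp u)%C).
  { unfold wexp in E. replace w2 with (w1 + u)%C in E at 2 by (unfold u; ring).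
    rewrite cexp_plus in E.
    assert (N := cexp_nonzero w1).
    replace w1 with (w1 * cexp w1 / cexp w1)%C by (field; auto). rewrite E.
    replace (w1 * cexp w1 / cexp w1)%C with w1 by (field; auto). field. auto. }
  assert (E2 : Cmod u <= Cmod w2 * Cmod u).
  { replace (Cmod u) with (Cmod (w2 * (cexp u - 1))) at 1.
    - rewrite Cmod_mult. apply Rmult_le_compat_l; [apply Cmod_ge_0|].
      apply Cmod_cexp_minus_1_le. exact Hu.
    - replace (w2 * (cexp u - 1))%C with (w1 - w2)%C by (rewrite E1 at 1; ring).
      unfold u. apply Cmod_minus_sym. }
  unfold inD in H2. pose proof (Cmod_ge_0 u).
  assert (Z : Cmod u = 0) by nra. apply Cmod_eq_0 in Z. unfold u in Z.
  symmetry. apply Ceq_minus. exact Z.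
Qed.

Lemma wexp_inj (w1 w2 : C) : inD w1 -> inD w2 -> wexp w1 = wexp w2 -> w1 = w2.
Proof.
  intros H1 H2 E. destruct (Rle_dec (Re (w2 - w1)%C) 0) as [L|L].
  - apply wexp_inj_aux; auto.
  - symmetry. apply wexp_inj_aux; auto.
    replace (Re (w1 - w2)%C) with (- Re (w2 - w1)%C) by (unfold Re; simpl; ring). lra.
Qed.

Lemma cder_wexp (w : C) : cder wexp w ((1 + w) * cexp w)%C.
Proof.
  unfold wexp. eapply cder_eq; [apply cder_mult; [apply cder_id|apply cder_cexp]|]. cbv beta. ring.
Qed.

Lemma hol_wexp (f : C -> C) : hol f -> hol (fun z => wexp (f z)).
Proof. intros. apply hol_mult; auto. apply hol_cexp; auto. Qed.

Lemma wexp_deriv_nonzero (w : C) : inD w -> ((1 + w) * cexp w <> 0)%C.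
Proof.
  intros H. apply Cmult_neq_0; [|apply cexp_nonzero]. intros E.
  assert (E1 : w = (- (1))%C).
  { replace w with ((1 + w) - 1)%C by ring. rewrite E. ring. }
  unfold inD in H. rewrite E1, Cmod_opp, Cmod_1 in H. lra.
Qed.

(** * A disc inside the image of w e^w *)

Definition ie : R := / exp 1.

Lemma ie_bounds : 0 < ie < 4 / 9.
Proof.
  pose proof (exp_pos 1). unfold ie. split; [apply Rinv_0_lt_compat; auto|].
  assert (E : 9 / 4 < exp 1).
  (* The constant 4/9 comes from e^(1/2) > 3/2. *)
  { replace 1 with (1 / 2 + 1 / 2) by field. rewrite exp_plus.
    assert (3 / 2 < exp (1 / 2)) by (pose proof (exp_ineq1 (1 / 2)); lra). nra. }
  replace (4 / 9) with (/ (9 / 4)) by field. apply Rinv_lt_contravar; lra.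
Qed.

Lemma ie_exp : ie = exp (- (1)).
Proof. unfold ie. rewrite exp_Ropp. reflexivity. Qed.

(** Since r sin d has the sign of d and |r sin d| <= |d|, the angle d - r sin d lies between 0 and
    d, where the cosine is monotone. *)
Lemma one_minus_cos_drop (d r : R) : - PI <= d <= PI -> 0 <= r <= 1 ->
  1 - cos (d - r * sin d) <= 1 - cos d.
Proof.
  assert (P : forall d, 0 <= d <= PI -> 0 <= r <= 1 -> cos d <= cos (d - r * sin d)).
  { clear d. intros d Hd Hr. pose proof (sin_ge_0 d ltac:(lra) ltac:(lra)).
    pose proof (Rabs_sin_le d) as S. rewrite !Rabs_pos_eq in S by lra.
    assert (r * sin d <= 1 * sin d) by (apply Rmult_le_compat_r; lra).
    assert (0 <= r * sin d) by (apply Rmult_le_pos; lra).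
    apply cos_decr_1; lra. }
  intros Hd Hr. destruct (Rle_dec 0 d).
  - specialize (P d). lra.
  - specialize (P (- d)). rewrite sin_neg, cos_neg in P.
    replace (- d - r * - sin d) with (- (d - r * sin d)) in P by ring. rewrite cos_neg in P. lra.
Qed.

Lemma wexp_circ (r t : R) :
  wexp (circ r t) = (r * (exp (r * cos t) * cos (t + r * sin t)), r * (exp (r * cos t) * sin (t + r * sin t))).
Proof.
  assert (E : circ r t = (r * cos t, r * sin t)).
  { unfold circ, cexp.
    replace (Re (Ci * t)%C) with 0 by (unfold Re; simpl; ring).
    replace (Im (Ci * t)%C) with t by (unfold Im; simpl; ring).
    rewrite exp_0. apply Ceq_ReIm; simpl; unfold Re, Im; ring. }
  unfold wexp. rewrite E. rewrite cos_plus, sin_plus. unfold cexp, Re, Im; simpl. unfold Cmult; simpl.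
  f_equal; ring.
Qed.

(* With [t = PI + d], both [1 + cos t] and [1 + cos (t + r sin t)] are of the form [1 - cos];
   the second is the smaller one, which gives the estimate down to the tangency point [t = PI]. *)
Lemma wexp_circ_lower (r t : R) : 3 / 4 <= r < 1 -> 0 <= t <= 2 * PI ->
  ie / 4 + r * ie <= Cmod (wexp (circ r t) - (ie / 4)%R).
Proof.
  intros Hr Ht. pose proof ie_bounds as HE. set (a := ie / 4).
  assert (Pa : 0 < a) by (unfold a; lra).
  set (X := exp (r * cos t)). set (Y := exp (- r)). set (k := cos (t + r * sin t)).
  assert (HY : ie <= Y).
  { rewrite ie_exp. unfold Y. left. apply exp_increasing. lra. }
  assert (Px : 0 < X) by apply exp_pos.
  assert (C1 : 1 + k <= 1 + cos t).
  { pose proof (one_minus_cos_drop (t - PI) r ltac:(lra) ltac:(lra)) as D.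
    assert (Ec : cos (t - PI) = - cos t) by (rewrite cos_minus, cos_PI, sin_PI; ring).
    assert (Es : sin (t - PI) = - sin t) by (rewrite sin_minus, cos_PI, sin_PI; ring).
    rewrite Es, Ec in D.
    replace (t - PI - r * - sin t) with (t + r * sin t - PI) in D by ring.
    rewrite (cos_minus (t + r * sin t)), cos_PI, sin_PI in D. unfold k. lra. }
  pose proof (COS_bound t) as Bc.
  assert (XY : Y * (1 + r * (1 + cos t)) <= X).
  { replace X with (Y * exp (r * (1 + cos t))).
    - apply Rmult_le_compat_l; [left; apply exp_pos|]. apply exp_ineq1_le.
    - unfold X, Y. rewrite <- exp_plus. f_equal. ring. }
  set (q := 1 + cos t) in *.
  assert (Hq : 0 <= q) by (unfold q; lra).
  assert (M : Cmod (wexp (circ r t) - a) * Cmod (wexp (circ r t) - a) = r * r * (X * X) - 2 * a * r * X * k + a * a).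
  { rewrite Cmod_sqr, wexp_circ. fold X k. set (s := sin (t + r * sin t)).
    pose proof (sin2_cos2 (t + r * sin t)) as SC. unfold Rsqr in SC. fold k s in SC.
    unfold Re, Im; simpl.
    replace ((r * (X * k) + - a) * (r * (X * k) + - a) + (r * (X * s) + - 0) * (r * (X * s) + - 0))
      with (r * r * (X * X) * (s * s + k * k) - 2 * a * r * X * k + a * a) by ring.
    rewrite SC. ring. }
  assert (PY : 0 < Y) by (apply exp_pos).
  assert (YX : Y <= X) by (assert (0 <= Y * (r * q)) by (apply Rmult_le_pos; [lra|]; apply Rmult_le_pos; lra); lra).
  (* After cancelling a^2 and a factor r this says 2 a (X k + Y) <= r (X - Y) (X + Y). Both sides
     are compared with multiples of X q: the left is at most 2 a X q, the right at least r^2 Y X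
     q. *)
  assert (Main : (a + r * Y) * (a + r * Y) <= r * r * (X * X) - 2 * a * r * X * k + a * a).
  { assert (T1 : 2 * a * (X * k + Y) <= 2 * a * (X * q)).
    { apply Rmult_le_compat_l; [lra|]. nra. }
    assert (T2 : Y * r * q * X <= (X - Y) * (X + Y)).
    { apply Rmult_le_compat; try lra. repeat apply Rmult_le_pos; lra. }
    (* Here the choice of [a] matters: 2 a = ie / 2 <= Y / 2, and r >= 3/4 makes r^2 >= 9/16 >
       1/2. *)
    assert (T3 : 2 * a * (X * q) <= r * (Y * r * q * X)).
    { replace (r * (Y * r * q * X)) with (r * r * Y * (X * q)) by ring.
      apply Rmult_le_compat_r; [apply Rmult_le_pos; lra|].
      unfold a. assert (9 / 16 <= r * r) by nra. nra. }
    assert (T4 : r * (2 * a * (X * k + Y)) <= r * (r * ((X - Y) * (X + Y)))).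
    { apply Rmult_le_compat_l; [lra|].
      assert (r * (Y * r * q * X) <= r * ((X - Y) * (X + Y))) by (apply Rmult_le_compat_l; lra). lra. }
    lra. }
  rewrite <- M in Main. pose proof (Cmod_ge_0 (wexp (circ r t) - a)).
  assert (r * ie <= r * Y) by (apply Rmult_le_compat_l; lra).
  apply Rle_trans with (a + r * Y); [lra|].
  apply Rnot_lt_le. intros L. nra.
Qed.

(** If the value at w1 is closer to v than v is to the boundary of the comparison disc, then on a
    circle near the unit circle [wexp] is farther from v than at w1, so [wexp w - v] has a zero. *)
Lemma wexp_surj_step (v w1 : C) : inD w1 ->
  Cmod (wexp w1 - v) < ie / 4 + ie - Cmod (v - (ie / 4)%R) -> exists w, inD w /\ wexp w = v.
Proof.
  intros H1 L. unfold inD in H1. pose proof ie_bounds. pose proof (Cmod_ge_0 w1).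
  set (gap := ie / 4 + ie - Cmod (v - (ie / 4)%R) - Cmod (wexp w1 - v)).
  assert (Hg : 0 < gap) by (unfold gap; lra).
  set (e := Rmin (Rmin (1 / 4) ((1 - Cmod w1) / 2)) (gap / 2)).
  assert (He : 0 < e) by (unfold e; repeat apply Rmin_case; lra).
  assert (He1 : e <= 1 / 4) by (unfold e; eapply Rle_trans; [apply Rmin_l|apply Rmin_l]).
  assert (He2 : e <= (1 - Cmod w1) / 2) by (unfold e; eapply Rle_trans; [apply Rmin_l|apply Rmin_r]).
  assert (He3 : e <= gap / 2) by apply Rmin_r.
  destruct (hol_has_zero (fun w => wexp w - v)%C w1 (1 - e) (Cmod (wexp w1 - v) + gap - e * ie))
    as (w & Hw & E).
  - apply hol_minus; [apply (hol_wexp (fun w => w)), hol_id|apply hol_const].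
  - lra.
  - intros t Ht. pose proof (wexp_circ_lower (1 - e) t ltac:(lra) Ht) as B.
    pose proof (Cmod_minus_triangle (wexp (circ (1 - e)%R t)) v (ie / 4)%R) as T.
    unfold gap. lra.
  - nra.
  - exists w. split; auto. apply Ceq_minus. exact E.
Qed.

(** The segment from 0 to v is walked in N equal steps, each preimage serving as the starting point
    for the next; N is chosen so that a step is shorter than the distance to the boundary. *)
Lemma wexp_surj (v : C) : Cmod (v - (ie / 4)%R) < ie / 4 + ie -> exists w, inD w /\ wexp w = v.
Proof.
  intros Hv. pose proof ie_bounds as HE.
  (* The two entries are the distances of 0 and of v to the boundary circle. By convexity every
     point of the segment keeps at least the smaller one. *)
  set (gap := Rmin ie (ie / 4 + ie - Cmod (v - (ie / 4)%R))).
  assert (Hg : 0 < gap) by (unfold gap; apply Rmin_case; lra).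
  assert (Hg1 : gap <= ie) by apply Rmin_l.
  assert (Hg2 : gap <= ie / 4 + ie - Cmod (v - (ie / 4)%R)) by apply Rmin_r.
  destruct (archimed_cor1 (gap / (Cmod v + 1))) as (N & HN & PN).
  { apply Rdiv_lt_0_compat; auto. pose proof (Cmod_ge_0 v). lra. }
  assert (PNR : 0 < INR N) by (apply lt_0_INR; lia).
  pose proof (Cmod_ge_0 v) as Pv.
  assert (Hs : Cmod v / INR N < gap).
  { apply Rmult_lt_compat_r with (r := Cmod v + 1) in HN; [|lra].
    replace (gap / (Cmod v + 1) * (Cmod v + 1)) with gap in HN by (field; lra).
    assert (0 < / INR N) by (apply Rinv_0_lt_compat; auto). unfold Rdiv. nra. }
  assert (Q : forall k, (k <= N)%nat -> exists w, inD w /\ wexp w = ((INR k / INR N)%R * v)%C).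
  { induction k as [|k IH]; intros Hk.
    - exists (RtoC 0). split; [apply inD_0|]. unfold wexp. simpl.
      replace (0 / INR N) with 0 by (field; lra). ring.
    - destruct IH as (w & Hw & E); [lia|].
      apply (wexp_surj_step _ w Hw). rewrite E.
      assert (T0 : 0 <= INR (S k) / INR N <= 1).
      { split. - apply Rdiv_le_0_compat; auto. apply pos_INR.
        - apply Rle_div_l; auto. rewrite Rmult_1_l. apply le_INR. lia. }
      set (s := INR (S k) / INR N) in *.
      replace (INR k / INR N) with (s - / INR N) by (unfold s; rewrite S_INR; field; lra).
      replace ((s - / INR N)%R * v - s * v)%C with (- ((/ INR N)%R * v))%C.
      2:{ rewrite RtoC_minus. ring. }
      rewrite Cmod_opp, Cmod_mult, Cmod_R, Rabs_pos_eq by (left; apply Rinv_0_lt_compat; auto).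
      replace (s * v - (ie / 4)%R)%C with (s * (v - (ie / 4)%R) + - ((1 - s)%R * (ie / 4)%R))%C
        by (rewrite RtoC_minus; ring).
      pose proof (Cmod_triangle (s * (v - (ie / 4)%R)) (- ((1 - s)%R * (ie / 4)%R))) as T.
      rewrite Cmod_opp, !Cmod_mult, !Cmod_R, !Rabs_pos_eq in T by lra.
      unfold Rdiv in Hs. rewrite Rmult_comm in Hs.
      assert (s * Cmod (v - (ie / 4)%R) <= s * (ie / 4 + ie - gap)) by (apply Rmult_le_compat_l; lra).
      nra. }
  destruct (Q N (le_n N)) as (w & Hw & E). exists w. split; auto. rewrite E.
  replace (INR N / INR N) with 1 by (field; lra). ring.
Qed.

(** For w = x + i t a real value means x sin t = - t cos t, whence sin^2 t (x^2 + t^2) = t^2. With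
    |w| < 1 and |sin t| <= |t| this forces t = 0, and x e^x >= -1/e on the real line. *)
Lemma wexp_real_value (w : C) (y : R) : inD w -> wexp w = RtoC y -> - ie <= y.
Proof.
  intros Hw E. unfold inD in Hw.
  assert (S : Re w * Re w + Im w * Im w < 1).
  { rewrite <- Cmod_sqr. pose proof (Cmod_ge_0 w). nra. }
  destruct w as [x t]. unfold Re, Im in S; simpl in S.
  unfold wexp, cexp, RtoC, Cmult in E. simpl in E. injection E as E1 E2. unfold Re, Im in E1, E2; simpl in E1, E2.
  pose proof (exp_pos x) as P.
  assert (Z : x * sin t + t * cos t = 0).
  { apply Rmult_eq_reg_l with (exp x); lra. }
  pose proof (sin2_cos2 t) as SC. unfold Rsqr in SC. pose proof (sin_sqr_le t).
  assert (T : t = 0).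
  { destruct (Req_dec t 0); auto. exfalso.
    assert (SS : sin t * sin t * (x * x + t * t) = t * t).
    { assert (x * sin t = - (t * cos t)) by lra.
      replace (sin t * sin t * (x * x + t * t))
        with ((x * sin t) * (x * sin t) + t * t * (sin t * sin t)) by ring.
      rewrite H1. replace (- (t * cos t) * - (t * cos t)) with (t * t * (cos t * cos t)) by ring.
      rewrite <- Rmult_plus_distr_l. replace (cos t * cos t + sin t * sin t) with 1 by lra. ring. }
    assert (0 < t * t) by nra. nra. }
  subst t. rewrite cos_0, sin_0 in E1. rewrite ie_exp.
  assert (exp (- (1)) >= - x * exp x).
  { replace (exp (-(1))) with (exp (- 1 - x) * exp x) by (rewrite <- exp_plus; f_equal; ring).
    pose proof (exp_ineq1_le (- 1 - x)). nra. }
  lra.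
Qed.

(** Preimages are chosen pointwise; univalence leaves no freedom, so any solution found near w(z0)
    must be the chosen one, which gives continuity. Differentiability then follows since the
    derivative of [wexp] does not vanish in the disc. *)
Lemma wexp_lift (V : C -> C) : hol V ->
  (forall z, inD z -> Cmod (V z - (ie / 4)%R) < ie / 4 + ie) ->
  exists w, hol w /\ forall z, inD z -> inD (w z) /\ wexp (w z) = V z.
Proof.
  intros HV B.
  assert (EX : forall z, exists w, inD z -> inD w /\ wexp w = V z).
  { intros z. destruct (classic (inD z)) as [Hz|Hz].
    - destruct (wexp_surj (V z) (B z Hz)) as (w & Hw). exists w. auto.
    - exists (RtoC 0). intros; contradiction. }
  destruct (functional_choice _ EX) as [w Hw]. exists w. split; [|exact Hw].
  pose proof (fun z => hol_ccont V z HV) as CV. destruct HV as [V' HV].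
  assert (CW : forall z, inD z -> ccont w z).
  { intros z0 Hz0 e He. destruct (Hw z0 Hz0) as [W0 E0]. set (w0 := w z0) in *.
    set (d := ((1 + w0) * cexp w0)%C).
    assert (Pd : 0 < Cmod d) by (apply Cmod_gt_0, wexp_deriv_nonzero; auto).
    destruct (cder_wexp w0 (Cmod d / 2)) as (d1 & Hd1 & K1); [lra|]. fold d in K1.
    unfold inD in W0.
    set (q := Rmin (Rmin e d1) (1 - Cmod w0) / 2).
    assert (Hq : 0 < q) by (unfold q; repeat apply Rmin_case; lra).
    assert (Q1 : q < e).
    { unfold q. pose proof (Rmin_l (Rmin e d1) (1 - Cmod w0)). pose proof (Rmin_l e d1). unfold q in Hq. lra. }
    assert (Q2 : q < d1).
    { unfold q. pose proof (Rmin_l (Rmin e d1) (1 - Cmod w0)). pose proof (Rmin_r e d1). unfold q in Hq. lra. }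
    assert (Q3 : q < 1 - Cmod w0).
    { unfold q. pose proof (Rmin_r (Rmin e d1) (1 - Cmod w0)). unfold q in Hq. lra. }
    (* On |h| = q/2 the increment of [wexp] is at least |d| q/2 - |d| q/4 = |d| q/4. A change of V
       below |d| q/8 leaves more than |d| q/8 there and less than that at the centre, as
       [hol_has_zero] requires. *)
    destruct (CV z0 Hz0 (Cmod d * q / 8)) as (d2 & Hd2 & K2). { apply Rdiv_lt_0_compat; [|lra]. apply Rmult_lt_0_compat; auto. }
    destruct (inD_nbhd z0 Hz0) as (d3 & Hd3 & K3).
    exists (Rmin d2 d3). split; [apply Rmin_case; auto|]. intros y Hy.
    pose proof (Rmin_l d2 d3). pose proof (Rmin_r d2 d3).
    assert (Dy : inD y) by (apply K3; lra).
    specialize (K2 y ltac:(lra)). destruct (Hw y Dy) as [Wy Ey].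
    assert (ID : forall u, inD u -> inD (w0 + q * u)%C).
    { unfold inD. intros u Hu. eapply Rle_lt_trans; [apply Cmod_triangle|].
      rewrite Cmod_mult, Cmod_R, Rabs_pos_eq by lra. nra. }
    destruct (hol_has_zero (fun u => wexp (w0 + q * u) - V y)%C 0 (1 / 2) (Cmod d * q / 8)) as (u & Hu & Eu).
    - apply hol_minus; [|apply hol_const]. apply (hol_wexp (fun u => w0 + q * u)%C).
      apply hol_plus; [apply hol_const|]. apply hol_mult; [apply hol_const|apply hol_id].
    - rewrite Cmod_0. lra.
    - intros t _. set (h := (q * circ (1 / 2)%R t)%C).
      assert (Mh : Cmod h = q / 2).
      { unfold h. rewrite Cmod_mult, Cmod_R, Cmod_circ, Rabs_pos_eq by lra. field. }
      specialize (K1 (w0 + h)%C). replace (w0 + h - w0)%C with h in K1 by ring. rewrite Mh in K1.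
      specialize (K1 ltac:(lra)).
      pose proof (Cmod_sub_ge (d * h) (wexp (w0 + h) - wexp w0)) as T1.
      rewrite Cmod_mult, Mh in T1.
      rewrite (Cmod_minus_sym (d * h)) in T1.
      pose proof (Cmod_sub_ge (wexp (w0 + h) - wexp w0) (V y - V z0)) as T2.
      replace (wexp (w0 + h) - wexp w0 - (V y - V z0))%C with (wexp (w0 + h) - V y)%C in T2
        by (rewrite E0; ring).
      fold h. lra.
    - replace (w0 + q * 0)%C with w0 by ring. rewrite E0, Cmod_minus_sym. exact K2.
    - assert (Ew : w y = (w0 + q * u)%C).
      { apply wexp_inj; auto. rewrite Ey. symmetry. apply Ceq_minus. exact Eu. }
      rewrite Ew. replace (w0 + q * u - w0)%C with (q * u)%C by ring.
      rewrite Cmod_mult, Cmod_R, Rabs_pos_eq by lra. unfold inD in Hu. pose proof (Cmod_ge_0 u). nra. }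
  exists (fun z => V' z / ((1 + w z) * cexp (w z)))%C.
  intros z Hz. destruct (HV z Hz) as [DV CV']. destruct (Hw z Hz) as [Wz Ez].
  assert (N := wexp_deriv_nonzero _ Wz). pose proof (CW z Hz) as Cw. split.
  (* In Caratheodory's form, V(y) - V(z) equals both v(y) (y - z) and p(w(y)) (w(y) - w(z)), so the
     difference quotient of w is v / (p o w), continuous at z. *)
  - pose proof (cder_wexp (w z)) as DF.
    rewrite cder_caratheodory in DF, DV |- *.
    destruct DF as (p & d1 & Hd1 & Cp & Ep & P). destruct DV as (v & d2 & Hd2 & Cv & Ev & Q).
    assert (Cpw : ccont (fun y => p (w y)) z) by (apply ccont_comp; auto).
    destruct (ccont_nonzero _ _ Cpw) as (d3 & Hd3 & K3). { rewrite Ep. exact N. }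
    destruct (Cw d1 Hd1) as (d4 & Hd4 & K4). destruct (inD_nbhd z Hz) as (d5 & Hd5 & K5).
    exists (fun y => v y / p (w y))%C, (Rmin (Rmin d2 d3) (Rmin d4 d5)).
    split; [repeat apply Rmin_case; auto|]. split; [|split].
    + apply ccont_div; auto. rewrite Ep. exact N.
    + rewrite Ev, Ep. reflexivity.
    + intros y Hy.
      pose proof (Rmin_l (Rmin d2 d3) (Rmin d4 d5)). pose proof (Rmin_r (Rmin d2 d3) (Rmin d4 d5)).
      pose proof (Rmin_l d2 d3). pose proof (Rmin_r d2 d3). pose proof (Rmin_l d4 d5). pose proof (Rmin_r d4 d5).
      assert (Np : p (w y) <> 0).
      { apply Cmod_gt_0. specialize (K3 y ltac:(lra)). pose proof (Cmod_ge_0 (p (w z))). lra. }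
      specialize (Q y ltac:(lra)). specialize (K4 y ltac:(lra)). specialize (P (w y) K4).
      destruct (Hw y (K5 y ltac:(lra))) as [_ Ey]. rewrite Ey, Ez, Q in P.
      replace (v y / p (w y) * (y - z))%C with (v y * (y - z) / p (w y))%C by (field; auto).
      rewrite P. field. auto.
  - apply ccont_div; auto. apply ccont_mult.
    + apply ccont_plus; [apply ccont_const|auto].
    + apply (ccont_comp cexp w); auto. apply ccont_cexp.
Qed.

(** * The logarithmic derivative of a close-to-star function *)


(** Two nested inductions. The right side minus the left grows by (1 - r^2) E(n) from n to n + 1,
    and E(n) itself starts at a nonnegative value and grows by r^(2n) (1 - r^2) (1 - r) ((n + 2) r +
    n) >= 0. *)
Lemma pow_mean_ineq (r : R) (n : nat) : 0 <= r <= 1 ->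
  2 * r * (1 - r ^ n * r ^ n) <= INR n * (1 - r * r) * (1 + r ^ n * r ^ n).
Proof.
  intros Hr.
  assert (E : forall n, 0 <= 1 + (INR n + 1) * (r ^ n * r ^ n * (r * r)) - INR n * (r ^ n * r ^ n)
    - 2 * (r ^ n * r ^ n * r)).
  { clear n. induction n as [|n IH].
    - simpl. nra.
    - rewrite S_INR. simpl pow. set (k := INR n) in *.
      assert (0 <= k) by apply pos_INR.
      set (y := r ^ n * r ^ n) in *.
      assert (0 <= y). { unfold y. apply Rmult_le_pos; apply pow_le; lra. }
      assert (0 <= y * ((1 - r * r) * (1 - r) * ((k + 2) * r + k))).
      { apply Rmult_le_pos; auto. apply Rmult_le_pos; [|nra]. apply Rmult_le_pos; nra. }
      replace (r * r ^ n * (r * r ^ n)) with (r * r * y) by (unfold y; ring).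
      lra. }
  induction n as [|n IH].
  - simpl. lra.
  - specialize (E n). rewrite S_INR. simpl pow. set (y := r ^ n * r ^ n) in *.
    replace (r * r ^ n * (r * r ^ n)) with (r * r * y) by (unfold y; ring).
    set (k := INR n) in *.
    assert (0 <= (1 - r * r) * (1 + (k + 1) * (y * (r * r)) - k * y - 2 * (y * r))).
    { apply Rmult_le_pos; auto. nra. }
    lra.
Qed.

(** Here r = |z| and s = |psi(z)|, and the worst case is s = 1. Once [pow_mean_ineq] has bounded the
    coefficient of 1 - s^2, the slack is n (1 - s)^2 (1 - x^2) / 2 with x = r^n. *)
Lemma schwarz_pick_combination (r s : R) (n : nat) : 0 <= r < 1 -> 0 <= s <= 1 -> (1 <= n)%nat ->
  (INR n * s + r * ((1 - s * s) / (1 - r * r))) * (1 - r ^ n * r ^ n) <=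
    INR n * (1 - r ^ n * s * (r ^ n * s)).
Proof.
  intros Hr Hs Hn. pose proof (pow_mean_ineq r n ltac:(lra)) as T.
  set (x := r ^ n) in *. assert (PN : 1 <= INR n) by (apply (le_INR 1); auto). set (k := INR n) in *.
  assert (Px : 0 <= x <= 1).
  { unfold x. split; [apply pow_le; lra|]. rewrite <- (pow1 n). apply pow_incr. lra. }
  assert (Pr : 0 < 1 - r * r) by nra.
  assert (A : r / (1 - r * r) * (1 - x * x) <= k * (1 + x * x) / 2).
  { replace (r / (1 - r * r) * (1 - x * x)) with (r * (1 - x * x) / (1 - r * r)) by (field; lra).
    apply Rle_div_l; auto. lra. }
  assert (0 <= 1 - s * s) by nra.
  apply Rmult_le_compat_l with (r := 1 - s * s) in A; auto.
  replace ((k * s + r * ((1 - s * s) / (1 - r * r))) * (1 - x * x)) with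
    (k * s * (1 - x * x) + (1 - s * s) * (r / (1 - r * r) * (1 - x * x))) by (field; lra).
  assert (0 <= k * ((1 - s) * (1 - s) * (1 - x * x)) / 2).
  { apply Rmult_le_pos; [|lra]. apply Rmult_le_pos; [lra|]. apply Rmult_le_pos; nra. }
  lra.
Qed.

(** The Cayley transform (p - 1) / (p + 1) maps the half-plane into the disc, and the factor z^n of
    p - 1 is divided out explicitly: psi = G / (p + 1). *)
Lemma Re_pos_schwarz (n : nat) (p G : C -> C) : hol G ->
  (forall z, inD z -> p z = (1 + Cpow z n * G z)%C) -> (forall z, inD z -> 0 < Re (p z)) ->
  exists psi, hol psi /\ (forall z, inD z -> Cmod (psi z) <= 1) /\
    forall z, inD z -> Cmod (Cpow z n * psi z) < 1 /\
      (p z * (1 - Cpow z n * psi z) = 1 + Cpow z n * psi z)%C.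
Proof.
  intros HG E P.
  assert (N : forall z, inD z -> (p z + 1 <> 0)%C).
  { intros z Hz Z. specialize (P z Hz). apply (f_equal Re) in Z. unfold Re in *. simpl in Z. lra. }
  assert (N' : forall z, inD z -> (1 + Cpow z n * G z + 1 <> 0)%C).
  { intros z Hz. rewrite <- E by auto. auto. }
  set (psi := fun z => (G z / (1 + Cpow z n * G z + 1))%C).
  assert (HP : hol psi).
  { apply hol_div; auto. apply hol_plus; [|apply hol_const]. apply hol_plus; [apply hol_const|].
    apply hol_mult; auto. apply (hol_pow (fun z => z)), hol_id. }
  assert (EP : forall z, inD z -> (Cpow z n * psi z = (p z - 1) / (p z + 1))%C).
  { intros z Hz. unfold psi. rewrite E by auto. field. auto. }
  assert (B : forall z, inD z -> Cmod (Cpow z n * psi z) < 1).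
  { intros z Hz. rewrite EP by auto. rewrite Cmod_div by auto.
    assert (Q : 0 < Cmod (p z + 1)) by (apply Cmod_gt_0; auto).
    apply Rlt_div_l; auto. rewrite Rmult_1_l. specialize (P z Hz).
    pose proof (Cmod_sqr (p z - 1)) as S1. pose proof (Cmod_sqr (p z + 1)) as S2.
    pose proof (Cmod_ge_0 (p z - 1)). unfold Re, Im in *. simpl in *. nra. }
  exists psi. split; auto. split.
  - apply (schwarz_lemma n); auto. intros z Hz. left. auto.
  - intros z Hz. split; auto. rewrite EP by auto. field. auto.
Qed.

Lemma Cmod_lt_1_minus_nonzero (u : C) : Cmod u < 1 -> (1 - u <> 0)%C.
Proof. intros H. apply Cmod_lt_neq. rewrite Cmod_1. exact H. Qed.

(** The image of |phi| <= x under (1 + phi) / (1 - phi), translated by -1. It rests on x^2 |1 -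
    phi|^2 - |phi - x^2|^2 = (1 - x^2) (x^2 - |phi|^2). *)
Lemma Re_pos_disc (n : nat) (p G : C -> C) (z : C) : hol G ->
  (forall z, inD z -> p z = (1 + Cpow z n * G z)%C) -> (forall z, inD z -> 0 < Re (p z)) ->
  (1 <= n)%nat -> inD z ->
  Cmod (p z - 1 - (2 * (Cmod z ^ n * Cmod z ^ n) / (1 - Cmod z ^ n * Cmod z ^ n))%R)
    <= 2 * Cmod z ^ n / (1 - Cmod z ^ n * Cmod z ^ n).
Proof.
  intros HG E P Hn Hz. destruct (Re_pos_schwarz n p G HG E P) as (psi & _ & B & K).
  destruct (K z Hz) as [L Ep]. specialize (B z Hz). unfold inD in Hz.
  pose proof (Cmod_ge_0 z) as Pz.
  set (x := Cmod z ^ n) in *. set (phi := (Cpow z n * psi z)%C) in *.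
  assert (Px : 0 <= x < 1).
  { unfold x. split; [apply pow_le; auto|]. destruct n; [lia|]. apply pow_lt_1_compat; [lra|lia]. }
  assert (Pp : Cmod phi <= x).
  { unfold phi, x. rewrite Cmod_mult, Cmod_pow. pose proof (pow_le (Cmod z) n Pz). nra. }
  assert (N := Cmod_lt_1_minus_nonzero phi L).
  assert (Nx : RtoC (1 - x * x) <> 0) by (apply RtoC_nonzero; nra).
  assert (Epz : (p z - 1 - (2 * (x * x) / (1 - x * x))%R)%C
    = (2 * (phi - (x * x)%R) / ((1 - phi) * (1 - x * x)%R))%C).
  { replace (p z) with ((1 + phi) / (1 - phi))%C.
    2:{ rewrite <- Ep. field. auto. }
    rewrite RtoC_div by nra. rewrite RtoC_minus, !RtoC_mult in *. field. auto. }
  rewrite Epz. rewrite Cmod_div by (apply Cmult_neq_0; auto). rewrite !Cmod_mult, !Cmod_R.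
  rewrite (Rabs_pos_eq 2), (Rabs_pos_eq (1 - x * x)) by nra.
  assert (Q : 0 < Cmod (1 - phi)) by (apply Cmod_gt_0; auto).
  assert (T : Cmod (phi - (x * x)%R) <= x * Cmod (1 - phi)).
  { pose proof (Cmod_sqr (phi - (x * x)%R)) as S1. pose proof (Cmod_sqr (1 - phi)) as S2.
    pose proof (Cmod_sqr phi) as S3. pose proof (Cmod_ge_0 (phi - (x * x)%R)).
    pose proof (Cmod_ge_0 phi).
    assert (Cmod phi * Cmod phi <= x * x) by nra.
    assert (0 <= x * x * (1 - x * x)) by (apply Rmult_le_pos; nra).
    assert (Cmod (phi - (x * x)%R) * Cmod (phi - (x * x)%R) <= x * x * (Cmod (1 - phi) * Cmod (1 - phi))).
    { rewrite S1, S2. unfold Re, Im in *. simpl in *.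
      assert (0 <= (1 - x * x) * (x * x - Cmod phi * Cmod phi)) by (apply Rmult_le_pos; nra).
      rewrite S3 in *. lra. }
    apply Rnot_lt_le. intros LL. assert (0 <= x * Cmod (1 - phi)) by (apply Rmult_le_pos; lra). nra. }
  assert (0 < 1 - x * x) by nra.
  apply Rle_div_l. { apply Rmult_lt_0_compat; auto. }
  replace (2 * x / (1 - x * x) * (Cmod (1 - phi) * (1 - x * x))) with (2 * (x * Cmod (1 - phi))) by (field; lra).
  lra.
Qed.

(** With phi = z^n psi one has z p'/p = 2 z phi' / (1 - phi^2) and z phi' = z^n (n psi + z psi').
    The Schwarz-Pick inequality bounds psi', and [schwarz_pick_combination] removes the dependence
    on |psi|. *)
Lemma Re_pos_logder (n : nat) (p G : C -> C) (z d : C) : hol G ->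
  (forall z, inD z -> p z = (1 + Cpow z n * G z)%C) -> (forall z, inD z -> 0 < Re (p z)) ->
  (1 <= n)%nat -> inD z -> cder p z d ->
  Cmod (z * d / p z) <= 2 * INR n * Cmod z ^ n / (1 - Cmod z ^ n * Cmod z ^ n).
Proof.
  intros HG E P Hn Hz D. destruct (Re_pos_schwarz n p G HG E P) as (psi & Hpsi & B & K).
  pose proof Hpsi as [psi' Hpsi'].
  destruct (Hpsi' z Hz) as [Dpsi _].
  pose proof (schwarz_pick psi z _ Hpsi B Hz Dpsi) as SP.
  destruct (K z Hz) as [L Ep].
  pose (phi := fun z => (Cpow z n * psi z)%C).
  assert (Dphi : cder phi z (INR n * Cpow z (pred n) * 1 * psi z + Cpow z n * psi' z)%C).
  { unfold phi. apply cder_mult; auto. apply (cder_pow (fun z => z)), cder_id. }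
  set (e := (INR n * Cpow z (pred n) * 1 * psi z + Cpow z n * psi' z)%C) in *.
  assert (N := Cmod_lt_1_minus_nonzero _ L). fold (phi z) in N, L, Ep.
  assert (D2 : cder p z (2 * e / ((1 - phi z) * (1 - phi z)))%C).
  { destruct (inD_nbhd z Hz) as (dl & Hdl & Kd).
    apply cder_ext_loc with (fun y => (1 + phi y) / (1 - phi y))%C dl; auto.
    - intros y Hy. destruct (K y (Kd y Hy)) as [Ly Epy]. fold (phi y) in *.
      rewrite <- Epy. field. apply Cmod_lt_1_minus_nonzero; auto.
    - eapply cder_eq.
      { apply cder_div; auto; [apply cder_plus|apply cder_minus]; try exact Dphi; apply cder_const. }
      cbv beta. field. auto. }
  rewrite (cder_unique _ _ _ _ D D2).
  assert (N1 : (1 + phi z <> 0)%C).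
  { replace (1 + phi z)%C with (1 - (- phi z))%C by ring. apply Cmod_lt_1_minus_nonzero.
    rewrite Cmod_opp. exact L. }
  assert (Epz : p z = ((1 + phi z) / (1 - phi z))%C) by (rewrite <- Ep; field; auto).
  rewrite Epz. clear D D2 Epz.
  replace (z * (2 * e / ((1 - phi z) * (1 - phi z))) / ((1 + phi z) / (1 - phi z)))%C
    with (2 * (z * e) / (1 - phi z * phi z))%C.
  2:{ field. repeat split; auto. replace (1 - phi z * phi z)%C with ((1 + phi z) * (1 - phi z))%C by ring.
      apply Cmult_neq_0; auto. }
  assert (Ee : (z * e = Cpow z n * (INR n * psi z + z * psi' z))%C).
  { unfold e. destruct n; [lia|]. change (pred (S n)) with n. rewrite !Cpow_S. ring. }
  rewrite Ee. unfold inD in Hz. pose proof (Cmod_ge_0 z) as Pz.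
  set (r := Cmod z) in *. set (s := Cmod (psi z)) in *.
  assert (Ps : 0 <= s <= 1) by (split; [apply Cmod_ge_0|apply B; exact Hz]).
  pose proof (schwarz_pick_combination r s n ltac:(lra) Ps Hn) as SC.
  set (x := r ^ n) in *.
  assert (Px : 0 <= x < 1).
  { unfold x. split; [apply pow_le; auto|]. destruct n; [lia|]. apply pow_lt_1_compat; [lra|lia]. }
  assert (Mphi : Cmod (phi z) = x * s) by (unfold phi; rewrite Cmod_mult, Cmod_pow; reflexivity).
  assert (Pr : 0 < 1 - r * r) by nra.
  assert (PN : 1 <= INR n) by (apply (le_INR 1); auto).
  assert (Hnum : Cmod (INR n * psi z + z * psi' z) <= INR n * s + r * ((1 - s * s) / (1 - r * r))).
  { eapply Rle_trans; [apply Cmod_triangle|]. rewrite !Cmod_mult, Cmod_R, Rabs_pos_eq by lra.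
    apply Rplus_le_compat; [right; reflexivity|]. apply Rmult_le_compat_l; auto.
    apply Rle_div_r; auto. }
  assert (Pxs : x * s * (x * s) < 1).
  { assert (x * s <= x * 1) by (apply Rmult_le_compat_l; lra). assert (0 <= x * s) by (apply Rmult_le_pos; lra). nra. }
  assert (Hden : 1 - x * s * (x * s) <= Cmod (1 - phi z * phi z)).
  { pose proof (Cmod_sub_ge 1 (phi z * phi z)) as T. rewrite Cmod_1, Cmod_mult, Mphi in T. exact T. }
  rewrite Cmod_div. 2:{ apply Cmod_gt_0. lra. }
  rewrite !Cmod_mult, Cmod_R, Rabs_pos_eq, Cmod_pow by lra. fold r x.
  apply Rle_div_l; [lra|]. assert (0 < 1 - x * x) by nra.
  set (num := Cmod (INR n * psi z + z * psi' z)) in *. set (den := Cmod (1 - phi z * phi z)) in *.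
  assert (M1 : num * (1 - x * x) <= INR n * den).
  { apply Rle_trans with ((INR n * s + r * ((1 - s * s) / (1 - r * r))) * (1 - x * x)).
    - apply Rmult_le_compat_r; lra.
    - eapply Rle_trans; [exact SC|]. apply Rmult_le_compat_l; lra. }
  replace (2 * INR n * x / (1 - x * x) * den) with (2 * x * (INR n * den) / (1 - x * x)) by (field; lra).
  apply (proj1 (Rle_div_r (2 * (x * num)) (2 * x * (INR n * den)) (1 - x * x) H)).
  apply Rmult_le_compat_l with (r := 2 * x) in M1; [|lra]. lra.
Qed.

(** V = (z g'/g - 1) + z p'/p. With b = 1 - alpha, the first term is b times a point of the disc of
    [Re_pos_disc], and the second has modulus at most 2 n x / (1 - x^2), which only enlarges the
    radius. *)
Lemma CS_logderiv (n : nat) (alpha : R) (f : C -> C) : (1 <= n)%nat -> 0 <= alpha < 1 -> CS n alpha f ->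
  exists V, hol V /\ V 0 = 0 /\
    (forall z, inD z -> z <> 0 -> f z <> 0 /\ exists d, cder f z d /\ (z * d / f z = 1 + V z)%C) /\
    forall z, inD z -> let x := Cmod z ^ n in
      Cmod (V z - (2 * (1 - alpha) * (x * x) / (1 - x * x))%R) <= 2 * (1 + INR n - alpha) * x / (1 - x * x).
Proof.
  intros Hn Ha (Af & g & [Ag Rg] & p & Pp & Epg).
  apply classA_hol in Af; auto. destruct Af as (Gf & _ & Ef).
  apply classA_hol in Ag; auto. destruct Ag as (G & HG & Eg).
  apply classP_hol in Pp; auto. destruct Pp as [(P & HP & Ep) Rp].
  pose (g1 := fun z => (1 + Cpow z n * G z)%C).
  assert (Eg1 : forall z, inD z -> g z = (z * g1 z)%C).
  { intros z Hz. rewrite Eg by auto. unfold g1. simpl. ring. }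
  assert (Z0 : Cpow 0 n = 0) by (destruct n; [lia|]; simpl; ring).
  assert (N1 : forall z, inD z -> g1 z <> 0).
  { intros z Hz. destruct (Ceq_dec z 0) as [->|Nz].
    - unfold g1. rewrite Z0. replace (1 + 0 * G 0)%C with (RtoC 1) by ring. apply C1_nz.
    - destruct (Rg z Hz Nz) as (q & [Ng _] & _). intros E. apply Ng. rewrite Eg1, E by auto. ring. }
  assert (Np : forall z, inD z -> p z <> 0).
  { intros z Hz E. specialize (Rp z Hz). rewrite E in Rp. unfold Re in Rp. simpl in Rp. lra. }
  destruct (hol_derivative G HG) as (G' & HG' & DG).
  assert (Hp : hol p).
  { apply hol_ext with (fun z => 1 + Cpow z n * P z)%C; [intros; symmetry; auto|].
    apply hol_plus; [apply hol_const|]. apply hol_mult; auto. apply (hol_pow (fun z => z)), hol_id. }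
  destruct (hol_derivative p Hp) as (p' & Hp' & Dp).
  assert (Hg1 : hol g1).
  { apply hol_plus; [apply hol_const|]. apply hol_mult; auto. apply (hol_pow (fun z => z)), hol_id. }
  assert (Dg1 : forall z, inD z -> cder g1 z (INR n * Cpow z (pred n) * G z + Cpow z n * G' z)%C).
  { intros z Hz. unfold g1. eapply cder_eq.
    { apply cder_plus; [apply cder_const|]. apply cder_mult; [apply (cder_pow (fun z => z)), cder_id|apply DG; auto]. }
    cbv beta. ring. }
  (* The quotient of z g'/g - 1 by z^n, written without dividing by z, so it is holomorphic at 0
     too. *)
  pose (H := fun z => ((INR n * G z + z * G' z) / g1 z)%C).
  assert (HH : hol H).
  { apply hol_div; auto. apply hol_plus; apply hol_mult; auto using hol_const, hol_id. }
  pose (Vg := fun z => (Cpow z n * H z)%C).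
  assert (HVg : hol Vg) by (apply hol_mult; auto; apply (hol_pow (fun z => z)), hol_id).
  assert (EVg : forall z, inD z -> (z * (INR n * Cpow z (pred n) * G z + Cpow z n * G' z) = Vg z * g1 z)%C).
  { intros z Hz. unfold Vg, H. destruct n; [lia|]. change (pred (S n)) with n. rewrite !Cpow_S. field. apply N1; auto. }
  assert (Ng : forall z, inD z -> z <> 0 -> g z <> 0).
  { intros z Hz Nz. rewrite Eg1 by auto. apply Cmult_neq_0; auto. }
  assert (EgV : forall z, inD z -> z <> 0 -> forall d, cder g z d -> (z * d / g z = 1 + Vg z)%C).
  { intros z Hz Nz d Dg.
    assert (D2 : cder g z (g1 z + z * (INR n * Cpow z (pred n) * G z + Cpow z n * G' z))%C).
    { destruct (inD_nbhd z Hz) as (dl & Hdl & K).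
      apply cder_ext_loc with (fun y => y * g1 y)%C dl; auto.
      { intros y Hy. symmetry. auto. }
      eapply cder_eq. { apply cder_mult; [apply cder_id|apply Dg1; auto]. } cbv beta. ring. }
    rewrite (cder_unique _ _ _ _ Dg D2), EVg, Eg1 by auto. field. auto. }
  exists (fun z => Vg z + z * p' z / p z)%C.
  split; [|split; [|split]].
  - apply hol_plus; auto. apply hol_div; auto. apply hol_mult; auto using hol_id.
  - unfold Vg. rewrite Z0. unfold Cdiv. ring.
  - intros z Hz Nz.
    assert (Efz : forall y, inD y -> f y = (y * g1 y * p y)%C).
    { intros y Hy. destruct (Ceq_dec y 0) as [->|Ny].
      - rewrite Ef by auto. simpl. ring.
      - rewrite (Epg y Hy Ny), <- Eg1 by auto. field. apply Ng; auto. }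
    split.
    + rewrite Efz by auto. repeat apply Cmult_neq_0; auto.
    + destruct (inD_nbhd z Hz) as (dl & Hdl & K).
      eexists. split.
      * apply cder_ext_loc with (fun y => y * g1 y * p y)%C dl; auto.
        { intros y Hy. symmetry. auto. }
        apply cder_mult; [apply cder_mult; [apply cder_id|apply Dg1; auto]|apply Dp; auto].
      * rewrite Efz by auto. cbv beta.
        set (e := (INR n * Cpow z (pred n) * G z + Cpow z n * G' z)%C).
        assert (Ee : (z * e = Vg z * g1 z)%C) by (apply EVg; auto).
        rewrite Ee. field. auto.
  - intros z Hz x.
    set (b := 1 - alpha). assert (Hb : 0 < b) by (unfold b; lra).
    assert (Nb : RtoC b <> 0) by (apply RtoC_nonzero; lra).
    assert (Px : 0 <= x < 1).
    { unfold x. split; [apply pow_le, Cmod_ge_0|]. destruct n; [lia|].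
      apply pow_lt_1_compat; [|lia]. split; [apply Cmod_ge_0|exact Hz]. }
    assert (0 < 1 - x * x) by nra.
    pose proof (Re_pos_logder n p P z (p' z) HP Ep Rp Hn Hz (Dp z Hz)) as B1.
    (* This is (z g'/g - alpha) / (1 - alpha), normalised to value 1 at 0 and of positive real
       part. *)
    pose proof (Re_pos_disc n (fun z => 1 + Cpow z n * (H z / b))%C (fun z => H z / b)%C z) as B2.
    cbv beta in B2. fold x in B1, B2.
    assert (B3 : Cmod (1 + Cpow z n * (H z / b) - 1 - (2 * (x * x) / (1 - x * x))%R) <= 2 * x / (1 - x * x)).
    { apply B2; auto.
      - apply hol_div; auto using hol_const.
      - intros y Hy. 
        replace (Re (1 + Cpow y n * (H y / b))%C) with ((Re (1 + Vg y)%C - alpha) / b).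
        2:{ replace (Cpow y n * (H y / b))%C with ((/ b)%R * Vg y)%C.
            2:{ unfold Vg. rewrite RtoC_inv by lra. field. auto. }
            replace (Re (1 + (/ b)%R * Vg y)%C) with (1 + / b * Re (Vg y)) by (unfold Re; simpl; ring).
            replace (Re (1 + Vg y)%C) with (1 + Re (Vg y)) by (unfold Re; simpl; ring).
            replace alpha with (1 - b) by (unfold b; ring). field. lra. }
        apply Rdiv_lt_0_compat; auto.
        destruct (Ceq_dec y 0) as [->|Ny].
        + unfold Vg. rewrite Z0. unfold Re. simpl. lra.
        + destruct (Rg y Hy Ny) as (q & [_ (d & Dd & <-)] & Hq).
          apply cder_is_derive in Dd. rewrite (EgV y Hy Ny d Dd) in Hq. lra. }
    replace (Vg z + z * p' z / p z - (2 * b * (x * x) / (1 - x * x))%R)%C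
      with (b * (1 + Cpow z n * (H z / b) - 1 - (2 * (x * x) / (1 - x * x))%R) + z * p' z / p z)%C.
    2:{ replace (2 * b * (x * x) / (1 - x * x)) with (b * (2 * (x * x) / (1 - x * x))) by (field; lra).
        rewrite (RtoC_mult b). unfold Vg. field. split; auto. }
    eapply Rle_trans; [apply Cmod_triangle|]. rewrite Cmod_mult, Cmod_R, Rabs_pos_eq by lra.
    apply Rmult_le_compat_l with (r := b) in B3; [|lra].
    replace (2 * (1 + INR n - alpha) * x / (1 - x * x))
      with (b * (2 * x / (1 - x * x)) + 2 * INR n * x / (1 - x * x)) by (unfold b; field; lra).
    lra.
Qed.

(** * The radius and its sharpness *)


(** A root of (2 (1 - alpha) - 1/e) x^2 - 2 A x + 1/e, with A = 1 + n - alpha. Keeping the square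
    root in the denominator covers both signs of the leading coefficient and the case where it
    vanishes. *)
Definition threshold (n : nat) (alpha : R) : R :=
  (/ exp 1) /
    (sqrt ((1 + INR n - alpha) ^ 2 - (/ exp 1) * (2 * (1 - alpha) - / exp 1))
     + 1 + INR n - alpha).

Lemma threshold_sqrt (n : nat) (alpha : R) : (1 <= n)%nat -> 0 <= alpha < 1 ->
  exists s, 1 < s /\ s * s = (1 + INR n - alpha) * (1 + INR n - alpha) - ie * (2 * (1 - alpha) - ie) /\
    threshold n alpha = ie / (s + (1 + INR n - alpha)).
Proof.
  intros Hn Ha. pose proof ie_bounds as HE. unfold threshold. fold ie.
  assert (PN : 1 <= INR n) by (apply (le_INR 1); auto).
  set (D := (1 + INR n - alpha) ^ 2 - ie * (2 * (1 - alpha) - ie)).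
  assert (HD : 1 < D).
  { unfold D. assert ((2 - alpha) * (2 - alpha) <= (1 + INR n - alpha) ^ 2) by (simpl; nra).
    assert (ie * (2 * (1 - alpha)) <= 1 * (2 * (1 - alpha))) by (apply Rmult_le_compat_r; lra). nra. }
  exists (sqrt D). split; [|split].
  - rewrite <- sqrt_1. apply sqrt_lt_1; lra.
  - rewrite sqrt_sqrt by lra. unfold D. ring.
  - f_equal. ring.
Qed.

(** The first upper bound leaves room just above the threshold for the sharpness argument; the
    second, from s > 1 and A >= 1 + (1 - alpha), keeps the centres of the discs small. *)
Lemma threshold_bounds (n : nat) (alpha : R) : (1 <= n)%nat -> 0 <= alpha < 1 ->
  0 < threshold n alpha < ie / (1 + INR n - alpha) /\ threshold n alpha < ie / (2 + (1 - alpha)).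
Proof.
  intros Hn Ha. pose proof ie_bounds as HE. assert (PN : 1 <= INR n) by (apply (le_INR 1); auto).
  destruct (threshold_sqrt n alpha Hn Ha) as (s & Hs & _ & ->).
  repeat split.
  - apply Rdiv_lt_0_compat; lra.
  - apply Rmult_lt_compat_l; [lra|]. apply Rinv_lt_contravar; [apply Rmult_lt_0_compat|]; lra.
  - apply Rmult_lt_compat_l; [lra|]. apply Rinv_lt_contravar; [apply Rmult_lt_0_compat|]; lra.
Qed.

(** With s the square root in the threshold, ie times the difference of the two sides is (ie - A
    x)^2 - s^2 x^2, which factors; both factors are positive for x < ie / (s + A). *)
Lemma below_threshold (n : nat) (alpha x : R) : (1 <= n)%nat -> 0 <= alpha < 1 ->
  0 <= x < threshold n alpha ->
  2 * (1 + INR n - alpha) * x - 2 * (1 - alpha) * (x * x) < ie * (1 - x * x).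
Proof.
  intros Hn Ha Hx. pose proof ie_bounds as HE. assert (PN : 1 <= INR n) by (apply (le_INR 1); auto).
  destruct (threshold_sqrt n alpha Hn Ha) as (s & Hs & Es & Et). rewrite Et in Hx.
  set (A := 1 + INR n - alpha) in *. assert (HA : 1 <= A) by (unfold A; lra).
  destruct Hx as [Hx0 Hx]. apply Rlt_div_r in Hx; [|lra].
  assert (0 < (ie - A * x - s * x) * (ie - A * x + s * x)).
  { apply Rmult_lt_0_compat; [lra|]. assert (0 <= s * x) by (apply Rmult_le_pos; lra). lra. }
  replace ((ie - A * x - s * x) * (ie - A * x + s * x)) with
    (ie * ie - 2 * A * x * ie + (A * A - s * s) * (x * x)) in H by ring.
  rewrite Es in H. nra.
Qed.

(** The same factorization; requiring x < ie / A keeps the factor ie - A x + s x positive, so that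
    only the other one changes sign. *)
Lemma above_threshold (n : nat) (alpha x : R) : (1 <= n)%nat -> 0 <= alpha < 1 ->
  threshold n alpha < x < ie / (1 + INR n - alpha) ->
  ie * (1 - x * x) < 2 * (1 + INR n - alpha) * x - 2 * (1 - alpha) * (x * x).
Proof.
  intros Hn Ha Hx. pose proof ie_bounds as HE. assert (PN : 1 <= INR n) by (apply (le_INR 1); auto).
  pose proof (threshold_bounds n alpha Hn Ha) as [[Pt _] _].
  destruct (threshold_sqrt n alpha Hn Ha) as (s & Hs & Es & Et). rewrite Et in *.
  set (A := 1 + INR n - alpha) in *. assert (HA : 1 <= A) by (unfold A; lra).
  destruct Hx as [Hx1 Hx2]. apply Rlt_div_l in Hx1; [|lra]. apply Rlt_div_r in Hx2; [|lra].
  assert (Px : 0 < x) by nra.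
  assert (0 < (s * x + A * x - ie) * (ie - A * x + s * x)).
  { apply Rmult_lt_0_compat; [lra|]. assert (0 <= s * x) by (apply Rmult_le_pos; lra). lra. }
  replace ((s * x + A * x - ie) * (ie - A * x + s * x)) with
    (- (ie * ie - 2 * A * x * ie + (A * A - s * s) * (x * x))) in H by ring.
  rewrite Es in H. nra.
Qed.

(** If the centre c satisfies c <= ie / 4 and the radius is below ie + c, the triangle inequality
    gives the distance bound ie + c + (ie / 4 - c): the real centres are aligned, so nothing is
    lost. *)
Lemma below_threshold_disc (n : nat) (alpha x : R) (v : C) : (1 <= n)%nat -> 0 <= alpha < 1 ->
  0 <= x < threshold n alpha ->
  Cmod (v - (2 * (1 - alpha) * (x * x) / (1 - x * x))%R) <= 2 * (1 + INR n - alpha) * x / (1 - x * x) ->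
  Cmod (v - (ie / 4)%R) < ie / 4 + ie.
Proof.
  intros Hn Ha Hx Hv. pose proof ie_bounds as HE.
  pose proof (below_threshold n alpha x Hn Ha Hx) as B.
  pose proof (threshold_bounds n alpha Hn Ha) as [_ T].
  assert (Hx2 : x < ie / (2 + (1 - alpha))) by lra.
  apply Rlt_div_r in Hx2; [|lra].
  set (b := 1 - alpha) in *. assert (Hb : 0 < b <= 1) by (unfold b; lra).
  assert (Hx3 : x * (2 + b) <= 4 / 9) by lra.
  assert (Hx4 : x <= 2 / 9) by nra.
  assert (Pq : 0 < 1 - x * x) by nra.
  set (c := 2 * b * (x * x) / (1 - x * x)) in *.
  (* Uses x <= ie / 2 and x <= 2/9, so 2 b x^2 <= 2 ie / 9, which is below ie (1 - x^2) / 4. *)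
  assert (Hc : c <= ie / 4).
  { unfold c. apply Rle_div_l; auto.
    assert (x * 2 <= ie) by nra.
    assert (x * x <= ie / 2 * (2 / 9)) by (apply Rmult_le_compat; lra).
    assert (b * (x * x) <= 1 * (x * x)) by (apply Rmult_le_compat_r; nra).
    nra. }
  assert (Hr : 2 * (1 + INR n - alpha) * x / (1 - x * x) < ie + c).
  { apply Rlt_div_l; auto. unfold c.
    replace ((ie + 2 * b * (x * x) / (1 - x * x)) * (1 - x * x)) with (ie * (1 - x * x) + 2 * b * (x * x))
      by (field; lra). lra. }
  pose proof (Cmod_minus_triangle v c (ie / 4)%R) as Tr.
  rewrite <- RtoC_minus, Cmod_R, Rabs_left1 in Tr by lra. lra.
Qed.

(** * Dilations *)

Lemma dilate_classA (n : nat) (r : R) (f : C -> C) : (1 <= n)%nat -> 0 < r <= 1 ->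
  classA n f -> classA n (dilate r f).
Proof.
  intros Hn Hr H. apply classA_hol in H; auto. destruct H as (G & HG & E).
  apply classA_hol; auto. exists (fun z => Cpow r n * G (r * z))%C.
  assert (D : forall z, inD z -> inD (r * z)%C).
  { unfold inD. intros z Hz. rewrite Cmod_mult, Cmod_R, Rabs_pos_eq by lra. pose proof (Cmod_ge_0 z). nra. }
  split.
  - apply hol_mult; [apply hol_const|]. apply (hol_comp G (fun z => r * z)%C); auto.
    apply hol_mult; [apply hol_const|apply hol_id].
  - intros z Hz. unfold dilate. rewrite E by auto. rewrite Cpow_mult_l. rewrite !Cpow_S.
    field. apply RtoC_nonzero. lra.
Qed.

Lemma cder_dilate (r : R) (f : C -> C) (z d : C) : r <> 0 -> cder f (r * z)%C d -> cder (dilate r f) z d.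
Proof.
  intros Hr H. unfold dilate. pose proof (RtoC_nonzero r Hr) as N.
  apply cder_ext with (fun y => / r * f (r * y))%C. { intros. field. auto. }
  eapply cder_eq.
  { apply cder_scal. apply (cder_comp f (fun y => r * y)%C); [exact H|]. apply cder_scal, cder_id. }
  field. auto.
Qed.

Lemma Rpower_root (x : R) (n : nat) : (1 <= n)%nat -> 0 < x -> 0 < Rpower x (1 / INR n) /\ Rpower x (1 / INR n) ^ n = x.
Proof.
  intros Hn Hx. assert (PN : 1 <= INR n) by (apply (le_INR 1); auto).
  split; [apply exp_pos|]. rewrite <- Rpower_pow by apply exp_pos. rewrite Rpower_mult.
  replace (1 / INR n * INR n) with 1 by (field; lra). apply Rpower_1. auto.
Qed.

Lemma pow_lt_compat (a b : R) (n : nat) : (1 <= n)%nat -> 0 <= a < b -> a ^ n < b ^ n.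
Proof.
  intros Hn H. induction n as [|n IH]; [lia|]. destruct n as [|n]; [simpl; lra|].
  specialize (IH ltac:(lia)). rewrite <- !(tech_pow_Rmult _ (S n)).
  apply Rmult_le_0_lt_compat; try lra. apply pow_le. lra.
Qed.

Lemma pow_lt_inv (a b : R) (n : nat) : 0 <= b -> a ^ n < b ^ n -> a < b.
Proof.
  intros Hb H. apply Rnot_le_lt. intros L. apply (Rlt_not_le _ _ H). apply pow_incr. lra.
Qed.

Lemma CS_dilate_Swp (n : nat) (alpha r : R) (f : C -> C) : (1 <= n)%nat -> 0 <= alpha < 1 ->
  0 < r <= 1 -> r ^ n <= threshold n alpha -> CS n alpha f -> Swp n (dilate r f).
Proof.
  intros Hn Ha Hr Ht Hf. split. { apply dilate_classA; auto. apply Hf. }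
  destruct (CS_logderiv n alpha f Hn Ha Hf) as (V & HV & V0 & LD & B).
  assert (Nr : RtoC r <> 0) by (apply RtoC_nonzero; lra).
  assert (Mz : forall z, Cmod (r * z) = r * Cmod z) by (intros; rewrite Cmod_mult, Cmod_R, Rabs_pos_eq; lra).
  assert (D : forall z, inD z -> inD (r * z)%C).
  { unfold inD. intros z Hz. rewrite Mz. pose proof (Cmod_ge_0 z). nra. }
  destruct (wexp_lift (fun z => V (r * z)%C)) as (w & Hw & Pw).
  - apply (hol_comp V (fun z => r * z)%C); auto. apply hol_mult; [apply hol_const|apply hol_id].
  - intros z Hz. apply (below_threshold_disc n alpha (Cmod (r * z)%C ^ n)); auto.
    (* Since |z| < 1 the inequality is strict even when [r ^ n] equals the threshold, so the radius
       itself is admissible. *)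
    + split; [apply pow_le, Cmod_ge_0|]. eapply Rlt_le_trans; [|exact Ht].
      rewrite Mz, Rpow_mult_distr. assert (0 < r ^ n) by (apply pow_lt; lra).
      assert (Cmod z ^ n < 1).
      { destruct n; [lia|]. apply pow_lt_1_compat; [|lia]. split; [apply Cmod_ge_0|exact Hz]. }
      nra.
  - exists w. split; [split; [|split]|].
    + exists (taylor_coef w). apply (taylor w Hw).
    + destruct (Pw 0 inD_0) as [_ E]. replace (r * 0)%C with (RtoC 0) in E by ring.
      rewrite V0 in E. unfold wexp in E.
      apply NNPP. intros N. apply (Cmult_neq_0 _ _ N (cexp_nonzero (w 0))). exact E.
    + apply Pw.
    + intros z Hz Nz. destruct (LD (r * z)%C (D z Hz) (Cmult_neq_0 _ _ Nr Nz)) as [Nf (d & Dd & Ed)].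
      split.
      * unfold dilate. intros E. apply Nf.
        replace (f (r * z)%C) with (f (r * z) / r * r)%C by (field; auto). rewrite E. ring.
      * exists d. split; [apply cder_is_derive, cder_dilate; auto; lra|].
        destruct (Pw z Hz) as [_ Ew]. unfold wp. change (w z * cexp (w z))%C with (wexp (w z)).
        rewrite Ew, <- Ed. unfold dilate. field. auto.
Qed.

(** * The extremal function *)

Lemma hol_primitive (f : C -> C) : hol f ->
  exists F, hol F /\ F 0 = 0 /\ forall z, inD z -> cder F z (f z).
Proof.
  intros Hf. pose proof (taylor f Hf) as T. set (c := taylor_coef f) in *.
  (* Termwise integration of the Taylor series; its derived series gives back the coefficients
     [c]. *)
  pose (a := fun k => match k with O => RtoC 0 | S j => (c j / INR (S j))%C end).
  assert (NS : forall k, RtoC (INR (S k)) <> 0).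
  { intros k. apply RtoC_nonzero. apply not_0_INR. lia. }
  assert (EX : forall z, exists l : C, inD z -> is_series (fun k => a k * Cpow z k)%C l).
  { intros z. destruct (classic (inD z)) as [Hz|Hz]; [|exists (RtoC 0); intros; contradiction].
    assert (E : ex_series (V := C_CompleteNormedModule) (fun k => c k / INR (S k) * Cpow z k)%C).
    { apply ex_series_le with (fun k => Rabs (Cmod (c k) * Cmod z ^ k)).
      - intros k. match goal with |- _ <= ?r => change (Cmod (c k / INR (S k) * Cpow z k) <= r) end.
        rewrite Cmod_mult, Cmod_pow, Cmod_div, Cmod_R by auto.
        assert (1 <= INR (S k)) by (apply (le_INR 1); lia).
        rewrite (Rabs_pos_eq (INR (S k))) by lra.
        rewrite Rabs_pos_eq by (apply Rmult_le_pos; [apply Cmod_ge_0|apply pow_le, Cmod_ge_0]).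
        apply Rmult_le_compat_r; [apply pow_le, Cmod_ge_0|].
        apply Rle_div_l; [lra|]. pose proof (Cmod_ge_0 (c k)). nra.
      - apply (CV_disk_inside (fun k => Cmod (c k))). apply (psum_CV_radius c f); auto.
        split; [apply Cmod_ge_0|exact Hz]. }
    destruct E as [l Hl]. exists (0 + z * l)%C. intros _.
    apply is_series_decr_1.
    match goal with |- is_series _ ?x => replace x with (@scal C_Ring C_ModuleSpace z l) end.
    2:{ change (z * l = 0 + z * l + - (0 * 1))%C. ring. }
    apply (is_series_scal z) in Hl. revert Hl. apply is_series_ext.
    intros k. rewrite Cpow_S. 
    change (z * (c k / INR (S k) * Cpow z k) = c k / INR (S k) * (z * Cpow z k))%C. ring. }
  destruct (functional_choice (fun z (l : C) => inD z -> is_series (fun k => a k * Cpow z k)%C l) EX) as [F HF].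
  assert (PF : psum a F) by exact HF.
  exists F. split; [eapply psum_hol; eauto|]. split; [rewrite (psum_at_0 a F PF); reflexivity|].
  destruct (psum_derive a F PF) as (F' & PF' & DF).
  intros z Hz. replace (f z) with (F' z); auto.
  apply (is_series_unique_C (fun k => c k * Cpow z k)%C); [|apply T; auto].
  generalize (PF' z Hz). apply is_series_ext. intros k.
  change (INR (S k) * (c k / INR (S k)) * Cpow z k = c k * Cpow z k)%C. field. apply NS.
Qed.

(** The quotient q satisfies 1 - q = u (1 + q), so it is closer to 1 than to -1. *)
Lemma Re_cayley_pos (u : C) : Cmod u < 1 -> (1 + u <> 0)%C /\ 0 < Re ((1 - u) / (1 + u))%C.
Proof.
  intros H. assert (N : (1 + u <> 0)%C).
  { replace (1 + u)%C with (1 - (- u))%C by ring. apply Cmod_lt_1_minus_nonzero. rewrite Cmod_opp. auto. }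
  split; auto. set (q := ((1 - u) / (1 + u))%C).
  assert (E : (1 - q = u * (1 + q))%C) by (unfold q; field; auto).
  assert (N1 : (1 + q <> 0)%C).
  { intros Z. rewrite Z in E. assert (Q : RtoC 2 = ((1 - q) + (1 + q))%C) by ring.
    rewrite Z, E in Q. replace (u * 0 + 0)%C with (RtoC 0) in Q by ring. apply RtoC_inj in Q. lra. }
  apply (f_equal Cmod) in E. rewrite Cmod_mult in E.
  assert (P : 0 < Cmod (1 + q)) by (apply Cmod_gt_0; auto).
  pose proof (Cmod_ge_0 u). pose proof (Cmod_ge_0 (1 - q)).
  assert (L : Cmod (1 - q) < Cmod (1 + q)) by nra.
  pose proof (Cmod_sqr (1 - q)) as S1. pose proof (Cmod_sqr (1 + q)) as S2.
  unfold Re, Im in *. simpl in *. nra.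
Qed.

Lemma Cmod_pow_lt_1 (z : C) (n : nat) : (1 <= n)%nat -> inD z -> Cmod (Cpow z n) < 1.
Proof.
  intros Hn Hz. rewrite Cmod_pow. destruct n; [lia|]. apply pow_lt_1_compat; [|lia].
  split; [apply Cmod_ge_0|exact Hz].
Qed.

(* [f = z (1 - z^n) / (1 + z^n)^(1 + 2 (1 - alpha) / n)]; the power is built as the exponential of a
   primitive of [1 / (1 + u)]. *)
Lemma CS_extremal (n : nat) (alpha : R) : (1 <= n)%nat -> 0 <= alpha < 1 ->
  exists f, CS n alpha f /\ forall z, inD z -> z <> 0 -> f z <> 0 /\ exists d, cder f z d /\
    (z * d / f z = 1 - 2 * (1 - alpha)%R * Cpow z n / (1 + Cpow z n)
       - 2 * INR n * Cpow z n / ((1 + Cpow z n) * (1 - Cpow z n)))%C.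
Proof.
  intros Hn Ha. assert (PN : 1 <= INR n) by (apply (le_INR 1); auto).
  set (b := 1 - alpha). assert (Hb : 0 < b) by (unfold b; lra).
  assert (NN : RtoC (INR n) <> 0) by (apply RtoC_nonzero; lra).
  destruct (hol_primitive (fun u => 1 / (1 + u))%C) as (L & HL & L0 & DL).
  { apply hol_div; [apply hol_const|apply hol_plus; [apply hol_const|apply hol_id]|].
    intros u Hu. apply Re_cayley_pos. exact Hu. }
  (* Thus h(u) = (1 + u)^beta. Differentiating h(z^n) brings out a factor n, which cancels the one
     in [beta] and leaves z g'/g = 1 - 2 b z^n / (1 + z^n). *)
  pose (beta := (- (2 * b / INR n))%R).
  pose (h := fun u => cexp (beta * L u)).
  assert (Hh : hol h) by (apply hol_cexp, hol_mult; auto using hol_const).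
  assert (Nh : forall u, h u <> 0) by (intros; apply cexp_nonzero).
  assert (Dh : forall u, inD u -> cder h u (h u * (beta * (1 / (1 + u))))%C).
  { intros u Hu. unfold h. apply (cder_comp cexp (fun u => beta * L u)%C); [apply cder_cexp|].
    apply cder_scal, DL, Hu. }
  assert (Hh1 : hol (fun u => h u - 1)%C) by (apply hol_minus; auto using hol_const).
  (* Since h(0) = 1, h(u) = 1 + u h2(u); substituting u = z^n puts g in the form required by
     [classA_hol]. *)
  destruct (psum_factor 1 _ _ (taylor _ Hh1)) as (h2 & Hh2 & Eh).
  { intros k Hk. replace k with 0%nat by lia. rewrite <- (psum_at_0 _ _ (taylor _ Hh1)).
    unfold h. rewrite L0. replace (beta * 0)%C with (RtoC 0) by ring. rewrite cexp_0. ring. }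
  assert (Dn : forall z, inD z -> inD (Cpow z n)) by (intros; apply Cmod_pow_lt_1; auto).
  assert (Hpow : hol (fun z => Cpow z n)) by apply (hol_pow (fun z => z)), hol_id.
  assert (Ng1 : forall z, inD z -> (1 + Cpow z n <> 0)%C) by (intros; apply Re_cayley_pos, Dn; auto).
  assert (Np1 : forall z, inD z -> (1 - Cpow z n <> 0)%C) by (intros; apply Cmod_lt_1_minus_nonzero, Dn; auto).
  pose (A := fun z => h2 (Cpow z n)).
  assert (HA : hol A) by (apply (hol_comp h2 (fun z => Cpow z n)); auto).
  assert (EA : forall z, inD z -> h (Cpow z n) = (1 + Cpow z n * A z)%C).
  { intros z Hz. unfold A. replace (h (Cpow z n)) with (1 + (h (Cpow z n) - 1))%C by ring.
    rewrite Eh by auto. simpl. ring. }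
  pose (B := fun z => (- (2) / (1 + Cpow z n))%C).
  assert (HB : hol B).
  { apply hol_div; auto using hol_const. apply hol_plus; auto using hol_const. }
  pose (g := fun z => (z * h (Cpow z n))%C).
  pose (p := fun z => ((1 - Cpow z n) / (1 + Cpow z n))%C).
  assert (EB : forall z, inD z -> p z = (1 + Cpow z n * B z)%C).
  { intros z Hz. unfold p, B. field. auto. }
  assert (Ng : forall z : C, z <> 0 -> g z <> 0) by (intros; apply Cmult_neq_0; auto).
  assert (Np : forall z, inD z -> p z <> 0).
  { intros z Hz. unfold p, Cdiv. apply Cmult_neq_0; auto. intros E.
    apply C1_nz. rewrite <- (Cinv_r (1 + Cpow z n)) by auto. rewrite E. ring. }
  pose (dn := fun z => (INR n * Cpow z (pred n) * 1)%C).
  assert (Dpow : forall z, cder (fun z => Cpow z n) z (dn z)).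
  { intros z. apply (cder_pow (fun z => z)), cder_id. }
  assert (Edn : forall z, (z * dn z = INR n * Cpow z n)%C).
  { intros z. unfold dn. destruct n; [lia|]. change (pred (S n)) with n. rewrite Cpow_S. ring. }
  pose (dg := fun z => (1 * h (Cpow z n) + z * (h (Cpow z n) * (beta * (1 / (1 + Cpow z n))) * dn z))%C).
  assert (Dg : forall z, inD z -> cder g z (dg z)).
  { intros z Hz. unfold g, dg. apply (cder_mult (fun z => z) (fun z => h (Cpow z n))); [apply cder_id|].
    apply (cder_comp h (fun z => Cpow z n)); auto. }
  assert (Eb : (beta * INR n = - (2 * b)%R)%C).
  { unfold beta. rewrite <- RtoC_mult, <- RtoC_opp. f_equal. field. lra. }
  assert (Eg : forall z, inD z -> z <> 0 -> (z * dg z / g z = 1 - 2 * b * Cpow z n / (1 + Cpow z n))%C).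
  { intros z Hz Nz. unfold dg, g.
    transitivity (1 + (beta * (z * dn z)) / (1 + Cpow z n))%C; [field; auto|].
    rewrite Edn. rewrite Cmult_assoc, Eb, RtoC_mult. field. auto. }
  pose (dp := fun z => (((0 - dn z) * (1 + Cpow z n) - (1 - Cpow z n) * (0 + dn z)) / ((1 + Cpow z n) * (1 + Cpow z n)))%C).
  assert (Dp : forall z, inD z -> cder p z (dp z)).
  { intros z Hz. unfold p, dp.
    apply (cder_div (fun z => 1 - Cpow z n)%C (fun z => 1 + Cpow z n)%C); auto.
    - apply cder_minus; auto. apply cder_const.
    - apply cder_plus; auto. apply cder_const. }
  assert (Ep : forall z, inD z -> (z * dp z / p z = - (2 * INR n * Cpow z n / ((1 + Cpow z n) * (1 - Cpow z n))))%C).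
  { intros z Hz. unfold dp, p.
    transitivity (- (2 * (z * dn z) / ((1 + Cpow z n) * (1 - Cpow z n))))%C; [field; auto|].
    rewrite Edn. field. auto. }
  exists (fun z => g z * p z)%C. split.
  - split; [|exists g; split; [split|exists p; split]].
    + apply classA_hol; auto. exists (fun z => A z + B z + Cpow z n * A z * B z)%C. split.
      * apply hol_plus; [apply hol_plus; auto|]. apply hol_mult; auto. apply hol_mult; auto.
      * intros z Hz. rewrite EB by auto. unfold g. rewrite EA by auto. rewrite Cpow_S. ring.
    + apply classA_hol; auto. exists A. split; auto.
      intros z Hz. unfold g. rewrite EA by auto. rewrite Cpow_S. ring.
    + intros z Hz Nz. exists (1 - 2 * b * Cpow z n / (1 + Cpow z n))%C. split.
      * split; auto. exists (dg z). split; [apply cder_is_derive; auto|auto].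
      * destruct (Re_cayley_pos (Cpow z n) (Dn z Hz)) as [_ R].
        replace (1 - 2 * b * Cpow z n / (1 + Cpow z n))%C
          with ((1 - b)%R + b * ((1 - Cpow z n) / (1 + Cpow z n)))%C
          by (rewrite RtoC_minus; field; auto).
        set (q := ((1 - Cpow z n) / (1 + Cpow z n))%C) in *.
        replace (Re ((1 - b)%R + b * q)%C) with (1 - b + b * Re q) by (unfold Re; simpl; ring).
        assert (0 < b * Re q) by (apply Rmult_lt_0_compat; auto). unfold b in *. lra.
    + apply classP_hol; auto. split; [exists B; auto|]. intros z Hz. apply Re_cayley_pos, Dn, Hz.
    + intros z Hz Nz. field. auto.
  - intros z Hz Nz. split; [apply Cmult_neq_0; auto|].
    exists (dg z * p z + g z * dp z)%C. split; [apply cder_mult; auto|].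
    transitivity (z * dg z / g z + z * dp z / p z)%C; [field; auto|].
    rewrite Eg, Ep by auto. reflexivity.
Qed.

Theorem mainTheorem8 (n : nat) (alpha : R) :
  (1 <= n)%nat -> 0 <= alpha < 1 ->
  is_radius (Swp n) (CS n alpha)
    (Rpower
       ((/ exp 1) /
        (sqrt ((1 + INR n - alpha) ^ 2 - (/ exp 1) * (2 * (1 - alpha) - / exp 1))
         + 1 + INR n - alpha))
       (1 / INR n)).
Proof.
  intros Hn Ha. fold (threshold n alpha).
  pose proof ie_bounds as HE. assert (PN : 1 <= INR n) by (apply (le_INR 1); auto).
  destruct (threshold_bounds n alpha Hn Ha) as [[T0 T1] T2].
  assert (T3 : threshold n alpha < 1).
  { eapply Rlt_le_trans; [exact T2|]. apply Rle_div_l; lra. }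
  destruct (Rpower_root (threshold n alpha) n Hn T0) as [P0 P1].
  set (r0 := Rpower (threshold n alpha) (1 / INR n)) in *.
  assert (R1 : r0 < 1). { apply (pow_lt_inv r0 1 n); [lra|]. rewrite pow1, P1. auto. }
  split; [lra|]. split.
  - intros r Hr f Hf. apply (CS_dilate_Swp n alpha); auto; [lra|].
    rewrite <- P1. apply pow_incr. lra.
  - intros r1 Hr1 HP. apply Rnot_lt_le. intros L.
    destruct (CS_extremal n alpha Hn Ha) as (f & Hf & LD).
    destruct (HP r1 ltac:(lra) f Hf) as [_ (w & [_ [_ Hw]] & Hlog)].
    assert (L1 : threshold n alpha < r1 ^ n) by (rewrite <- P1; apply pow_lt_compat; auto; lra).
    set (A := 1 + INR n - alpha) in *.
    (* A value X between the threshold and [m] stays in the range of [above_threshold], and its n-th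
       root s is below r1, so s / r1 is a point of the disc at which the dilated function can be
       tested. *)
    set (m := Rmin (r1 ^ n) (ie / A)).
    assert (M0 : threshold n alpha < m) by (unfold m; apply Rmin_case; auto).
    assert (M1 : m <= r1 ^ n) by apply Rmin_l. assert (M2 : m <= ie / A) by apply Rmin_r.
    set (X := (threshold n alpha + m) / 2).
    assert (HX : threshold n alpha < X < m) by (unfold X; lra).
    destruct (Rpower_root X n Hn ltac:(lra)) as [S0 S1].
    set (s := Rpower X (1 / INR n)) in *.
    assert (Hs : s < r1) by (apply (pow_lt_inv s r1 n); lra).
    assert (Nr1 : RtoC r1 <> 0) by (apply RtoC_nonzero; lra).
    assert (Es : (r1 * (s / r1)%R)%C = s) by (rewrite <- RtoC_mult; f_equal; field; lra).
    assert (Ht : 0 < s / r1 < 1).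
    { split; [apply Rdiv_lt_0_compat; lra|]. apply Rlt_div_l; lra. }
    assert (Dt : inD (s / r1)%R) by (unfold inD; rewrite Cmod_R, Rabs_pos_eq; lra).
    assert (Ds : inD s) by (unfold inD; rewrite Cmod_R, Rabs_pos_eq; lra).
    assert (Ns : RtoC s <> 0) by (apply RtoC_nonzero; lra).
    destruct (Hlog (s / r1)%R Dt) as [_ (d & Dd & Ed)]. { apply RtoC_nonzero. lra. }
    destruct (LD s Ds Ns) as [Nf (d' & Dd' & Ed')].
    apply cder_is_derive in Dd.
    assert (Dd2 : cder (dilate r1 f) (s / r1)%R d') by (apply cder_dilate; [lra|rewrite Es; auto]).
    rewrite (cder_unique _ _ _ _ Dd Dd2) in Ed. unfold dilate in Ed. rewrite Es in Ed.
    replace ((s / r1)%R * d' / (f s / r1))%C with (s * d' / f s)%C in Ed.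
    2:{ rewrite RtoC_div by lra. field. auto. }
    rewrite Ed' in Ed. rewrite <- RtoC_pow, S1 in Ed.
    assert (X1 : X < 1).
    { eapply Rlt_le_trans; [apply HX|]. eapply Rle_trans; [exact M1|].
      rewrite <- (pow1 n). apply pow_incr. lra. }
    assert (PX : 0 < 1 - X * X) by nra.
    assert (N1 : (1 + X <> 0)%C) by (rewrite <- RtoC_plus; apply RtoC_nonzero; lra).
    assert (N2 : (1 - X <> 0)%C) by (rewrite <- RtoC_minus; apply RtoC_nonzero; lra).
    (* The value of z f'/f - 1 at z = s for the extremal function: real, and exactly the leftmost
       point of the disc for x = X. *)
    set (y := - ((2 * A * X - 2 * (1 - alpha) * (X * X)) / (1 - X * X))).
    assert (Ey : wexp (w (s / r1)%R) = RtoC y).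
    { unfold wp in Ed. change (w (s / r1)%R * cexp (w (s / r1)%R))%C with (wexp (w (s / r1)%R)) in Ed.
      replace (wexp (w (s / r1)%R)) with (1 + wexp (w (s / r1)%R) - 1)%C by ring. rewrite <- Ed.
      assert (N3 : (1 - X * X <> 0)%C).
      { replace (1 - X * X)%C with ((1 + X) * (1 - X))%C by ring. apply Cmult_neq_0; auto. }
      unfold y, A. rewrite RtoC_opp, RtoC_div by lra.
      repeat rewrite ?RtoC_minus, ?RtoC_plus, ?RtoC_mult. field. auto. }
    apply wexp_real_value in Ey; [|apply Hw, Dt].
    pose proof (above_threshold n alpha X Hn Ha) as AT. fold A in AT. specialize (AT ltac:(lra)).
    assert (ie < (2 * A * X - 2 * (1 - alpha) * (X * X)) / (1 - X * X)) by (apply Rlt_div_r; auto).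
    unfold y in Ey. lra.
Qed.
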